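(* Let $V:\mathbb{R}^2\to\mathbb{R}$ satisfy $V,\partial_xV\in C(\mathbb{R}^2)$ and suppose there are constants $\eta_0>0$, $\tfrac12<s<\tfrac34$, $A_0>0$, $A_1>0$ such that $$\operatorname{supp}(V)\subset\{(x,y)\in\mathbb{R}^2:\ -\eta_0\le y\le \eta_0\},$$ $$\sup_{x,y\in\mathbb{R}}\langle x\rangle^{2s}|V(x,y)|\le A_0,\qquad \sup_{x,y\in\mathbb{R}}\langle x\rangle|\partial_xV(x,y)|\le A_1 .$$ Put $\gamma=2s-1$. Let $R=\max\{R_1,R_2\}$ with $R_1,R_2$ as in the context, and let $C_{R,\gamma}>0$ be the constant (independent of $\eta_0$) in the estimate $$\sup_{\lambda\in[-R,R],\,\nu>0}\Big\||y|^{-\gamma}F\Big(\frac{y}{\eta_0}\Big)\langle x\rangle^{-1/2-\gamma/2}(H_0-\lambda\mp i\nu)^{-1}\langle x\rangle^{-1/2-\gamma/2}F\Big(\frac{y}{\eta_0}\Big)|y|^{-\gamma}\Big\|_{L^2\to L^2}\le C_{R,\gamma}.$$ Assume that $$\eta_0^{2\gamma}\,C_{R,\gamma}\,A_0<1 .$$ Then the operator $H=H_0+V$ has no embedded eigenvalues, i.e. $H$ has no eigenvalue $\lambda\in\mathbb{R}$.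
   Context: Notation: $D_x=-i\partial_x$, $D_y=-i\partial_y$, $\langle t\rangle=(1+t^2)^{1/2}$, $L^2=L^2(\mathbb{R}^2)$. $H_0=(D_x+y)^2+D_y^2+x$ and $H=H_0+V$ are the self-adjoint operators on $L^2(\mathbb{R}^2)$ with common domain $\mathcal D(H)=\mathcal D(H_0)$ (closures from $C_0^\infty(\mathbb{R}^2)$), $V$ acting by multiplication. $F\in C_0^\infty(\mathbb{R};[0,1])$ is a fixed cut-off with $F(t)=1$ for $|t|\le1$ and $F(t)=0$ for $|t|\ge2$. $\sigma_{pp}(H)$ denotes the point spectrum (set of eigenvalues) of $H$. The numbers $R_1,R_2$: one has $R_1=C_1+\|V\|_{L^\infty}$ and $R_2=C_2\|\langle x\rangle\langle y\rangle\partial_xV\|_{L^\infty}^8$, where $C_1,C_2>0$ are constants independent of $\eta_0$ and $V$, chosen so that $\sigma_{pp}(H)\cap\big((-\infty,-R_1)\cup(R_2,\infty)\big)=\emptyset$. *)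

(* Defs.v *)
From HB Require Import structures.
From mathcomp Require Import all_boot all_order all_algebra.
From mathcomp Require Import all_classical all_reals all_analysis.
From mathcomp Require Import complex.

Set Implicit Arguments.
Unset Strict Implicit.
Unset Printing Implicit Defensive.

Import Order.TTheory GRing.Theory Num.Theory.
Import numFieldNormedType.Exports.

Local Open Scope classical_set_scope.
Local Open Scope complex_scope.
Local Open Scope ring_scope.

Section Defs.
Context {R : realType}.

Notation cfun := (R * R -> R[i]).

Definition bracket (t : R) : R := Num.sqrt (1 + t ^+ 2).

(* [leb2] lives on the Borel sets of the plane: every Lebesgue class has a
   Borel representative. *)
Definition leb2 :
    {measure set (measurableTypeR R * measurableTypeR R) -> \bar R} :=
  (lebesgue_measure \x lebesgue_measure)%E.

(* Elements of $L^2(\mathbb{R}^2;\mathbb{C})$ are represented by functions;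
   the norms and the graphs of [H0] and [H] below do not distinguish functions
   that are equal almost everywhere. *)
Definition L2 (f : cfun) : Prop :=
  ((fun p => complex.Re (f p)) \in Lfun leb2 2%:E) /\
  ((fun p => complex.Im (f p)) \in Lfun leb2 2%:E).

Definition L2norm (f : cfun) : \bar R :=
  'N[leb2]_2%:E[EFin \o (@Normc.normc R \o f)]%E.

(* The value is meant only for essentially bounded [f]: [fine] sends the norm
   of an unbounded function to 0. *)
Definition Linfty_norm (f : R * R -> R) : R :=
  fine 'N[leb2]_+oo[EFin \o f]%E.

Definition partialx (f : R * R -> R) : R * R -> R := 'D_(1, 0) f.
Definition partialy (f : R * R -> R) : R * R -> R := 'D_(0, 1) f.

Fixpoint Ck (k : nat) (f : R * R -> R) : Prop :=
  continuous f /\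
  if k is k'.+1 then
    (forall p, derivable f p (1, 0) /\ derivable f p (0, 1)) /\
    Ck k' (partialx f) /\ Ck k' (partialy f)
  else True.

Definition test_function (phi : cfun) : Prop :=
  (forall k, Ck k (fun p => complex.Re (phi p)) /\ Ck k (fun p => complex.Im (phi p))) /\
  compact (closure [set p | phi p != 0]).

Definition Dx (u : cfun) : cfun := fun p =>
  - 'i%C * (partialx (fun q => complex.Re (u q)) p +i* partialx (fun q => complex.Im (u q)) p).
Definition Dy (u : cfun) : cfun := fun p =>
  - 'i%C * (partialy (fun q => complex.Re (u q)) p +i* partialy (fun q => complex.Im (u q)) p).

Definition magnetic_Dx (u : cfun) : cfun := fun p => Dx u p + p.2%:C * u p.

Definition H0_expr (u : cfun) : cfun := fun p =>
  magnetic_Dx (magnetic_Dx u) p + Dy (Dy u) p + p.1%:C * u p.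

(* Operators on functions are given by their graphs. *)
Definition operator := set (cfun * cfun).

Definition closure_on_test_functions (A : cfun -> cfun) : operator :=
  [set ug | [/\ L2 ug.1, L2 ug.2 &
    exists phi : nat -> cfun,
      [/\ forall n, test_function (phi n),
          (L2norm (fun p => phi n p - ug.1 p)%R @[n --> \oo] --> 0)%E &
          (L2norm (fun p => A (phi n) p - ug.2 p)%R @[n --> \oo] --> 0)%E]]].

Definition H0 : operator := closure_on_test_functions H0_expr.

Definition H (V : R * R -> R) : operator :=
  closure_on_test_functions (fun u p => H0_expr u p + (V p)%:C * u p).

Definition point_spectrum (A : operator) : set R[i] :=
  [set z | exists u : cfun,
    [/\ L2 u, ~ {ae leb2, forall p, u p = 0} & A (u, fun p => z * u p)]].

(* The graph of $(A - z)^{-1}$. *)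
Definition resolvent (A : operator) (z : R[i]) : operator :=
  [set fu | A (fu.2, fun p => fu.1 p + z * fu.2 p)].

(* Multiplication by a possibly unbounded weight: the product is not required
   to be square integrable. *)
Definition multiplication (w : R * R -> R) : operator :=
  [set fg | fg.2 = fun p => (w p)%:C * fg.1 p].

Definition compose (A B : operator) : operator :=
  [set fh | exists g, B (fh.1, g) /\ A (g, fh.2)].

(* Norm from $L^2$ to $L^2$ of a densely defined operator; it is infinite if
   some $f$ in $L^2$ has an image outside $L^2$. *)
Definition operator_norm (A : operator) : \bar R :=
  ereal_sup [set r | exists f g : cfun,
    [/\ L2 f, (L2norm f <= 1)%E, A (f, g) & r = L2norm g]].

Definition cutoff (F : R -> R) : Prop :=
  [/\ forall n t, derivable (derive1n n F) t 1,
      forall t, 0 <= F t <= 1,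
      forall t, `|t| <= 1 -> F t = 1 &
      forall t, 2 <= `|t| -> F t = 0].

(* At $y = 0$, where $|y|^{-\gamma}$ is undefined, [powR] gives the value 0
   (for $\gamma \neq 0$); this is a null set. *)
Definition weight (F : R -> R) (eta0 gamma : R) : R * R -> R := fun p =>
  `|p.2| `^ (- gamma) * F (p.2 / eta0) *
  bracket p.1 `^ (- (1 / 2) - gamma / 2).

(* The supremum over $\lambda\in[-r,r]$, $\nu>0$ and both signs of the norm of
   the weighted resolvent of $H_0$ at $\lambda\pm i\nu$. *)
Definition weighted_resolvent_sup (F : R -> R) (eta0 gamma r : R) : \bar R :=
  let W := multiplication (weight F eta0 gamma) in
  ereal_sup [set operator_norm (compose W (compose (resolvent H0 z) W)) |
    z in [set z | exists lambda nu : R,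
      [/\ - r <= lambda <= r, 0 < nu &
          z = lambda +i* nu \/ z = lambda +i* - nu]]].

Definition R1 (C1 : R) (V : R * R -> R) : R := C1 + Linfty_norm V.

Definition R2 (C2 : R) (V : R * R -> R) : R :=
  C2 * Linfty_norm (fun p => bracket p.1 * bracket p.2 * partialx V p) ^+ 8.

End Defs.

(* Main.v *)
(** A function in [L^2(R^2; C)] is handled as a pair of real functions, on which
multiplication by [i] acts as [rot] and [H0] as the real operator [h0].

For [nu <> 0] the equation [(H0 - (lambda + i nu)) v = f] is solved by least
squares over test functions: the residual is orthogonal to the range, so it is
enough that no nonzero [w] annihilates the range. To see this, test against the
kernel operator with kernel [a (x, x') * a (y, y')], where
[a (t, t') = bump ((t - t') / e) * F (e (t + t'))], applied to [w] itself: the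
symmetric part of [H0] cancels, and after division by [e^2] the commutator
terms vanish as [e -> 0], which leaves [nu |w|^2 = 0].

[H0] has no eigenfunction [u]: as [H0] commutes with the translation by [a] in
[x] up to the constant [a], the translates of [u] are eigenfunctions for
distinct eigenvalues, hence orthogonal to [u], and letting [a -> 0] gives
[u = 0].

If [H u = lambda u], the spectral hypothesis puts [lambda] in [[-R, R]]. With
[W] the weight and [h = |V| / W * u], solve [(H0 - lambda - i nu) v = W h].
Pairing with [u] gives [<W h, u> = - <v, V u> - nu <i v, u>]. The resolvent bound
controls the first term by [C |h|^2] and gives [nu |v|^2 <= C |h|^2], so
[nu -> 0] yields [<W h, u> <= C |h|^2], while
[|h|^2 <= A0 eta0^(2 gamma) <W h, u>]. The smallness assumption
forces [h = 0], so [V u = 0] and [u] would be an eigenfunction of [H0]. *)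

Require Import Defs.
From HB Require Import structures.
From mathcomp Require Import all_boot all_order all_algebra.
From mathcomp Require Import all_classical all_reals all_analysis.
From mathcomp Require Import measurable_realfun.
From mathcomp Require Import complex.
From mathcomp Require Import ring lra.
Import Order.TTheory GRing.Theory Num.Theory.
Import numFieldNormedType.Exports.
Local Open Scope classical_set_scope.
Local Open Scope ring_scope.
Set Implicit Arguments.
Unset Strict Implicit.
Unset Printing Implicit Defensive.

(** * The real space [L^2] and least squares *)

Section L2.
Context {d} {T : measurableType d} {R : realType}.
Variable mu : {measure set T -> \bar R}.

(** A bound on the graph of a resolvent says nothing before [W h] is known to have a preimage; hence
    solvability at [lambda + i nu] must be proved, which is the essential self-adjointness of [H0]
    on test functions. The potential [y^2 + x] is unbounded below, so positivity does not give it.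

    The kernel works because [H0] has degree two in positions and momenta together. Both
    [t^2 - t'^2] and the difference of the second derivatives in [t] and [t'] factor into one term
    attached to [t - t'] and one attached to [t + t']. These live at the inverse scales [e] and
    [1 / e], so the powers of [e] compensate and the surviving commutator terms stay bounded. In the
    limit each of them carries a factor [F'(0) = 0], the value at 0 of [t F(t)], the integral of a
    derivative, or a spare [e].

    In [h] the absolute value of [V] makes the pairing of [W h] with [u] equal to the integral of
    [|V| |u|^2], which controls [|h|^2] whatever the sign of [V]. The constant [A0 eta0^(2 gamma)]
    bounds [|V| / W^2], since [W^2] is [|y|^(-2 gamma)] times the power [-2s] of the bracket of [x]
    on the strip. *)

Lemma le12 : (1 <= 2%:E :> \bar R)%E. Proof. by rewrite lee_fin ler1n. Qed.

Lemma Lfun2P (f : T -> R) : f \in Lfun mu 2%:E <->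
  measurable_fun setT f /\ mu.-integrable setT (fun x => (f x ^+ 2)%:E).
Proof.
split=> [fL|[mf /integrableP[_ fi]]].
  split; last exact: Lfun2_integrable_sqr.
  by move: fL; rewrite inE => /andP[]; rewrite inE.
rewrite inE; apply/andP; split; rewrite inE//= /finite_norm unlock poweR_lty//.
apply: le_lt_trans fi; rewrite le_eqVlt; apply/orP; left; apply/eqP.
apply: eq_integral => x _ /=.
by rewrite powR_mulrn// -normrX.
Qed.

Definition Lsp := LfunType mu le12.
(** Total by a default: a function that is not square integrable is sent to 0, so every use goes
    through [toLspE] and a proof of integrability. *)
Definition toLsp (f : T -> R) : Lsp := insubd 0 f.

Lemma toLspE (f : T -> R) : f \in Lfun mu 2%:E -> toLsp f = f :> (T -> R).
Proof. by move=> fL; rewrite -[LHS]/(val (toLsp f)) /toLsp insubdK. Qed.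

(** Elements of [Lsp] are functions and not classes modulo null sets, so this form is only
    semidefinite: a null vector need not be 0. *)
Definition dot (f g : Lsp) : R := \int[mu]_x (f x * g x).

Lemma dot_int (f g : Lsp) : mu.-integrable setT (fun x => (f x * g x)%:E).
Proof.
by apply/Lfun1_integrable; apply: Lfun2_mul_Lfun1; exact: LfunP.
Qed.
Lemma dotC f g : dot f g = dot g f.
Proof. by apply: eq_Rintegral => x _; rewrite mulrC. Qed.
Lemma dotDl f g h : dot (f + g) h = dot f h + dot g h.
Proof.
rewrite -RintegralD//; [|exact: dot_int|exact: dot_int].
by apply: eq_Rintegral => x _; rewrite mulrDl.
Qed.
Lemma dotZl a f h : dot (a *: f) h = a * dot f h.
Proof.
rewrite -RintegralZl//; last exact: dot_int.
by apply: eq_Rintegral => x _; rewrite -mulrA.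
Qed.
Lemma dot_ge0 f : 0 <= dot f f.
Proof. by apply: Rintegral_ge0 => x _; rewrite -expr2 sqr_ge0. Qed.
End L2.

(** * Semidefinite forms: Cauchy-Schwarz, convergence, least squares *)

Section SemiInner.
Context {R : realType} {E : lmodType R}.
Variable b : E -> E -> R.
Hypothesis bC : forall u v, b u v = b v u.
Hypothesis bDl : forall u v w, b (u + v) w = b u w + b v w.
Hypothesis bZl : forall a u w, b (a *: u) w = a * b u w.
Hypothesis b_ge0 : forall u, 0 <= b u u.

Lemma formDr u v w : b u (v + w) = b u v + b u w.
Proof. by rewrite bC bDl !(bC _ u). Qed.
Lemma formZr a u v : b u (a *: v) = a * b u v.
Proof. by rewrite bC bZl (bC v). Qed.
Lemma formNl u v : b (- u) v = - b u v.
Proof. by rewrite -scaleN1r bZl mulN1r. Qed.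
Lemma formNr u v : b u (- v) = - b u v.
Proof. by rewrite bC formNl bC. Qed.
Lemma formBl u v w : b (u - v) w = b u w - b v w.
Proof. by rewrite bDl formNl. Qed.
Lemma formBr u v w : b u (v - w) = b u v - b u w.
Proof. by rewrite formDr formNr. Qed.

(** The discriminant inequality, with no sign assumed on [z]: a negative [z] contradicts the
    hypothesis at large [t], and [z = 0] forces [y = 0]. *)
Lemma poly2_ge0 (x y z : R) : (forall t, 0 <= x + 2 * t * y + t ^+ 2 * z) ->
  y ^+ 2 <= x * z.
Proof.
move=> h; have [z0|z0|z0] := ltgtP 0 z.
- have := h (- y / z); rewrite -(ler_pM2r z0) mul0r.
  have -> : (x + 2 * (- y / z) * y + (- y / z) ^+ 2 * z) * z = x * z - y ^+ 2.
    by field; rewrite gt_eqF.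
  by rewrite subr_ge0.
- have x0 : 0 <= x by have := h 0; rewrite mulr0 mul0r addr0 expr0n mul0r addr0.
  (* This [t] is at least 1 and makes [t * - z] exceed [x]; adding the inequalities at [t] and [- t]
     removes the linear term and leaves a contradiction. *)
  have := h ((2 * y ^+ 2 + x + 1) / - z + 1).
  set t := _ + 1; move=> ht.
  exfalso.
  have h1 := h t; have h2 := h (- t).
  have t1 : 1 <= t.
    by rewrite /t lerDr divr_ge0 ?oppr_ge0 ?(ltW z0)//; nra.
  have : t * - z = 2 * y ^+ 2 + x + 1 - z by rewrite /t; field; rewrite lt_eqF.
  nra.
- rewrite -z0 mulr0; have [->|y0] := eqVneq y 0; first by rewrite expr0n.
  have := h (- (x + 1) / (2 * y)); rewrite -z0 mulr0 addr0.
  have -> : x + 2 * (- (x + 1) / (2 * y)) * y = -1 by field.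
  by lra.
Qed.

Lemma form_CS u v : b u v ^+ 2 <= b u u * b v v.
Proof.
apply: poly2_ge0 => t.
have := b_ge0 (u + t *: v).
rewrite bDl !formDr !bZl !formZr (bC v u); lra.
Qed.

Lemma form_normD u v : b (u + v) (u + v) <= 2 * (b u u + b v v).
Proof.
have := b_ge0 (u - v).
rewrite !formBl !formBr !bDl !formDr (bC v u); lra.
Qed.

Lemma form_le_sqrt u v : `|b u v| <= Num.sqrt (b u u) * Num.sqrt (b v v).
Proof.
rewrite -sqrtrM// -sqrtr_sqr ler_wsqrtr//; exact: form_CS.
Qed.

Definition form_cvg (un : nat -> E) (u : E) := b (un n - u) (un n - u) @[n --> \oo] --> 0.

Lemma form_cvg_dot un u vn v : form_cvg un u -> form_cvg vn v ->
  b (un n) (vn n) @[n --> \oo] --> b u v.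
Proof.
move=> hu hv.
have su : Num.sqrt (b (un n - u) (un n - u)) @[n --> \oo] --> 0.
  by rewrite -[X in _ --> X]sqrtr0; apply: (continuous_cvg _ (@sqrt_continuous R 0) hu).
have sv : Num.sqrt (b (vn n - v) (vn n - v)) @[n --> \oo] --> 0.
  by rewrite -[X in _ --> X]sqrtr0; apply: (continuous_cvg _ (@sqrt_continuous R 0) hv).
apply/subr_cvg0; apply/norm_cvg0P.
apply: (@squeeze_cvgr _ _ _ _ (fun=> 0) (fun n =>
  Num.sqrt (b (un n - u) (un n - u)) * Num.sqrt (b (vn n - v) (vn n - v)) +
  Num.sqrt (b (un n - u) (un n - u)) * Num.sqrt (b v v) +
  Num.sqrt (b u u) * Num.sqrt (b (vn n - v) (vn n - v)))).
- near=> n; rewrite normr_ge0/=.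
  have -> : b (un n) (vn n) - b u v =
    b (un n - u) (vn n - v) + b (un n - u) v + b u (vn n - v).
    by rewrite !formBr !formBl; ring.
  apply: le_trans (ler_normD _ _) _; apply: lerD; last exact: form_le_sqrt.
  by apply: le_trans (ler_normD _ _) _; apply: lerD; exact: form_le_sqrt.
- exact: cvg_cst.
- rewrite -[X in _ --> X](_ : 0 * 0 + 0 * Num.sqrt (b v v) + Num.sqrt (b u u) * 0 = 0); last by ring.
  apply: cvgD; first (apply: cvgD; first exact: cvgM).
    by apply: cvgM => //; exact: cvg_cst.
  by apply: cvgM => //; exact: cvg_cst.
Unshelve. all: by end_near. Qed.

Lemma form_cvg_cst u : form_cvg (fun=> u) u.
Proof.
rewrite /form_cvg; under eq_fun do rewrite subrr -(scale0r 0) bZl mul0r.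
exact: cvg_cst.
Qed.

Lemma form_cvgD un u vn v : form_cvg un u -> form_cvg vn v ->
  form_cvg (fun n => un n + vn n) (u + v).
Proof.
move=> hu hv; rewrite /form_cvg.
apply: (@squeeze_cvgr _ _ _ _ (fun=> 0) (fun n =>
  2 * (b (un n - u) (un n - u) + b (vn n - v) (vn n - v)))).
- by near=> n; rewrite b_ge0/= opprD addrACA form_normD.
- exact: cvg_cst.
- rewrite -[X in _ --> X](_ : 2 * (0 + 0) = 0); last by ring.
  by apply: cvgM; [exact: cvg_cst|exact: cvgD].
Unshelve. all: by end_near. Qed.

Lemma form_cvgZ a un u : form_cvg un u -> form_cvg (fun n => a *: un n) (a *: u).
Proof.
move=> hu; rewrite /form_cvg.
have -> : (fun n => b (a *: un n - a *: u) (a *: un n - a *: u)) =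
    (fun n => a * a * b (un n - u) (un n - u)).
  by apply/funext => n; rewrite -scalerBr bZl formZr mulrA.
rewrite -[X in _ --> X](mulr0 (a * a)).
by apply: cvgM; first exact: cvg_cst.
Qed.

(** Limits are determined only up to null vectors; this is what allows replacing one limit by
    another at distance 0. *)
Lemma form_cvg_shift un u a : form_cvg un u -> b a a = 0 -> form_cvg un (u + a).
Proof.
move=> hu a0; have : form_cvg (fun=> 0 : E) a.
  rewrite /form_cvg; under eq_fun do rewrite sub0r formNl formNr opprK a0.
  exact: cvg_cst.
by move=> /(form_cvgD hu); under eq_fun do rewrite addr0.
Qed.

Hypothesis b_complete : forall un : nat -> E,
  (forall e : R, 0 < e -> exists N, forall m n, (N <= m)%N -> (N <= n)%N ->
     b (un m - un n) (un m - un n) < e) ->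
  exists u, form_cvg un u.

(** [K] is the class of admissible residuals. It will be the closure of the continuous functions of
    bounded support, where the kernel limits are proved, so that no density theorem is involved. *)
Variables (S : set E) (A : E -> E) (c : R) (K : set E).
Hypothesis S0 : S 0.
Hypothesis SD : forall u v, S u -> S v -> S (u + v).
Hypothesis SZ : forall a u, S u -> S (a *: u).
Hypothesis AD : forall u v, S u -> S v -> A (u + v) = A u + A v.
Hypothesis AZ : forall a u, S u -> A (a *: u) = a *: A u.
Hypothesis Ac : forall u, S u -> b u u <= c * b (A u) (A u).
Hypothesis Kcl : forall f g phi, K f -> (forall n, S (phi n)) ->
  form_cvg (fun n => A (phi n)) g -> K (f - g).
Hypothesis Kuniq : forall w, K w -> (forall phi, S phi -> b w (A phi) = 0) -> b w w = 0.

(* The residual [f - g] of the infimum is orthogonal to the range of [A] and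
   stays in [K], where [Kuniq] makes it null. *)
Lemma least_squares_solution f : K f -> exists v phi,
  [/\ forall n, S (phi n), form_cvg phi v & form_cvg (fun n => A (phi n)) f].
Proof.
move=> Kf.
pose X : set R := [set b (A p - f) (A p - f) | p in S].
have X0 : X !=set0 by exists (b (A 0 - f) (A 0 - f)); exists 0.
have Xlb : has_lbound X by exists 0 => _ [p _ <-].
have Xinf : has_inf X by [].
set dd := inf X.
have ddle p : S p -> dd <= b (A p - f) (A p - f).
  by move=> Sp; apply: ge_inf => //; exists p.
have /choice[phi hphi] : forall n : nat, exists p, S p /\
    b (A p - f) (A p - f) < dd + n.+1%:R^-1.
  move=> n; have n0 : 0 < n.+1%:R^-1 :> R by rewrite invr_gt0.
  have [_ [p Sp <-] h] := inf_adherent n0 Xinf.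
  by exists p.
have Sphi n : S (phi n) by have [] := hphi n.
(* Parallelogram law: the midpoint of [phi m] and [phi n] lies in [S], so its residual cannot go
   below the infimum [dd]. *)
have par m n : b (A (phi m) - A (phi n)) (A (phi m) - A (phi n)) <=
    2 * (m.+1%:R^-1 + n.+1%:R^-1).
  have [Sm hm] := hphi m; have [Sn hn] := hphi n.
  have := ddle _ (SZ (2^-1) (SD Sm Sn)).
  rewrite AZ ?AD//; last exact: SD.
  move: hm hn; rewrite !formBr !formBl !bZl !formZr !bDl !formDr.
  rewrite (bC f (A (phi m))) (bC f (A (phi n))) (bC (A (phi n)) (A (phi m))).
  set x1 := b (A (phi m)) _; set x2 := b (A (phi n)) (A (phi n)).
  by move: (m.+1%:R^-1 : R) (n.+1%:R^-1 : R) => e1 e2; lra.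
have cauchy0 (e : R) : 0 < e -> exists N, forall m n, (N <= m)%N -> (N <= n)%N ->
    2 * (m.+1%:R^-1 + n.+1%:R^-1) < e.
  move=> e0; have e4 : 0 < e / 4 by rewrite divr_gt0.
  have [N _ hN] := near_infty_natSinv_lt (PosNum e4).
  exists N => m n Nm Nn; have := hN _ Nm; have := hN _ Nn.
  by rewrite /=; move: (m.+1%:R^-1 : R) (n.+1%:R^-1 : R) => e1 e2; lra.
have [g hg] : exists g, form_cvg (fun n => A (phi n)) g.
  apply: b_complete => e e0; have [N hN] := cauchy0 _ e0.
  by exists N => m n Nm Nn; apply: le_lt_trans (par m n) _; exact: hN.
have SB u v : S u -> S v -> S (u - v).
  by move=> Su Sv; rewrite -scaleN1r; apply: SD => //; exact: SZ.
have AB u v : S u -> S v -> A (u - v) = A u - A v.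
  by move=> Su Sv; rewrite -scaleN1r (AD Su (SZ _ Sv)) (AZ _ Sv) scaleN1r.
(* Coercivity [Ac] turns the Cauchy property of the images into that of [phi]; [c] is replaced by
   the positive number [|c| + 1] in order to divide by it. *)
have [v hv] : exists v, form_cvg phi v.
  apply: b_complete => e e0.
  have c0 : 0 < `|c| + 1 by rewrite ltr_wpDl.
  have ec : 0 < e / (`|c| + 1) by rewrite divr_gt0.
  have [N hN] := cauchy0 _ ec.
  exists N => m n Nm Nn; apply: le_lt_trans (Ac (SB _ _ (Sphi m) (Sphi n))) _.
  rewrite AB//; have h1 := par m n; have := hN m n Nm Nn.
  rewrite ltr_pdivlMr// => h2; apply: le_lt_trans h2.
  apply: (@le_trans _ _ ((`|c| + 1) * b (A (phi m) - A (phi n)) (A (phi m) - A (phi n)))).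
    by apply: ler_wpM2r => //; rewrite ler_wpDr// ler_norm.
  by rewrite mulrC; apply: ler_wpM2r => //; exact: ltW.
exists v, phi; split=> //.
suff w0 : b (f - g) (f - g) = 0.
  by have := form_cvg_shift hg w0; rewrite addrC subrK.
apply: Kuniq; first exact: Kcl hg.
move=> p Sp.
have dd_eq : b (g - f) (g - f) <= dd.
  have h : b (A (phi n) - f) (A (phi n) - f) @[n --> \oo] --> b (g - f) (g - f).
    by apply: form_cvg_dot; apply: form_cvgD => //; exact: form_cvg_cst.
  have h2 : dd + n.+1%:R^-1 @[n --> \oo] --> dd.
    rewrite -[X in _ --> X]addr0; apply: cvgD; first exact: cvg_cst.
    exact: cvg_harmonic.
  apply: (ler_cvg_to h h2); near=> n.
  by have [_ /ltW] := hphi n.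
(* First variation at the minimiser in the direction [A p]. The constant term is 0, so the
   discriminant inequality forces the linear coefficient to vanish. *)
have key t : 0 <= 0 + 2 * t * b (f - g) (A p) + t ^+ 2 * b (A p) (A p).
  have h : b (A (phi n + (- t) *: p) - f) (A (phi n + (- t) *: p) - f) @[n --> \oo] -->
      b (g + (- t) *: A p - f) (g + (- t) *: A p - f).
    have AE n : A (phi n + (- t) *: p) = A (phi n) + (- t) *: A p.
      by rewrite (AD (Sphi n) (SZ _ Sp)) (AZ _ Sp).
    under eq_fun do rewrite AE.
    by apply: form_cvg_dot; do 2 (apply: form_cvgD; last exact: form_cvg_cst); exact: hg.
  have : dd <= b (g + (- t) *: A p - f) (g + (- t) *: A p - f).
    apply: (ler_cvg_to (cvg_cst dd) h); near=> n.
    exact: ddle (SD (Sphi n) (SZ _ Sp)).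
  move=> /(le_trans dd_eq).
  rewrite !formBr !formBl !bDl !formDr !bZl !formZr (bC f g) (bC (A p) g) (bC (A p) f).
  by lra.
have := poly2_ge0 key; rewrite mul0r => h.
by apply/eqP; rewrite -sqrf_eq0 eq_le h sqr_ge0.
Unshelve. all: by end_near. Qed.

End SemiInner.

(** * Completeness of the space of square integrable functions *)

Section Completeness.
Context {d} {T : measurableType d} {R : realType}.
Variable mu : {measure set T -> \bar R}.
Local Notation L := (Lsp mu).

Lemma dotE (f g : L) : (dot f g)%:E = (\int[mu]_x (f x * g x)%:E)%E.
Proof. by rewrite /dot /Rintegral fineK//; apply: integrable_fin_num => //; exact: dot_int. Qed.

Lemma measurable_Lsp (f : L) : measurable_fun setT (f : T -> R).
Proof. by have /Lfun2P[] := LfunP f. Qed.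

Lemma dot_eq0 (f : L) : dot f f = 0 -> {ae mu, forall x, f x = 0}.
Proof.
move=> f0.
have mf2 : measurable_fun setT (fun x => (f x * f x)%:E).
  by apply/measurable_EFinP; apply: measurable_funM; exact: measurable_Lsp.
have : (\int[mu]_x `|(f x * f x)%:E|)%E = 0%E.
  under eq_integral do rewrite gee0_abs ?lee_fin -?expr2 ?sqr_ge0// expr2.
  by rewrite -dotE f0.
move/(ae_eq_integral_abs mu measurableT mf2).
apply: filterS => x /= /(_ I) [] /eqP.
by rewrite mulf_eq0 orbb => /eqP.
Qed.

Lemma dot_ae0 (f : L) : {ae mu, forall x, f x = 0} -> dot f f = 0.
Proof.
move=> f0; apply: EFin_inj; rewrite dotE.
rewrite (@ae_eq_integral _ _ _ mu setT (cst 0%E))//.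
- by rewrite integral0.
- by apply/measurable_EFinP; apply: measurable_funM; exact: measurable_Lsp.
- by apply: filterS f0 => x /= -> _; rewrite mul0r.
Qed.

Lemma limn_einf_le (u : (\bar R)^nat) (e : \bar R) N :
  (forall n, (N <= n)%N -> (u n <= e)%E) -> (limn_einf u <= e)%E.
Proof.
move=> h; rewrite limn_einf_lim; apply: lime_le; first exact: is_cvg_einfs.
near=> n; apply: le_trans (h (maxn n N) (leq_maxr _ _)).
by apply: ereal_inf_lbound; exists (maxn n N) => //=; exact: leq_maxl.
Unshelve. all: by end_near. Qed.

(** Riesz-Fischer: a fast subsequence converges almost everywhere by a geometric bound, and Fatou's
    lemma transfers the Cauchy estimate to its pointwise limit. *)
Lemma dot_complete (un : nat -> L) :
  (forall e : R, 0 < e -> exists N, forall m n, (N <= m)%N -> (N <= n)%N ->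
     dot (un m - un n) (un m - un n) < e) ->
  exists u, form_cvg (@dot _ _ _ mu) un u.
Proof.
move=> cau.
(* The factor [4^-k] pays for the weight [4^k] in [g], and what remains sums to 1. Finiteness of
   [G x] then bounds the increment [dd k x] by [sqrt (G x) * 2^-k]. *)
pose ee k : R := (4 ^+ k)^-1 * (1 / (2 ^ (k + 1))%:R).
have ee0 k : 0 < ee k by rewrite mulr_gt0 ?invr_gt0 ?exprn_gt0// divr_gt0// ltr0n expn_gt0.
have /choice[N hN] : forall k, exists N, forall m n, (N <= m)%N -> (N <= n)%N ->
     dot (un m - un n) (un m - un n) < ee k by move=> k; exact: cau.
(* The sum makes [s] nondecreasing and at least [N k]; the extra [k] makes it tend to infinity, as
   the Fatou step requires. *)
pose s k := (\sum_(i < k.+1) N i + k)%N.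
have sS k : (s k <= s k.+1)%N by rewrite /s [in leqRHS]big_ord_recr/= leq_add// leq_addr.
have sN k : (N k <= s k)%N by rewrite /s big_ord_recr/= -addnA addnCA leq_addr.
pose v k : T -> R := un (s k).
have mv k : measurable_fun setT (v k) by exact: measurable_Lsp.
pose dd k x := v k.+1 x - v k x.
have md k : measurable_fun setT (dd k) by exact: measurable_funB.
pose g k x := (4 ^+ k * (dd k x * dd k x))%:E.
have mg k : measurable_fun setT (g k).
  by apply/measurable_EFinP; apply: measurable_funM => //; exact: measurable_funM.
have g0 k x : (0 <= g k x)%E.
  by rewrite lee_fin mulr_ge0 ?exprn_ge0// -expr2 sqr_ge0.
pose G x := (\sum_(0 <= k <oo) g k x)%E.
have mG : measurable_fun setT G by apply: ge0_emeasurable_sum => //.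
have G0 x : (0 <= G x)%E by apply: nneseries_ge0 => n _ _.
have iG : mu.-integrable setT G.
  apply/integrableP; split=> //.
  under eq_integral do rewrite gee0_abs//.
  rewrite integral_nneseries//.
  apply: (@le_lt_trans _ _ (\sum_(0 <= k <oo) (1 / (2 ^ (k + 1))%:R)%:E)%E).
    apply: lee_nneseries => [i _ _|k _]; first by apply: integral_ge0 => x _.
    rewrite /g; under eq_integral do rewrite EFinM.
    rewrite ge0_integralZl_EFin ?exprn_ge0//; last 2 first.
      by move=> x _; rewrite lee_fin -expr2 sqr_ge0.
      by apply/measurable_EFinP; exact: measurable_funM.
    have -> : (\int[mu]_x (dd k x * dd k x)%:E)%E =
        (dot (un (s k.+1) - un (s k)) (un (s k.+1) - un (s k)))%:E by rewrite dotE.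
    rewrite -EFinM lee_fin -ler_pdivlMl ?exprn_gt0//.
    apply: ltW; apply: (hN k) => //; exact: leq_trans (sS k).
  rewrite [X in (X < _)%E](_ : _ = (1 / 2 ^+ 0)%:E) ?ltry//.
  by apply/cvg_lim => //; exact: (@cvg_geometric_eseries_half R 1 0).
have conv : {ae mu, forall x, cvgn (fun k => v k x)}.
  have := integrable_ae measurableT iG.
  apply: filterS => x /(_ I) Gfin.
  pose c := fine (G x).
  have c0 : 0 <= c by rewrite fine_ge0.
  have dle k : `|dd k x| <= geometric (Num.sqrt c) 2^-1 k.
    have : (g k x <= G x)%E.
      have := @nneseries_lim_ge R (g ^~ x) xpredT 0%N k.+1 (fun n _ _ => g0 n x).
      rewrite big_nat_recr//=; apply: le_trans.
      by rewrite leeDr// sume_ge0.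
    rewrite -(fineK Gfin) lee_fin -/c => h.
    have p0 : 0 <= Num.sqrt c * 2^-1 ^+ k by rewrite mulr_ge0 ?sqrtr_ge0// exprn_ge0.
    rewrite /geometric /= -(@ler_pXn2r _ 2)// ?nnegrE//.
    rewrite real_normK ?num_real// exprMn sqr_sqrtr// -exprM mulnC exprM.
    have -> : 2^-1 ^+ 2 = 4^-1 :> R by rewrite exprVn; congr (_^-1); ring.
    by rewrite exprVn ler_pdivlMr ?exprn_gt0// mulrC expr2.
  have : cvgn [normed series (fun k => dd k x)].
    apply: (series_le_cvg _ _ dle) => //.
    - by move=> k /=; rewrite mulr_ge0 ?sqrtr_ge0// exprn_ge0.
    - apply: is_cvg_geometric_series; rewrite ger0_norm// invf_lt1// ltr1n//.
  move=> /normed_cvg h.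
  have -> : (fun k => v k x) = (fun k => v 0%N x + series (fun k => dd k x) k).
    by apply/funext => k; rewrite {1}(eq_sum_telescope (fun k => v k x) k).
  by apply: is_cvgD => //; exact: is_cvg_cst.
(* The upper limit is measurable and defined at every point, also where the subsequence diverges. *)
pose f x := fine (limn_esup (fun k => (v k x)%:E)).
have mf : measurable_fun setT f.
  apply: measurableT_comp => //.
  by apply: measurable_fun_limn_esup => k; exact/measurable_EFinP.
have vf : {ae mu, forall x, v k x @[k --> \oo] --> f x}.
  apply: filterS conv => x /cvg_ex[l hl].
  have hl' : (v k x)%:E @[k --> \oo] --> l%:E by apply: cvg_EFin hl; exact: nearW.
  rewrite /f (cvg_limn_einf_sup hl').2/=; exact: hl.
(* The estimate compares the original sequence, not just the subsequence, with [f]. Taking the error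
   1 it also shows that [f] is square integrable. *)
have fatou_est (e : R) M : 0 < e -> (forall m n, (M <= m)%N -> (M <= n)%N ->
     dot (un m - un n) (un m - un n) < e) -> forall n, (M <= n)%N ->
     (\int[mu]_x ((un n x - f x) * (un n x - f x))%:E <= e%:E)%E.
  move=> e0 hM n Mn.
  pose h k x := ((un n x - v k x) * (un n x - v k x))%:E.
  have mh k : measurable_fun setT (h k).
    by apply/measurable_EFinP; apply: measurable_funM; apply: measurable_funB => //;
      exact: measurable_Lsp.
  have h0 k x : (0 <= h k x)%E by rewrite lee_fin -expr2 sqr_ge0.
  rewrite (@ge0_ae_eq_integral _ _ _ mu setT _ (fun x => limn_einf (h ^~ x)))//; first last.
  - apply: filterS vf => x vx _; apply/esym.
    have : h k x @[k --> \oo] --> ((un n x - f x) * (un n x - f x))%:E.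
      apply: cvg_EFin; first exact: nearW.
      by apply: cvgM; apply: cvgB => //; exact: cvg_cst.
    by move=> /cvg_limn_einf_sup[].
  - move=> x _; rewrite limn_einf_lim; apply: lime_ge; first exact: is_cvg_einfs.
    by apply: nearW => k; apply: le_ereal_inf_tmp => _ [j _ <-].
  - by move=> x _; rewrite lee_fin -expr2 sqr_ge0.
  - rewrite (_ : (fun x => _) = (fun x => - limn_esup (fun k => - h k x))%E).
      apply: measurableT_comp => //; apply: measurable_fun_limn_esup => k.
      exact: measurableT_comp.
    apply/funext => x; rewrite -limn_einfN; congr limn_einf.
    by apply/funext => k /=; rewrite opprK.
  - by apply/measurable_EFinP; apply: measurable_funM; apply: measurable_funB => //;
      exact: measurable_Lsp.
  apply: le_trans (fatou _ _ mh _) _ => //.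
  apply: (@limn_einf_le _ _ M) => k Mk.
  rewrite /h.
  have -> : (\int[mu]_x ((un n x - v k x) * (un n x - v k x))%:E)%E =
        (dot (un n - un (s k)) (un n - un (s k)))%:E by rewrite dotE.
  by rewrite lee_fin ltW// hM// (leq_trans Mk)// leq_addl.
have [M0 hM0] := cau 1 ltr01.
have fL : f \in Lfun mu 2%:E.
  have : (fun x => un M0 x - f x) \in Lfun mu 2%:E.
    apply/Lfun2P; split.
      by apply: measurable_funB => //; exact: measurable_Lsp.
    apply/integrableP; split.
      by apply/measurable_EFinP; apply: measurable_funX; apply: measurable_funB => //; exact: measurable_Lsp.
    under eq_integral do rewrite gee0_abs ?lee_fin ?sqr_ge0// expr2.
    by apply: le_lt_trans (fatou_est _ _ ltr01 hM0 _ (leqnn _)) _; rewrite ltry.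
  move=> h; have -> : f = (un M0 - toLsp mu (fun x => un M0 x - f x) : L).
    by apply/funext => x; rewrite /= toLspE//= opprB addrC subrK.
  exact: LfunP.
exists (toLsp mu f); apply/cvgrPdist_le => e e0.
have [M hM] := cau _ e0.
near=> n.
have Mn : (M <= n)%N by near: n; exact: nbhs_infty_ge.
rewrite sub0r normrN ger0_norm ?dot_ge0// -lee_fin dotE.
have := fatou_est _ _ e0 hM _ Mn; apply: le_trans.
by rewrite le_eqVlt; apply/orP; left; apply/eqP; apply: eq_integral => x _ /=; rewrite toLspE.
Unshelve. all: by end_near. Qed.
End Completeness.

(** * Complex functions as pairs of real ones *)

Section Pairs.
Context {d} {T : measurableType d} {R : realType}.
Variable mu : {measure set T -> \bar R}.
Local Notation L := (Lsp mu).

(** The real part of the complex inner product; its imaginary part is recovered by applying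
    multiplication by [i] to one argument. *)
Definition dot2 (u v : L * L) : R := dot u.1 v.1 + dot u.2 v.2.

Lemma dot2C u v : dot2 u v = dot2 v u.
Proof. by rewrite /dot2 dotC (dotC u.2). Qed.
Lemma dot2Dl u v w : dot2 (u + v) w = dot2 u w + dot2 v w.
Proof. by rewrite /dot2 /= !dotDl addrACA. Qed.
Lemma dot2Zl a u v : dot2 (a *: u) v = a * dot2 u v.
Proof. by rewrite /dot2 /= !dotZl mulrDr. Qed.
Lemma dot2_ge0 u : 0 <= dot2 u u.
Proof. by rewrite addr_ge0 ?dot_ge0. Qed.

Lemma form_cvg_dot2P (un : nat -> L * L) u : form_cvg dot2 un u <->
  form_cvg (@dot _ _ _ mu) (fun n => (un n).1) u.1 /\
  form_cvg (@dot _ _ _ mu) (fun n => (un n).2) u.2.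
Proof.
split=> [h|[h1 h2]]; last first.
  by rewrite /form_cvg /dot2 /= -[X in _ --> X]addr0; exact: cvgD.
by split; apply: (squeeze_cvgr _ (cvg_cst 0) h); near=> n;
  rewrite /dot2 /= dot_ge0/= ?lerDl ?lerDr dot_ge0.
Unshelve. all: by end_near. Qed.

Lemma dot2_complete (un : nat -> L * L) :
  (forall e : R, 0 < e -> exists N, forall m n, (N <= m)%N -> (N <= n)%N ->
     dot2 (un m - un n) (un m - un n) < e) ->
  exists u, form_cvg dot2 un u.
Proof.
move=> h.
have [u1 hu1] : exists u1, form_cvg (@dot _ _ _ mu) (fun n => (un n).1) u1.
  apply: dot_complete => e /h[N hN]; exists N => m n Nm Nn.
  by apply: le_lt_trans (hN m n Nm Nn); rewrite /dot2 lerDl dot_ge0.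
have [u2 hu2] : exists u2, form_cvg (@dot _ _ _ mu) (fun n => (un n).2) u2.
  apply: dot_complete => e /h[N hN]; exists N => m n Nm Nn.
  by apply: le_lt_trans (hN m n Nm Nn); rewrite /dot2 lerDr dot_ge0.
by exists (u1, u2); apply/form_cvg_dot2P.
Qed.
End Pairs.

(** * Calculus in the plane *)

Section Plane.
Context {R : realType}.
Local Notation PT := (measurableTypeR R * measurableTypeR R)%type.

(** The plane carries the product sigma-algebra, so an open set has to be exhibited as a countable
    union of boxes, here with rational centres and radii [1 / (n + 1)]. *)
Lemma open_measurable_plane (U : set (R * R)) : open U -> measurable (U : set PT).
Proof.
move=> oU.
pose box (p q : rat) (n : nat) : set PT :=
  ball (ratr p : R) n.+1%:R^-1 `*` ball (ratr q : R) n.+1%:R^-1.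
have -> : U = \bigcup_p \bigcup_q \bigcup_n
    [set z | box p q n z /\ box p q n `<=` U] :> set PT.
  apply/seteqP; split=> [z Uz|z [p _ [q _ [n _ [/= bz]]]]]; last exact.
  have /nbhs_ballP[e /= e0 he] : nbhs z U by exact: open_nbhs_nbhs.
  have e2 : 0 < e / 2 by rewrite divr_gt0.
  have [N _ hN] := near_infty_natSinv_lt (PosNum e2).
  have n0 : 0 < N.+1%:R^-1 :> R by rewrite invr_gt0.
  have hN' : N.+1%:R^-1 < e / 2 by exact: (hN N (leqnn N)).
  have [p /[!in_itv]/= /andP[p1 p2]] : exists p : rat,
    ratr p \in `](z.1 - N.+1%:R^-1), (z.1 + N.+1%:R^-1)[%R.
    by apply: rat_in_itvoo; rewrite ltrBlDr -addrA ltrDl addr_gt0.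
  have [q /[!in_itv]/= /andP[q1 q2]] : exists q : rat,
    ratr q \in `](z.2 - N.+1%:R^-1), (z.2 + N.+1%:R^-1)[%R.
    by apply: rat_in_itvoo; rewrite ltrBlDr -addrA ltrDl addr_gt0.
  exists p => //; exists q => //; exists N => //; split.
    by split; rewrite /ball/= ltr_norml; apply/andP; split; move: n0 p1 p2 q1 q2;
      move: (N.+1%:R^-1 : R) => x; lra.
  move=> w [/=]; rewrite /ball/= => w1 w2; apply: he; split; rewrite /ball/=.
    move: w1 hN' p1 p2; rewrite !ltr_norml => /andP[]; move: (N.+1%:R^-1 : R) => x.
    by move=> *; apply/andP; split; lra.
  move: w2 hN' q1 q2; rewrite !ltr_norml => /andP[]; move: (N.+1%:R^-1 : R) => x.
  by move=> *; apply/andP; split; lra.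
apply: bigcupT_measurable_rat => p; apply: bigcupT_measurable_rat => q.
apply: bigcup_measurable => n _.
have [h|h] := pselect (box p q n `<=` U).
  rewrite (_ : [set z | _] = box p q n).
    by apply: measurableX; apply: open_measurable; exact: ball_open.
  by apply/seteqP; split=> z // [].
rewrite (_ : [set z | _] = set0) //.
by apply/seteqP; split=> z // [].
Qed.

Lemma continuous_measurable_plane (f : R * R -> R) :
  continuous f -> measurable_fun setT (f : PT -> R).
Proof.
move=> cf; apply: (measurability _ (RGenOInfty.measurableE R)).
move=> /= _ [_ [a ->]] <-; apply: measurableI => //.
by apply: open_measurable_plane; apply: open_comp => // x _; exact: cf.
Qed.

(** Bundles [k] times the image measure as a measure, so that a change of variables follows from a
    uniqueness theorem for measures. *)
Lemma scaled_image_measure d d' (T1 : measurableType d) (T2 : measurableType d')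
    (m : {measure set T1 -> \bar R}) (f : T1 -> T2) (k : R) :
  measurable_fun setT f -> 0 <= k ->
  exists m' : {measure set T2 -> \bar R},
    (forall A, m' A = k%:E * m (f @^-1` A))%E /\
    (forall G : T2 -> \bar R, measurable_fun setT G -> (forall x, 0 <= G x)%E ->
      (\int[m']_x G x = k%:E * \int[m]_x G (f x))%E).
Proof.
move=> mf k0; unshelve eexists (mscale (NngNum k0) (pushforward m f)); first exact: mf.
split=> // G mG G0; rewrite ge0_integral_mscale//=; congr (_ * _)%E.
by rewrite ge0_integral_pushforward.
Qed.

(** By uniqueness of Lebesgue measure it is enough to compare lengths of half-open intervals. *)
Lemma lebesgue_affine (a r : R) (A : set (measurableTypeR R)) : r != 0 -> measurable A ->
  lebesgue_measure A = (`|r|%:E * lebesgue_measure ((fun t : R => a + r * t)%R @^-1` A))%E.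
Proof.
move=> r0 mA.
have maff : measurable_fun setT (fun t : R => a + r * t : measurableTypeR R).
  by apply: measurable_funD => //; exact: measurable_funM.
have [m' [m'E _]] := scaled_image_measure (@lebesgue_measure R) maff (normr_ge0 r).
rewrite -m'E; apply: (@lebesgue_measure_unique _ m') => // _ [[x y]] _ <-.
rewrite m'E/=.
have [xy|yx] := ltP x y; last first.
  rewrite set_itv_ge ?bnd_simp -?leNgt//.
  by rewrite preimage_set0 !measure0 mule0.
have [rp|rn] := ltP 0 r.
  rewrite (_ : _ @^-1` _ = `](x - a) / r, (y - a) / r]%classic); last first.
    apply/seteqP; split=> t /=; rewrite !in_itv/= ltr_pdivrMr// ler_pdivlMr//;
      by move=> /andP[h1 h2]; apply/andP; split; lra.
  rewrite !lebesgue_measure_itv/= !lte_fin xy ltr_pM2r ?invr_gt0// ltrD2r xy.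
  by rewrite -!EFinB -EFinM gtr0_norm//; congr EFin; field.
have {}rn : r < 0 by rewrite lt_neqAle r0.
(* A negative [r] reverses the interval, so that the closed end moves to the left; the length is
   unaffected. *)
rewrite (_ : _ @^-1` _ = `[(y - a) / r, (x - a) / r[%classic); last first.
  apply/seteqP; split=> t /=; rewrite !in_itv/= ltr_ndivlMr// ler_ndivrMr//;
    by move=> /andP[h1 h2]; apply/andP; split; lra.
rewrite !lebesgue_measure_itv/= !lte_fin xy ltr_nM2r ?invr_lt0// ltrD2r xy.
by rewrite -!EFinB -EFinM ltr0_norm//; congr EFin; field.
Qed.

Definition affine (a : R * R) (r : R) (t : PT) : PT :=
  (a.1 + r * t.1, a.2 + r * t.2).

Lemma measurable_affine a r : measurable_fun setT (affine a r).
Proof.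
apply: measurable_fun_pair; apply: measurable_funD => //; apply: measurable_funM => //.
Qed.

Lemma leb2X (A B : set (measurableTypeR R)) : measurable A -> measurable B ->
  leb2 (A `*` B) = (lebesgue_measure A * lebesgue_measure B)%E.
Proof. by move=> mA mB; apply: product_measure1E. Qed.

Lemma leb2_affine (a : R * R) (r : R) (A : set PT) : r != 0 -> measurable A ->
  leb2 A = ((r ^+ 2)%:E * leb2 (affine a r @^-1` A))%E.
Proof.
move=> r0 mA.
have [m' [m'E _]] := scaled_image_measure (@leb2 R) (@measurable_affine a r) (sqr_ge0 r).
have hm' : forall (A B : set (measurableTypeR R)), measurable A -> measurable B ->
    m' (A `*` B) = (lebesgue_measure A * lebesgue_measure B)%E.
  move=> B C mB mC; rewrite m'E.
  rewrite (_ : _ @^-1` _ = ((fun t : R => a.1 + r * t)%R @^-1` B) `*` ((fun t : R => a.2 + r * t)%R @^-1` C))//.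
  have mp (c : R) D : measurable D ->
      measurable (((fun t : R => c + r * t)%R @^-1` D) : set (measurableTypeR R)).
    move=> mD; rewrite -[X in measurable X]setTI.
    by apply: (measurable_funD _ (measurable_funM _ _)) => //.
  rewrite leb2X; [|exact: mp|exact: mp].
  rewrite (lebesgue_affine a.1 r0 mB) (lebesgue_affine a.2 r0 mC).
  by rewrite muleACA -EFinM -normrM -expr2 ger0_norm// sqr_ge0.
by rewrite -m'E -(product_measure_unique hm').
Qed.

Lemma ge0_integral_affine (a : R * R) (r : R) (G : PT -> \bar R) : r != 0 ->
  measurable_fun setT G -> (forall x, 0 <= G x)%E ->
  (\int[leb2]_p G p = (r ^+ 2)%:E * \int[leb2]_t G (affine a r t))%E.
Proof.
move=> r0 mG G0.
have [m' [m'E <-]//] := scaled_image_measure (@leb2 R) (@measurable_affine a r) (sqr_ge0 r).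
by apply: eq_measure_integral => A mA _; rewrite m'E -leb2_affine.
Qed.

Lemma integrable_affine (a : R * R) (r : R) (G : PT -> R) : r != 0 ->
  leb2.-integrable setT (EFin \o G) ->
  leb2.-integrable setT (fun t => (G (affine a r t))%:E).
Proof.
move=> r0 /integrableP[mG iG]; apply/integrableP; split.
  by apply: measurableT_comp mG _; exact: measurable_affine.
move: iG; rewrite (ge0_integral_affine a r0)//; last exact: measurableT_comp.
rewrite !ltey; apply: contra_neq => h.
rewrite [X in (_ * X)%E]h gt0_muley// lte_fin.
by rewrite lt0r sqrf_eq0 r0 sqr_ge0.
Qed.

Lemma Rintegral_affine (a : R * R) (r : R) (G : PT -> R) : r != 0 ->
  leb2.-integrable setT (EFin \o G) ->
  \int[leb2]_p G p = r ^+ 2 * \int[leb2]_t G (affine a r t).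
Proof.
move=> r0 iG.

have iGa := integrable_affine a r0 iG.
rewrite /Rintegral integralE [in RHS]integralE.
have mE := measurable_int _ iG.
rewrite (ge0_integral_affine a r0 (measurable_funepos mE))//.
rewrite (ge0_integral_affine a r0 (measurable_funeneg mE))//.
have -> : (\int[leb2]_t ((EFin \o G)^\+ (affine a r t)) =
    \int[leb2]_t ((fun t => (G (affine a r t))%:E)^\+ t))%E.
  by apply: eq_integral => t _; rewrite !funeposE.
have -> : (\int[leb2]_t ((EFin \o G)^\- (affine a r t)) =
    \int[leb2]_t ((fun t => (G (affine a r t))%:E)^\- t))%E.
  by apply: eq_integral => t _; rewrite !funenegE.
have fp := integrable_pos_fin_num measurableT iGa.
have fn := integrable_neg_fin_num measurableT iGa.
rewrite -muleBr ?fin_num_adde_defl//.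
  rewrite fineM//.
  by rewrite fin_numD fin_numN; apply/andP; split; [exact: fp|exact: fn].
by rewrite fin_numN; exact: fn.
Qed.

End Plane.

Section Calculus.
Context {R : realType}.
Local Notation PT := (measurableTypeR R * measurableTypeR R)%type.
Implicit Types (f g : R * R -> R) (p v : R * R).

(** Restricting to a line turns directional derivatives into one-variable derivatives, to which the
    chain rule and differentiation under the integral apply. *)
Lemma line_quotientE f v p (h0 : R) :
  (fun h => h^-1 *: ((f \o shift (h0 *: v + p)) (h *: v) - f (h0 *: v + p))) =
  (fun h => h^-1 *: (((fun t : R => f (t *: v + p)) \o shift h0) (h *: 1) - f (h0 *: v + p))).
Proof.
apply/funext => h /=; congr (_ *: (f _ - _)).
by rewrite addrA -scalerDl [h *: 1]mulr1.
Qed.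

Lemma derivable_line f v p h0 :
  derivable (fun t : R => f (t *: v + p)) h0 1 = derivable f (h0 *: v + p) v.
Proof. by rewrite /derivable line_quotientE. Qed.

Lemma derive_line f v p h0 :
  derive1 (fun t : R => f (t *: v + p)) h0 = 'D_v f (h0 *: v + p).
Proof. by rewrite derive1E /derive line_quotientE. Qed.

(** Replaces compactness of the closed support; [compact_bsupp] and [bsupp_compact] translate
    between the two. *)
Definition bsupp f := exists M : R, forall p, M < `|p| -> f p = 0.

Lemma bsupp_D f g : bsupp f -> bsupp g -> bsupp (fun p => f p + g p).
Proof.
move=> [M hM] [N hN]; exists (Num.max M N) => p.
by rewrite gt_max => /andP[/hM -> /hN ->]; rewrite addr0.
Qed.

Lemma bsupp_Ml f g : bsupp g -> bsupp (fun p => f p * g p).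
Proof. by move=> [M hM]; exists M => p /hM ->; rewrite mulr0. Qed.

Lemma derive_locally_cst (V : normedModType R) (f : V -> R) (v p : V) :
  (\forall q \near p, f q = f p) -> 'D_v f p = 0.
Proof.
move=> /nbhs_ballP[e /= e0 he]; apply/cvg_lim => //.
have v1 : 0 < `|v| + 1 by rewrite ltr_wpDl.
have e1 : 0 < e / (`|v| + 1) by rewrite divr_gt0.
apply: cvg_near_cst; near=> h.
have : `|h| < e / (`|v| + 1) by near: h; exact: dnbhs0_lt.
rewrite (ltr_pdivlMr _ _ v1) => hh.
rewrite /= he ?subrr ?scaler0//.
rewrite -ball_normE /= opprD addrCA subrr addr0 normrN normrZ.
by have := normr_ge0 h; lra.
Unshelve. all: by end_near. Qed.

Lemma derive_outside (V : normedModType R) (f : V -> R) (M : R) (v p : V) :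
  (forall q, M < `|q| -> f q = 0) -> M < `|p| -> 'D_v f p = 0.
Proof.
move=> hM Mp; apply: derive_locally_cst; rewrite (hM _ Mp).
apply/nbhs_ballP; exists (`|p| - M) => /=; first by rewrite subr_gt0.
move=> q; rewrite -ball_normE /= => pq; apply: hM.
have := ler_normD q (p - q); rewrite subrKC; lra.
Qed.

Lemma bsupp_derive f v : bsupp f -> bsupp ('D_v f).
Proof. by move=> [M hM]; exists M => p; exact: derive_outside. Qed.

Definition box (M : R) : set PT := `[- M, M] `*` `[- M, M].

Lemma boxP M p : box M p <-> `|p| <= M.
Proof.
rewrite /box/= prod_normE ge_max !ler_norml !in_itv/=.
by split=> [[-> ->]//|/andP[-> ->]].
Qed.

Lemma measurable_box M : measurable (box M).
Proof. by apply: measurableX. Qed.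

Lemma leb2_box_lty M : (leb2 (box M) < +oo)%E.
Proof.
rewrite leb2X// lte_mul_pinfty//.
  rewrite ge0_fin_numE//; rewrite lebesgue_measure_itv/=; case: ifP => // _.
  by rewrite -EFinB ltry.
by rewrite lebesgue_measure_itv/=; case: ifP => // _; rewrite -EFinB ltry.
Qed.

Lemma bounded_bsupp_integrable (f : PT -> R) : measurable_fun setT f -> bsupp f ->
  (exists B : R, forall p, `|f p| <= B) -> leb2.-integrable setT (EFin \o f).
Proof.
move=> mf [M hM] [B hB].
have iB : leb2.-integrable setT (EFin \o (fun p => B * \1_(box M) p)).
  apply/integrableP; split.
    by apply/measurable_EFinP; apply: measurable_funM => //; exact: measurable_indic (measurable_box M).
  have B0 : 0 <= B by apply: le_trans (hB 0).
  rewrite (_ : (\int[_]_x _)%E = (\int[leb2]_x (B%:E * (\1_(box M) x)%:E))%E); last first.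
    apply: eq_integral => p _; rewrite -EFinM gee0_abs// lee_fin mulr_ge0//.
  rewrite ge0_integralZl_EFin//.
    rewrite integral_indic// ?setIT; last exact: measurable_box.
    by rewrite lte_mul_pinfty// leb2_box_lty.
  by apply/measurable_EFinP; exact: measurable_indic (measurable_box M).
apply: le_integrable iB => //; first exact/measurable_EFinP.
move=> p _ /=; rewrite lee_fin [leRHS]ger0_norm; last first.
  by rewrite mulr_ge0// (le_trans _ (hB 0)).
have [/boxP pM|nb] := pselect (box M p).
  by rewrite indicE mem_set ?mulr1 ?hB//; apply/boxP.
rewrite hM; first by rewrite normr0 mulr_ge0// (le_trans _ (hB 0)).
by rewrite ltNge; apply/negP => /boxP.
Qed.

Lemma cc_bounded f : continuous f -> bsupp f -> exists B : R, forall p, `|f p| <= B.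
Proof.
move=> cf [M hM].
have cb : compact (box M : set (R * R)) by apply: compact_setX; exact: segment_compact.
have := compact_bounded (continuous_compact (continuous_subspaceT cf) cb).
move=> [B [_ hB]].
exists (Num.max 0 (B + 1)) => p; have [/boxP pM|pM] := leP `|p| M.
  rewrite le_max; apply/orP; right; apply: (hB (B + 1)); first by rewrite ltrDl.
  by exists p.
by rewrite hM// normr0 le_max lexx.
Qed.

Lemma cc_integrable f : continuous f -> bsupp f -> leb2.-integrable setT (EFin \o (f : PT -> R)).
Proof.
move=> cf sf; apply: bounded_bsupp_integrable => //; last exact: cc_bounded.
exact: continuous_measurable_plane.
Qed.

Lemma bounded_bsupp_L2 (f : PT -> R) : measurable_fun setT f -> bsupp f ->
  (exists B : R, forall p, `|f p| <= B) -> f \in Lfun leb2 2%:E.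
Proof.
move=> mf sf [B hB]; apply/Lfun2P; split=> //.
apply: (@bounded_bsupp_integrable (fun p => f p ^+ 2)).
- exact: measurable_funX.
- by have [M hM] := sf; exists M => p /hM ->; rewrite expr0n.
- have B0 : 0 <= B by apply: le_trans (hB 0).
  by exists (B ^+ 2) => p; rewrite normrX lerXn2r ?nnegrE.
Qed.

Lemma cc_L2 f : continuous f -> bsupp f -> (f : PT -> R) \in Lfun leb2 2%:E.
Proof.
move=> cf sf; apply: bounded_bsupp_L2 => //; last exact: cc_bounded.
exact: continuous_measurable_plane.
Qed.

Lemma derive_under_integral (K : R * R -> PT -> R) p v (G : PT -> R) :
  (forall h : R, `|h| < 1 -> leb2.-integrable setT (EFin \o K (h *: v + p))) ->
  (forall (h : R) t, `|h| < 1 -> derivable (K ^~ t) (h *: v + p) v) ->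
  leb2.-integrable setT (EFin \o G) ->
  (forall (h : R) t, `|h| < 1 -> `|'D_v (K ^~ t) (h *: v + p)| <= G t) ->
  derivable (fun p => \int[leb2]_t K p t) p v /\
  'D_v (fun p => \int[leb2]_t K p t) p = \int[leb2]_t 'D_v (K ^~ t) p.
Proof.
move=> iK dK iG bG.
pose f (h : R) t := K (h *: v + p) t.
have I0 : `](-1), 1[%classic (0 : R) by rewrite /= in_itv/= ltrN10 ltr01.
have Ih (h : R) : `](-1), 1[%classic h -> `|h| < 1 by rewrite /= in_itv/= ltr_norml.
have if_ (h : R) : `](-1), 1[%classic h -> leb2.-integrable setT (EFin \o f h).
  by move=> /Ih; exact: iK.
have df (h : R) t : `](-1), 1[%classic h -> setT t -> derivable (f ^~ t) h 1.
  by move=> /Ih h1 _; rewrite /f (derivable_line (K ^~ t)); exact: dK.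
have bf (h : R) t : `](-1), 1[%classic h -> setT t -> `|partial1of2 f h t| <= G t.
  by move=> /Ih h1 _; rewrite /partial1of2 /f (derive_line (K ^~ t)); exact: bG.
have G0 t : 0 <= G t by apply: le_trans (bG 0 t _); rewrite ?normr0.
have := derivable_under_integral measurableT I0 if_ df G0 iG bf.
have := differentiation_under_integral measurableT I0 if_ df G0 iG bf.
rewrite {1}/f (derive_line (fun p => \int[leb2]_t K p t)) => h1.
rewrite {1}/f (derivable_line (fun p => \int[leb2]_t K p t)) => h2.
have p0 : 0 *: v + p = p by rewrite scale0r add0r.
rewrite p0 in h1; rewrite p0 in h2; apply: (conj h2).
rewrite h1; apply: eq_Rintegral => t _.
by rewrite /partial1of2/= /f (derive_line (K ^~ t)) scale0r add0r.
Qed.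

(** By translation invariance the integral of [f (p + t)] over [t] does not depend on [p];
    differentiate it under the integral sign. *)
Lemma integral_derive_eq0 f v : continuous f -> bsupp f ->
  (forall p, derivable f p v) -> continuous ('D_v f) ->
  \int[leb2]_t 'D_v f t = 0.
Proof.
move=> cf sf df cdf.
pose K p (t : PT) : R := f (p + t).
have KE p : \int[leb2]_t K p t = \int[leb2]_t f t.
  rewrite (@Rintegral_affine R p 1 f)//; last exact: cc_integrable.
  rewrite expr1n mul1r; apply: eq_Rintegral => t _.
  by rewrite /K /affine !mul1r.
have quotE p t : (fun h => h^-1 *: ((K ^~ t \o shift p) (h *: v) - K p t)) =
    (fun h => h^-1 *: ((f \o shift (p + t)) (h *: v) - f (p + t))).
  by apply/funext => h /=; rewrite /K addrA.
have DK p t : 'D_v (K ^~ t) p = 'D_v f (p + t) by rewrite /derive quotE.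
have dK p t : derivable (K ^~ t) p v by rewrite /derivable quotE; exact: df.
have [B hB] := cc_bounded cdf (bsupp_derive v sf).
have [M hM] := bsupp_derive v sf.
(* The box is enlarged by [|v|] because the translations [h *: v] with [|h| < 1] move the support by
   at most that much. *)
pose G (t : PT) : R := B * \1_(box (M + `|v|)) t.
have B0 : 0 <= B by apply: le_trans (hB 0).
have [] := @derive_under_integral K 0 v G.
- move=> h _; rewrite addr0 /K.
  have := @integrable_affine R (h *: v) 1 f (oner_neq0 _) (cc_integrable cf sf).
  by under eq_fun do rewrite /affine !mul1r.
- by move=> h t _; exact: dK.
- apply: bounded_bsupp_integrable.
  + by apply: measurable_funM => //; exact: measurable_indic (measurable_box _).
  + exists (M + `|v|) => p pM; rewrite /G indicE memNset ?mulr0//.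
    by move=> /boxP; rewrite leNgt pM.
  + exists B => p; rewrite normrM ger0_norm// ler_piMr// indicE.
    by case: (_ \in _); rewrite ?normr1 ?normr0.
- move=> h t h1; rewrite DK addr0 /G.
  have [/boxP tM|tM] := pselect (box (M + `|v|) t).
    by rewrite indicE mem_set ?mulr1 ?hB//; apply/boxP.
  rewrite hM ?normr0 ?mulr_ge0//.
  have tM' : M + `|v| < `|t| by rewrite ltNge; apply/negP => /boxP.
  have : `|t| <= `|h *: v + t| + `|h *: v|.
    by rewrite -[in leLHS](addKr (h *: v) t) addrC (le_trans (ler_normB _ _)).
  have : `|h *: v| <= `|v| by rewrite normrZ ler_piMl// ltW.
  by lra.
move=> _; under eq_fun do rewrite KE.
rewrite -[in LHS]/(cst (\int[leb2]_t f t)) derive_cst => /esym <-.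
by apply: eq_Rintegral => t _; rewrite DK add0r.
Qed.

End Calculus.

(** * Smooth functions, test functions and integration by parts *)

Section Smooth.
Context {R : realType}.
Implicit Types (f g c : R * R -> R) (p v : R * R).

Lemma Ck_pred k f : Ck k.+1 f -> Ck k f.
Proof.
elim: k f => [|k IH] f [cf [df [fx fy]]]; first by split.
exact (conj cf (conj df (conj (IH _ fx) (IH _ fy)))).
Qed.

Lemma CkD k f g : Ck k f -> Ck k g -> Ck k (fun p => f p + g p).
Proof.
elim: k f g => [|k IH] f g [cf hf] [cg hg].
  by split=> // p; apply: cvgD; [exact: cf|exact: cg].
split; first by move=> p; apply: cvgD; [exact: cf|exact: cg].
have [df [fx fy]] := hf; have [dg [gx gy]] := hg.
split; first by move=> p; split; apply: derivableD;
  [exact: (df p).1|exact: (dg p).1|exact: (df p).2|exact: (dg p).2].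
have -> : partialx (fun p => f p + g p) = (fun p => partialx f p + partialx g p).
  by apply/funext => p; apply: deriveD; [exact: (df p).1|exact: (dg p).1].
have -> : partialy (fun p => f p + g p) = (fun p => partialy f p + partialy g p).
  by apply/funext => p; apply: deriveD; [exact: (df p).2|exact: (dg p).2].
by split; exact: IH.
Qed.

Lemma CkM k f g : Ck k f -> Ck k g -> Ck k (fun p => f p * g p).
Proof.
elim: k f g => [|k IH] f g hf hg.
  by split=> // p; apply: cvgM; [exact: hf.1|exact: hg.1].
have hf' := Ck_pred hf; have hg' := Ck_pred hg.
have [cf [df [fx fy]]] := hf; have [cg [dg [gx gy]]] := hg.
split; first by move=> p; apply: cvgM; [exact: cf|exact: cg].
split; first by move=> p; split; apply: derivableM;
  [exact: (df p).1|exact: (dg p).1|exact: (df p).2|exact: (dg p).2].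
have -> : partialx (fun p => f p * g p) =
    (fun p => f p * partialx g p + g p * partialx f p).
  by apply/funext => p; apply: deriveM; [exact: (df p).1|exact: (dg p).1].
have -> : partialy (fun p => f p * g p) =
    (fun p => f p * partialy g p + g p * partialy f p).
  by apply/funext => p; apply: deriveM; [exact: (df p).2|exact: (dg p).2].
by split; apply: CkD; exact: IH.
Qed.

Lemma Ck_cst k (a : R) : Ck k (fun=> a).
Proof.
elim: k a => [|k IH] a; first by split=> // p; exact: cvg_cst.
split; first by move=> p; exact: cvg_cst.
split; first by move=> p; split; exact: derivable_cst.
have -> : partialx (fun=> a) = (fun=> 0) :> (R * R -> R).
  by apply/funext => p; exact: derive_cst.
have -> : partialy (fun=> a) = (fun=> 0) :> (R * R -> R).
  by apply/funext => p; exact: derive_cst.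
by split.
Qed.

Lemma derive_affine f a v p :
  'D_v (fun p => f (a + p)) p = 'D_v f (a + p) /\
  (derivable (fun p => f (a + p)) p v <-> derivable f (a + p) v).
Proof.
have quotE : (fun h : R => h^-1 *: (((fun p => f (a + p)) \o shift p) (h *: v) - f (a + p))) =
    (fun h => h^-1 *: ((f \o shift (a + p)) (h *: v) - f (a + p))).
  by apply/funext => h /=; rewrite addrCA.
by rewrite /derive /derivable quotE.
Qed.

Lemma Ck_shift k f a : Ck k f -> Ck k (fun p => f (a + p)).
Proof.
elim: k f => [|k IH] f [cf hf].
  split=> // p; apply: (@continuous_comp _ _ _ (fun p => a + p) f); last exact: cf.
  by apply: cvgD; [exact: cvg_cst|exact: cvg_id].
have [df [fx fy]] := hf.
split.
  move=> p; apply: (@continuous_comp _ _ _ (fun p => a + p) f); last exact: cf.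
  by apply: cvgD; [exact: cvg_cst|exact: cvg_id].
split.
  move=> p; split.
    by apply/(derive_affine f a (1, 0) p).2; exact: (df _).1.
  by apply/(derive_affine f a (0, 1) p).2; exact: (df _).2.
have -> : partialx (fun p => f (a + p)) = (fun p => partialx f (a + p)).
  by apply/funext => p; exact: (derive_affine f a (1, 0) p).1.
have -> : partialy (fun p => f (a + p)) = (fun p => partialy f (a + p)).
  by apply/funext => p; exact: (derive_affine f a (0, 1) p).1.
by split; exact: IH.
Qed.

Definition smooth1 (g : R -> R) := forall n t, derivable (derive1n n g) t 1.

Lemma smooth1_derive (g : R -> R) : smooth1 g -> smooth1 (derive1 g).
Proof. by move=> hg n t; rewrite -derive1Sn; exact: hg. Qed.

Lemma smooth1_continuous (g : R -> R) : smooth1 g -> continuous g.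
Proof.
by move=> hg t; apply: differentiable_continuous; apply/derivable1_diffP; exact: (hg 0%N).
Qed.

Definition lin (a b : R) p := a * p.1 + b * p.2.

Lemma lin_continuous a b : continuous (lin a b).
Proof.
by move=> p; apply: cvgD; apply: cvgM; try exact: cvg_cst;
  [exact: cvg_fst|exact: cvg_snd].
Qed.

Lemma linD a b p v : lin a b (p + v) = lin a b p + lin a b v.
Proof. by rewrite /lin /=; ring. Qed.

Lemma linZ a b h v : lin a b (h *: v) = h * lin a b v.
Proof. by rewrite /lin /= -![_ *: _]/(_ * _); ring. Qed.

Lemma derive_comp_lin (g : R -> R) a b p v : (forall t, derivable g t 1) ->
  derivable (g \o lin a b) p v /\
  'D_v (g \o lin a b) p = derive1 g (lin a b p) * lin a b v.
Proof.
move=> dg.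
have E : (fun t : R => (g \o lin a b) (t *: v + p)) =
   g \o (fun t : R => t * lin a b v + lin a b p).
  by apply/funext => t /=; rewrite linD linZ.
have dl t : derivable (fun t : R => t * lin a b v + lin a b p) t 1.
  by apply: derivableD => //; apply: derivableM.
have h1 : derivable (fun t : R => (g \o lin a b) (t *: v + p)) 0 1.
  rewrite E; apply/derivable1_diffP; apply: differentiable_comp; apply/derivable1_diffP => //.
split.
  by move: h1; rewrite derivable_line scale0r add0r.
have D := derive_line (g \o lin a b) v p 0; rewrite scale0r add0r in D.
refine (etrans (esym D) _); rewrite E.
have C := @derive1_comp R (fun t : R => t * lin a b v + lin a b p) g 0 (dl 0) (dg _).
refine (etrans C _).
rewrite mul0r add0r; congr (_ * _).
have -> : (fun t : R => t * lin a b v + lin a b p) = (lin a b v \*: id) + cst (lin a b p).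
  by apply/funext => t; rewrite mulrC.
have di : derivable (@id R) 0 1 by exact: derivable_id.
have dc : derivable (cst (lin a b p) : R -> R) 0 1 by exact: derivable_cst.
rewrite derive1E (deriveD (derivableZ (k := lin a b v) di) dc) (deriveZ _ di).
by rewrite derive_id derive_cst addr0 [_ *: _]mulr1.
Qed.

Lemma Ck_comp_lin k (g : R -> R) a b : smooth1 g -> Ck k (g \o lin a b).
Proof.
elim: k g => [|k IH] g sg.
  split=> // p; apply: continuous_comp; first exact: lin_continuous.
  exact: smooth1_continuous.
have dg t : derivable g t 1 by exact: (sg 0%N).
split.
  move=> p; apply: continuous_comp; first exact: lin_continuous.
  exact: smooth1_continuous.
split; first by move=> p; split; exact: (derive_comp_lin _ _ _ _ dg).1.
have -> : partialx (g \o lin a b) = (fun p => (derive1 g \o lin a b) p * lin a b (1, 0)).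
  by apply/funext => p; exact: (derive_comp_lin _ _ _ _ dg).2.
have -> : partialy (g \o lin a b) = (fun p => (derive1 g \o lin a b) p * lin a b (0, 1)).
  by apply/funext => p; exact: (derive_comp_lin _ _ _ _ dg).2.
by split; apply: CkM; try exact: Ck_cst; apply: IH; exact: smooth1_derive.
Qed.

Definition rtest f := (forall k, Ck k f) /\ bsupp f.

Lemma rtest0 : rtest (fun=> 0).
Proof. by split; [move=> k; exact: Ck_cst|exists 0]. Qed.

Lemma rtestD f g : rtest f -> rtest g -> rtest (fun p => f p + g p).
Proof. by move=> [cf sf] [cg sg]; split; [move=> k; exact: CkD|exact: bsupp_D]. Qed.

Lemma rtestZ (a : R) f : rtest f -> rtest (fun p => a * f p).
Proof.
move=> [cf sf]; split; last exact: bsupp_Ml.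
by move=> k; apply: CkM => //; exact: Ck_cst.
Qed.

Lemma rtest_cont f : rtest f -> continuous f.
Proof. by move=> [/(_ 0%N)[]]. Qed.

Lemma rtest_partialx f : rtest f -> rtest (partialx f).
Proof.
move=> [cf sf]; split; last exact: bsupp_derive.
by move=> k; have [_ [_ []]] := cf k.+1.
Qed.

Lemma rtest_partialy f : rtest f -> rtest (partialy f).
Proof.
move=> [cf sf]; split; last exact: bsupp_derive.
by move=> k; have [_ [_ []]] := cf k.+1.
Qed.

Lemma rtest_derivable f p : rtest f -> derivable f p (1, 0) /\ derivable f p (0, 1).
Proof. by move=> [/(_ 1%N)[_ [+ _]] _]; exact. Qed.

Lemma rtest_shift f a : rtest f -> rtest (fun p => f (a + p)).
Proof.
move=> [cf [M hM]]; split; first by move=> k; exact: Ck_shift.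
exists (M + `|a|) => p hp; apply: hM.
have : `|p| <= `|a + p| + `|a|.
  by rewrite -[in leLHS](addKr a p) addrC (le_trans (ler_normB _ _)).
lra.
Qed.

(* [c] is constant in the direction [v], hence commutes with the derivative. *)
Lemma integration_by_parts_plane c f g v : continuous c ->
  (forall h p, c (h *: v + p) = c p) ->
  continuous f -> continuous g -> bsupp g ->
  (forall p, derivable f p v) -> (forall p, derivable g p v) ->
  continuous ('D_v f) -> continuous ('D_v g) ->
  \int[leb2]_p (c p * 'D_v f p * g p) = - \int[leb2]_p (c p * f p * 'D_v g p).
Proof.
move=> cc cv cf cg sg df dg cdf cdg.
pose F p := c p * (f p * g p).
have quotE p : (fun h : R => h^-1 *: ((F \o shift p) (h *: v) - F p)) =
    (fun h => h^-1 *: (((c p \*: (f * g)) \o shift p) (h *: v) - (c p \*: (f * g)) p)).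
  by apply/funext => h /=; rewrite /F cv.
have dfg p := derivableM (df p) (dg p).
have dF p : derivable F p v by rewrite /derivable quotE; exact: derivableZ.
have DF p : 'D_v F p = c p * 'D_v f p * g p + c p * f p * 'D_v g p.
  have -> : 'D_v F p = 'D_v (c p \*: (f * g)) p by rewrite /derive quotE.
  by rewrite deriveZ// deriveM// -![_ *: _]/(_ * _); ring.
have cM (u w : R * R -> R) : continuous u -> continuous w -> continuous (fun p => u p * w p).
  by move=> cu cw p; apply: cvgM; [exact: cu|exact: cw].
have c1 : continuous (fun p => c p * 'D_v f p * g p) := cM _ _ (cM _ _ cc cdf) cg.
have c2 : continuous (fun p => c p * f p * 'D_v g p) := cM _ _ (cM _ _ cc cf) cdg.
have s1 := bsupp_Ml (fun p => c p * 'D_v f p) sg.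
have s2 := bsupp_Ml (fun p => c p * f p) (bsupp_derive v sg).
apply/eqP; rewrite -addr_eq0 -RintegralD//; [|exact: cc_integrable|exact: cc_integrable].
rewrite -(@integral_derive_eq0 R F v).
- by apply/eqP/eq_Rintegral => p _; rewrite DF.
- exact: cM _ _ cc (cM _ _ cf cg).
- by apply: bsupp_Ml; exact: bsupp_Ml.
- exact: dF.
- have -> : 'D_v F = (fun p => c p * 'D_v f p * g p + c p * f p * 'D_v g p).
    by apply/funext.
  by move=> p; apply: cvgD; [exact: c1|exact: c2].
Qed.

End Smooth.

(** * The real form of the free Hamiltonian *)

Section Hamiltonian.
Context {R : realType}.
Local Notation PT := (measurableTypeR R * measurableTypeR R)%type.
Implicit Types (f g c : R * R -> R) (p v : R * R).

Definition cc f := continuous f /\ bsupp f.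

Lemma continuousM_plane f g : continuous f -> continuous g -> continuous (fun p => f p * g p).
Proof. by move=> cf cg p; apply: cvgM; [exact: cf|exact: cg]. Qed.

Lemma continuousD_plane f g : continuous f -> continuous g -> continuous (fun p => f p + g p).
Proof. by move=> cf cg p; apply: cvgD; [exact: cf|exact: cg]. Qed.

Lemma continuous_cst_plane (a : R) : continuous (fun _ : R * R => a).
Proof. by move=> p; exact: cvg_cst. Qed.

Lemma continuous_fst_plane : continuous (fun p : R * R => p.1).
Proof. by move=> p; exact: cvg_fst. Qed.

Lemma continuous_snd_plane : continuous (fun p : R * R => p.2).
Proof. by move=> p; exact: cvg_snd. Qed.

Lemma ccD f g : cc f -> cc g -> cc (fun p => f p + g p).
Proof. by move=> [cf sf] [cg sg]; split; [exact: continuousD_plane|exact: bsupp_D]. Qed.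

Lemma ccM f g : continuous f -> cc g -> cc (fun p => f p * g p).
Proof. by move=> cf [cg sg]; split; [exact: continuousM_plane|exact: bsupp_Ml]. Qed.

Lemma ccN f : cc f -> cc (fun p => - f p).
Proof.
move=> [cf [M hM]]; split; first by move=> p; apply: cvgN; exact: cf.
by exists M => p /hM ->; rewrite oppr0.
Qed.

Lemma cc_rtest f : rtest f -> cc f.
Proof. by move=> hf; split; [exact: rtest_cont|exact: hf.2]. Qed.

Lemma cc_int f : cc f -> leb2.-integrable setT (EFin \o (f : PT -> R)).
Proof. by move=> []; exact: cc_integrable. Qed.

Lemma integral_cc_comb2 (F : R * R -> R) f g (s t A B : R) : cc f -> cc g ->
  (forall p, F p = s * f p + t * g p) ->
  \int[leb2]_p f p = A -> \int[leb2]_p g p = B ->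
  \int[leb2]_p F p = s * A + t * B.
Proof.
move=> hf hg FE <- <-.
have hs : cc (fun p => s * f p) by exact: ccM (@continuous_cst_plane s) hf.
have ht : cc (fun p => t * g p) by exact: ccM (@continuous_cst_plane t) hg.
rewrite -(RintegralZl s measurableT (cc_int hf)) -(RintegralZl t measurableT (cc_int hg)).
rewrite -(RintegralD measurableT (cc_int hs) (cc_int ht)).
by apply: eq_Rintegral => p _; rewrite FE.
Qed.

Lemma integral_cc_comb3 (F : R * R -> R) f g k (A B C : R) : cc f -> cc g -> cc k ->
  (forall p, F p = - f p - g p + k p) ->
  \int[leb2]_p f p = A -> \int[leb2]_p g p = B -> \int[leb2]_p k p = C ->
  \int[leb2]_p F p = - A - B + C.
Proof.
move=> hf hg hk FE iA iB iC.
have i1 := @integral_cc_comb2 (fun p => - f p - g p) f g (-1) (-1) A B hf hg _ iA iB.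
have hfg : cc (fun p => - f p - g p) by apply: ccD; exact: ccN.
have := @integral_cc_comb2 F _ k 1 1 _ C hfg hk _ (i1 _) iC.
rewrite !mul1r !mulN1r; apply => p; first by rewrite FE !mul1r.
by rewrite !mulN1r.
Qed.

Lemma continuous_potential : continuous (fun p : R * R => p.2 ^+ 2 + p.1).
Proof.
have -> : (fun p : R * R => p.2 ^+ 2 + p.1) = (fun p => p.2 * p.2 + p.1).
  by apply/funext => p; rewrite expr2.
apply: continuousD_plane; last exact: continuous_fst_plane.
exact: continuousM_plane continuous_snd_plane continuous_snd_plane.
Qed.

Definition schrodinger f p : R :=
  - partialx (partialx f) p - partialy (partialy f) p + (p.2 ^+ 2 + p.1) * f p.
(* Expanding [(D_x + y)^2] gives [- dx^2 + y^2 - 2 i y dx]: the last term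
   couples the real part [f] and the imaginary part [g]. *)
Definition h0re f g p : R := schrodinger f p + 2 * p.2 * partialx g p.
Definition h0im f g p : R := schrodinger g p - 2 * p.2 * partialx f p.

Lemma cc_schrodinger f : rtest f -> cc (schrodinger f).
Proof.
move=> hf; apply: ccD; first apply: ccD; last apply: ccM.
- by apply/ccN/cc_rtest; do 2 apply: rtest_partialx.
- by apply/ccN/cc_rtest; do 2 apply: rtest_partialy.
- exact: continuous_potential.
- exact: cc_rtest.
Qed.

Lemma cc_ypartialx f : rtest f -> cc (fun p => 2 * p.2 * partialx f p).
Proof.
move=> hf; apply: ccM; last by apply/cc_rtest/rtest_partialx.
apply: continuousM_plane; [exact: continuous_cst_plane|exact: continuous_snd_plane].
Qed.

Lemma cc_h0re f g : rtest f -> rtest g -> cc (h0re f g).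
Proof. by move=> hf hg; apply: ccD; [exact: cc_schrodinger|exact: cc_ypartialx]. Qed.

Lemma cc_h0im f g : rtest f -> rtest g -> cc (h0im f g).
Proof. by move=> hf hg; apply: ccD; [exact: cc_schrodinger|exact/ccN/cc_ypartialx]. Qed.

Lemma integral_partialx c f g : continuous c -> (forall h p, c (h *: (1, 0) + p) = c p) ->
  rtest f -> rtest g ->
  \int[leb2]_p (c p * partialx f p * g p) = - \int[leb2]_p (c p * f p * partialx g p).
Proof.
move=> cc0 cv hf hg; apply: integration_by_parts_plane => //.
- exact: rtest_cont.
- exact: rtest_cont.
- exact: hg.2.
- by move=> p; exact: (rtest_derivable p hf).1.
- by move=> p; exact: (rtest_derivable p hg).1.
- exact: rtest_cont (rtest_partialx hf).
- exact: rtest_cont (rtest_partialx hg).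
Qed.

Lemma integral_partialy f g : rtest f -> rtest g ->
  \int[leb2]_p (partialy f p * g p) = - \int[leb2]_p (f p * partialy g p).
Proof.
move=> hf hg.
have := @integration_by_parts_plane R (fun=> 1) f g (0, 1).
have E1 : \int[leb2]_p (1 * 'D_(0, 1) f p * g p) = \int[leb2]_p (partialy f p * g p).
  by apply: eq_Rintegral => p _; rewrite mul1r.
have E2 : \int[leb2]_p (1 * f p * 'D_(0, 1) g p) = \int[leb2]_p (f p * partialy g p).
  by apply: eq_Rintegral => p _; rewrite mul1r.
rewrite E1 E2; apply => //.
- exact: continuous_cst_plane.
- exact: rtest_cont.
- exact: rtest_cont.
- exact: hg.2.
- by move=> p; exact: (rtest_derivable p hf).2.
- by move=> p; exact: (rtest_derivable p hg).2.
- exact: rtest_cont (rtest_partialy hf).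
- exact: rtest_cont (rtest_partialy hg).
Qed.

Lemma integral_partialx1 f g : rtest f -> rtest g ->
  \int[leb2]_p (partialx f p * g p) = - \int[leb2]_p (f p * partialx g p).
Proof.
move=> hf hg.
have := @integral_partialx (fun=> 1) f g (@continuous_cst_plane 1) (fun _ _ => erefl) hf hg.
have -> : \int[leb2]_p (1 * partialx f p * g p) = \int[leb2]_p (partialx f p * g p).
  by apply: eq_Rintegral => p _; rewrite mul1r.
by under [X in - X]eq_Rintegral do rewrite mul1r.
Qed.

Lemma integral_schrodinger f g : rtest f -> rtest g ->
  \int[leb2]_p (schrodinger f p * g p) = \int[leb2]_p (f p * schrodinger g p).
Proof.
move=> hf hg.
have fx := rtest_partialx hf; have fy := rtest_partialy hf.
have gx := rtest_partialx hg; have gy := rtest_partialy hg.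
have c1 := ccM (rtest_cont (rtest_partialx fx)) (cc_rtest hg).
have c2 := ccM (rtest_cont (rtest_partialy fy)) (cc_rtest hg).
have c3 := ccM (continuousM_plane continuous_potential (rtest_cont hf)) (cc_rtest hg).
have d1 := ccM (rtest_cont hf) (cc_rtest (rtest_partialx gx)).
have d2 := ccM (rtest_cont hf) (cc_rtest (rtest_partialy gy)).
have ex : \int[leb2]_p (partialx (partialx f) p * g p) =
    \int[leb2]_p (f p * partialx (partialx g) p).
  exact (etrans (integral_partialx1 fx hg) (etrans (congr1 -%R (integral_partialx1 hf gx)) (opprK _))).
have ey : \int[leb2]_p (partialy (partialy f) p * g p) =
    \int[leb2]_p (f p * partialy (partialy g) p).
  exact (etrans (integral_partialy fy hg) (etrans (congr1 -%R (integral_partialy hf gy)) (opprK _))).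
have F1 p : schrodinger f p * g p = - (partialx (partialx f) p * g p) -
    partialy (partialy f) p * g p + (p.2 ^+ 2 + p.1) * f p * g p.
  by rewrite /schrodinger; ring.
have F2 p : f p * schrodinger g p = - (f p * partialx (partialx g) p) -
    f p * partialy (partialy g) p + (p.2 ^+ 2 + p.1) * f p * g p.
  by rewrite /schrodinger; ring.
exact (etrans (integral_cc_comb3 c1 c2 c3 F1 ex ey erefl)
  (esym (integral_cc_comb3 d1 d2 c3 F2 erefl erefl erefl))).
Qed.

Lemma integral_ypartialx f g : rtest f -> rtest g ->
  \int[leb2]_p (2 * p.2 * partialx f p * g p) = - \int[leb2]_p (f p * (2 * p.2 * partialx g p)).
Proof.
move=> hf hg.
rewrite (@integral_partialx (fun p => 2 * p.2))//.
- by congr (- _); apply: eq_Rintegral => p _; ring.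
- apply: continuousM_plane; [exact: continuous_cst_plane|exact: continuous_snd_plane].
- by move=> h p /=; rewrite [_ *: 0]mulr0 add0r.
Qed.

Local Notation L := (Lsp (@leb2 R)).
Local Notation E := (L * L)%type.

Definition test2 (u : E) : Prop := rtest (u.1 : PT -> R) /\ rtest (u.2 : PT -> R).
Definition toL (f : R * R -> R) : L := toLsp (@leb2 R) (f : PT -> R).
Definition h0 (u : E) : E := (toL (h0re u.1 u.2), toL (h0im u.1 u.2)).
Definition rot (u : E) : E := (- u.2, u.1).

Lemma h01E (u : E) : test2 u -> (h0 u).1 = h0re u.1 u.2 :> (PT -> R).
Proof. by move=> [h1 h2]; have [c s] := cc_h0re h1 h2; exact: toLspE (cc_L2 c s). Qed.

Lemma h02E (u : E) : test2 u -> (h0 u).2 = h0im u.1 u.2 :> (PT -> R).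
Proof. by move=> [h1 h2]; have [c s] := cc_h0im h1 h2; exact: toLspE (cc_L2 c s). Qed.

(** The Schrodinger part is symmetric. The operator [2 y dx] is antisymmetric, but it enters the two
    components with opposite signs, so the cross terms match. *)
Lemma h0_sym u w : test2 u -> test2 w -> dot2 (h0 u) w = dot2 u (h0 w).
Proof.
move=> hu hw; have [u1 u2] := hu; have [w1 w2] := hw.
have M f g : rtest f -> cc g -> cc (fun p => f p * g p).
  by move=> hf; apply: ccM; exact: rtest_cont.
have E f g k : rtest f -> rtest g -> rtest k ->
    \int[leb2]_p (h0re f g p * k p) =
    1 * \int[leb2]_p (f p * schrodinger k p) + 1 * - \int[leb2]_p (g p * (2 * p.2 * partialx k p)).
  move=> hf hg hk.
  have c1 := ccM (cc_schrodinger hf).1 (cc_rtest hk).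
  have c2 := ccM (cc_ypartialx hg).1 (cc_rtest hk).
  apply: (integral_cc_comb2 c1 c2 _ (integral_schrodinger hf hk) (integral_ypartialx hg hk)) => p.
  by rewrite /h0re; ring.
have E' f g k : rtest f -> rtest g -> rtest k ->
    \int[leb2]_p (h0im f g p * k p) =
    1 * \int[leb2]_p (g p * schrodinger k p) + (-1) * - \int[leb2]_p (f p * (2 * p.2 * partialx k p)).
  move=> hf hg hk.
  have c1 := ccM (cc_schrodinger hg).1 (cc_rtest hk).
  have c2 := ccM (cc_ypartialx hf).1 (cc_rtest hk).
  apply: (integral_cc_comb2 c1 c2 _ (integral_schrodinger hg hk) (integral_ypartialx hf hk)) => p.
  by rewrite /h0im; ring.
have E2 f g k : rtest f -> rtest g -> rtest k ->
    \int[leb2]_p (k p * h0re f g p) =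
    1 * \int[leb2]_p (k p * schrodinger f p) + 1 * \int[leb2]_p (k p * (2 * p.2 * partialx g p)).
  move=> hf hg hk.
  apply: (integral_cc_comb2 (M _ _ hk (cc_schrodinger hf)) (M _ _ hk (cc_ypartialx hg)) _ erefl erefl) => p.
  by rewrite /h0re; ring.
have E2' f g k : rtest f -> rtest g -> rtest k ->
    \int[leb2]_p (k p * h0im f g p) =
    1 * \int[leb2]_p (k p * schrodinger g p) + (-1) * \int[leb2]_p (k p * (2 * p.2 * partialx f p)).
  move=> hf hg hk.
  apply: (integral_cc_comb2 (M _ _ hk (cc_schrodinger hg)) (M _ _ hk (cc_ypartialx hf)) _ erefl erefl) => p.
  by rewrite /h0im; ring.
have D (f g : L) (f' : R * R -> R) : f = f' :> (PT -> R) ->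
    dot f g = \int[leb2]_p (f' p * g p).
  by move=> ff'; apply: eq_Rintegral => p _; rewrite ff'.
have D' (f g : L) (f' : R * R -> R) : f = f' :> (PT -> R) ->
    dot g f = \int[leb2]_p (g p * f' p).
  by move=> ff'; apply: eq_Rintegral => p _; rewrite ff'.
have d1 := etrans (D _ w.1 _ (h01E hu)) (E _ _ _ u1 u2 w1).
have d2 := etrans (D _ w.2 _ (h02E hu)) (E' _ _ _ u1 u2 w2).
have d3 := etrans (D' _ u.1 _ (h01E hw)) (E2 _ _ _ w1 w2 u1).
have d4 := etrans (D' _ u.2 _ (h02E hw)) (E2' _ _ _ w1 w2 u2).
have alg (a b c d : R) : 1 * a + 1 * - b + (1 * c + (-1) * - d) = 1 * a + 1 * d + (1 * c + (-1) * b).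
  by ring.
exact (etrans (f_equal2 +%R d1 d2) (etrans (alg _ _ _ _) (esym (f_equal2 +%R d3 d4)))).
Qed.

Lemma test2_0 : test2 0.
Proof. by split; exact: rtest0. Qed.
Lemma test2D (u w : E) : test2 u -> test2 w -> test2 (u + w).
Proof. by move=> [u1 u2] [w1 w2]; exact (conj (rtestD u1 w1) (rtestD u2 w2)). Qed.
Lemma test2Z a (u : E) : test2 u -> test2 (a *: u).
Proof. by move=> [u1 u2]; exact (conj (rtestZ a u1) (rtestZ a u2)). Qed.
Lemma test2_rot (u : E) : test2 u -> test2 (rot u).
Proof.
move=> [u1 u2]; have h := rtestZ (-1) u2.
have E1 : (fun p => (-1) * u.2 p) = (- u.2 : L) :> (PT -> R).
  by apply/funext => p; rewrite mulN1r.
by rewrite E1 in h; exact (conj h u1).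
Qed.

Lemma partialx_comb f g (a : R) : rtest f -> rtest g ->
  partialx (fun p => a * f p + g p) = (fun p => a * partialx f p + partialx g p).
Proof.
move=> hf hg; apply/funext => p.
have df := (rtest_derivable p hf).1; have dg := (rtest_derivable p hg).1.
exact (etrans (deriveD (derivableZ (k := a) df) dg) (congr1 (+%R^~ _) (deriveZ a df))).
Qed.

Lemma partialy_comb f g (a : R) : rtest f -> rtest g ->
  partialy (fun p => a * f p + g p) = (fun p => a * partialy f p + partialy g p).
Proof.
move=> hf hg; apply/funext => p.
have df := (rtest_derivable p hf).2; have dg := (rtest_derivable p hg).2.
exact (etrans (deriveD (derivableZ (k := a) df) dg) (congr1 (+%R^~ _) (deriveZ a df))).
Qed.

Lemma schrodinger_comb f g (a : R) p : rtest f -> rtest g ->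
  schrodinger (fun p => a * f p + g p) p = a * schrodinger f p + schrodinger g p.
Proof.
move=> hf hg; rewrite /schrodinger.
rewrite (partialx_comb a hf hg) (partialy_comb a hf hg).
rewrite (partialx_comb a (rtest_partialx hf) (rtest_partialx hg)).
rewrite (partialy_comb a (rtest_partialy hf) (rtest_partialy hg)).
by move: (partialx _ _) (partialx _ _) (partialy _ _) (partialy _ _) => *; ring.
Qed.

Lemma h0_comb a (u w : E) : test2 u -> test2 w -> h0 (a *: u + w) = a *: h0 u + h0 w.
Proof.
move=> hu hw; have [u1 u2] := hu; have [w1 w2] := hw.
have hs : test2 (a *: u + w) by apply: test2D => //; exact: test2Z.
apply/pair_equal_spec; split; apply/LfuneqP => p.
  rewrite [LHS](congr1 (@^~ p) (h01E hs)).
  have -> : (a *: h0 u + h0 w).1 p = a * (h0 u).1 p + (h0 w).1 p by [].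
  rewrite (congr1 (@^~ p) (h01E hu)) (congr1 (@^~ p) (h01E hw)).
  have S := schrodinger_comb a p u1 w1.
  have P := congr1 (@^~ p) (partialx_comb a u2 w2).
  have alg (x y z t k : R) : a * x + y + k * (a * z + t) = a * (x + k * z) + (y + k * t) by ring.
  exact (etrans (f_equal2 +%R S (congr1 ( *%R _) P)) (alg _ _ _ _ _)).
rewrite [LHS](congr1 (@^~ p) (h02E hs)).
have -> : (a *: h0 u + h0 w).2 p = a * (h0 u).2 p + (h0 w).2 p by [].
rewrite (congr1 (@^~ p) (h02E hu)) (congr1 (@^~ p) (h02E hw)).
have S := schrodinger_comb a p u2 w2.
have P := congr1 (@^~ p) (partialx_comb a u1 w1).
have alg (x y z t k : R) : a * x + y - k * (a * z + t) = a * (x - k * z) + (y - k * t) by ring.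
exact (etrans (f_equal2 (fun x y => x - y) S (congr1 ( *%R _) P)) (alg _ _ _ _ _)).
Qed.

Lemma h0_0 : h0 0 = 0.
Proof.
have := h0_comb (-1) test2_0 test2_0.
by rewrite scaler0 addr0 scaleN1r addNr.
Qed.

Lemma h0D (u w : E) : test2 u -> test2 w -> h0 (u + w) = h0 u + h0 w.
Proof. by move=> hu hw; have := h0_comb 1 hu hw; rewrite !scale1r. Qed.

Lemma h0Z a (u : E) : test2 u -> h0 (a *: u) = a *: h0 u.
Proof. by move=> hu; have := h0_comb a hu test2_0; rewrite h0_0 !addr0. Qed.

Lemma h0_rot (u : E) : test2 u -> h0 (rot u) = rot (h0 u).
Proof.
move=> hu; have [u1 u2] := hu; have hr := test2_rot hu.
have nE (f : L) : - f = (fun p => (-1) * f p + 0) :> (PT -> R).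
  by apply/funext => p; rewrite mulN1r addr0.
have zx : partialx (fun=> 0) = (fun=> 0) :> (R * R -> R).
  by apply/funext => p; exact: derive_cst.
have zy : partialy (fun=> 0) = (fun=> 0) :> (R * R -> R).
  by apply/funext => p; exact: derive_cst.
have z p : schrodinger (fun=> 0) p = 0.
  by rewrite /schrodinger zx zy zx zy; ring.
apply/pair_equal_spec; split; apply/LfuneqP => p.
  rewrite [LHS](congr1 (@^~ p) (h01E hr)).
  have -> : (rot (h0 u)).1 p = - (h0 u).2 p by [].
  rewrite (congr1 (@^~ p) (h02E hu)) /h0re /h0im /rot/=.
  have S := schrodinger_comb (-1) p u2 rtest0.
  have -> : schrodinger (- u.2 : L) p = - schrodinger u.2 p.
    by rewrite nE; refine (etrans S _); rewrite z; ring.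
  by move: (schrodinger _ _) (partialx _ _) => *; ring.
rewrite [LHS](congr1 (@^~ p) (h02E hr)).
refine (etrans _ (esym (congr1 (@^~ p) (h01E hu)))).
rewrite /h0re /h0im /rot/=.
have P := congr1 (@^~ p) (partialx_comb (-1) u2 rtest0).
have -> : partialx (- u.2 : L) p = - partialx u.2 p.
  by rewrite nE; refine (etrans P _); rewrite zx; ring.
by move: (schrodinger _ _) (partialx _ _) => *; ring.
Qed.

Lemma rotD (u w : E) : rot (u + w) = rot u + rot w.
Proof. by rewrite /rot /= opprD. Qed.

Lemma rotZ a (u : E) : rot (a *: u) = a *: rot u.
Proof. by rewrite /rot /= -scalerN. Qed.

Lemma dot_Nl (f g : L) : dot (- f) g = - dot f g.
Proof. by rewrite -scaleN1r dotZl mulN1r. Qed.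

Lemma dot2_rot (u w : E) : dot2 (rot u) w = - dot2 u (rot w).
Proof.
rewrite /dot2 /rot /= dot_Nl (dotC u.1 (- w.2)) dot_Nl (dotC w.2 u.1).
by rewrite addrC opprD opprK.
Qed.

Lemma dot2_rot_self (u : E) : dot2 (rot u) u = 0.
Proof. by have := dot2_rot u u; rewrite (dot2C u); lra. Qed.

Lemma rotrot (u : E) : rot (rot u) = - u.
Proof. by []. Qed.

Lemma dot2_rotrot (u w : E) : dot2 (rot u) (rot w) = dot2 u w.
Proof.
have h : dot2 u (- w) = - dot2 u w by rewrite dot2C -[- w]scaleN1r dot2Zl mulN1r dot2C.
by rewrite dot2_rot rotrot h opprK.
Qed.

End Hamiltonian.

(** * Smoothing kernels *)

Section Kernel.
Context {R : realType}.
Local Notation PT := (measurableTypeR R * measurableTypeR R)%type.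
Local Notation L := (Lsp (@leb2 R)).
Implicit Types (a b f g : R * R -> R) (p : R * R) (w : L).

(** Reduces continuity to sequences, in order to apply dominated convergence in
    [kerop_continuous]. *)
Lemma seq_continuous_plane f p :
  (forall u : nat -> R * R, u n @[n --> \oo] --> p -> f (u n) @[n --> \oo] --> f p) ->
  {for p, continuous f}.
Proof.
move=> h; apply: contrapT => nc.
have [e [e0 he]] : exists e : R, 0 < e /\ forall n : nat, exists q, `|p - q| < n.+1%:R^-1 /\ e <= `|f p - f q|.
  apply: contrapT => ne; apply: nc; apply/cvgrPdist_lt => e e0.
  have : ~ forall n : nat, exists q, `|p - q| < n.+1%:R^-1 /\ e <= `|f p - f q|.
    by move=> hn; apply: ne; exists e.
  move=> /existsNP[n hn].
  have n0 : 0 < n.+1%:R^-1 :> R by rewrite invr_gt0.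
  have near_p : \forall q \near p, `|p - q| < n.+1%:R^-1.
    by apply: (@cvgr_dist_lt _ _ _ (nbhs p) _ id p).
  apply: filterS near_p => q pq; rewrite ltNge; apply/negP => eq.
  by apply: hn; exists q.
have /choice[u hu] := he.
have up : u n @[n --> \oo] --> p.
  apply/cvgrPdist_lt => r r0.
  have [N _ hN] := near_infty_natSinv_lt (PosNum r0).
  by exists N => // n Nn; apply: lt_trans (hN _ Nn); exact: (hu n).1.
have /cvgrPdist_lt/(_ e e0)[N _ hN] := h u up.
by have := hN N (leqnn N); rewrite ltNge (hu N).2.
Qed.

(** For [p = (x, y)] and [q = (x', y')] these regroup the coordinates as [(x, x')] and [(y, y')], so
    that a kernel on the plane is a product of two one-dimensional kernels. *)
Definition pairx (p q : R * R) : R * R := (p.1, q.1).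
Definition pairy (p q : R * R) : R * R := (p.2, q.2).

Lemma continuous_pair f g : continuous f -> continuous g ->
  continuous (fun p => (f p, g p) : R * R).
Proof. by move=> cf cg p; exact: (cvg_pair (cf p) (cg p)). Qed.

Lemma pairx_continuous_r p : continuous (pairx p).
Proof. exact: continuous_pair (@continuous_cst_plane _ p.1) (@continuous_fst_plane R). Qed.
Lemma pairy_continuous_r p : continuous (pairy p).
Proof. exact: continuous_pair (@continuous_cst_plane _ p.2) (@continuous_snd_plane R). Qed.
Lemma pairx_continuous_l q : continuous (pairx ^~ q).
Proof. exact: continuous_pair (@continuous_fst_plane R) (@continuous_cst_plane _ q.1). Qed.
Lemma pairy_continuous_l q : continuous (pairy ^~ q).
Proof. exact: continuous_pair (@continuous_snd_plane R) (@continuous_cst_plane _ q.2). Qed.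

Lemma ker_continuous_r a b p : continuous a -> continuous b ->
  continuous (fun q => a (pairx p q) * b (pairy p q)).
Proof.
move=> ca cb; apply: continuousM_plane => q.
  by apply: (@continuous_comp _ _ _ (pairx p) a); [exact: pairx_continuous_r|exact: ca].
by apply: (@continuous_comp _ _ _ (pairy p) b); [exact: pairy_continuous_r|exact: cb].
Qed.

Lemma ker_continuous_l a b q : continuous a -> continuous b ->
  continuous (fun p => a (pairx p q) * b (pairy p q)).
Proof.
move=> ca cb; apply: continuousM_plane => p.
  by apply: (@continuous_comp _ _ _ (pairx ^~ q) a); [exact: pairx_continuous_l|exact: ca].
by apply: (@continuous_comp _ _ _ (pairy ^~ q) b); [exact: pairy_continuous_l|exact: cb].
Qed.

(** If [p] or [q] is far from the origin then so is [(x, x')] or [(y, y')], and one of the two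
    factors vanishes. *)
Lemma ker_bound a b : cc a -> cc b -> exists C M : R, 0 <= C /\
  forall p q, `|a (pairx p q) * b (pairy p q)| <= C * \1_(box M) p * \1_(box M) q.
Proof.
move=> [ca sa] [cb sb].
have [A hA] := cc_bounded ca sa; have [B hB] := cc_bounded cb sb.
have [M hM] := sa; have [N hN] := sb.
have A0 : 0 <= A by apply: le_trans (hA 0).
have B0 : 0 <= B by apply: le_trans (hB 0).
exists (A * B), (Num.max M N); split; first exact: mulr_ge0.
move=> p q.
have [[/boxP hp /boxP hq]|h] := pselect (box (Num.max M N) p /\ box (Num.max M N) q).
  rewrite !indicE !mem_set ?mulr1; [|by apply/boxP..].
  by rewrite normrM ler_pM.
suff [->|->] : a (pairx p q) = 0 \/ b (pairy p q) = 0.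
- by rewrite mul0r normr0 !mulr_ge0.
- by rewrite mulr0 normr0 !mulr_ge0.
have [xM|xM] := leP `|pairx p q| M; last by left; exact: hM.
have [yN|yN] := leP `|pairy p q| N; last by right; exact: hN.
exfalso; apply: h; move: xM yN.
rewrite !prod_normE !ge_max/= => /andP[p1 q1] /andP[p2 q2].
by split; apply/boxP; rewrite prod_normE ge_max !le_max ?p1 ?q1 ?p2 ?q2 ?orbT.
Qed.

Lemma indic_box_L2 (M : R) : (\1_(box M) : PT -> R) \in Lfun leb2 2%:E.
Proof.
apply: bounded_bsupp_L2.
- exact: measurable_indic (measurable_box M).
- exists M => p pM; rewrite indicE memNset//.
  by move=> /boxP; rewrite leNgt pM.
- by exists 1 => p; rewrite indicE; case: (_ \in _); rewrite ?normr1 ?normr0.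
Qed.

Lemma indic_box_int (M : R) w : leb2.-integrable setT (fun q => (\1_(box M) q * `|w q|)%:E).
Proof.
have h : leb2.-integrable setT (EFin \o ((\1_(box M) : PT -> R) \* (w : PT -> R))).
  apply/Lfun1_integrable; apply: Lfun2_mul_Lfun1; first exact: indic_box_L2.
  exact: LfunP.
have := integrable_abse h; apply: eq_integrable => // q _ /=.
by rewrite normrM ger0_norm.
Qed.

Definition kerw a b w p (q : PT) : R := a (pairx p q) * b (pairy p q) * w q.

Lemma measurable_kerw a b w p : continuous a -> continuous b -> measurable_fun setT (kerw a b w p).
Proof.
move=> ca cb; have h := continuous_measurable_plane (@ker_continuous_r a b p ca cb).
exact: (measurable_funM h (measurable_Lsp w)).
Qed.

Lemma kerw_dominated a b w : cc a -> cc b -> exists G : PT -> R,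
  [/\ leb2.-integrable setT (EFin \o G), forall q, 0 <= G q &
      forall p q, `|kerw a b w p q| <= G q].
Proof.
move=> ha hb; have [C [M [C0 hC]]] := ker_bound ha hb.
exists (fun q => C * (\1_(box M) q * `|w q|)); split.
- have := indic_box_int M w => /(integrableZl measurableT C).
  by apply: eq_integrable.
- by move=> q; rewrite !mulr_ge0.
- move=> p q; rewrite /kerw normrM mulrA ler_wpM2r//.
  by apply: le_trans (hC p q) _; rewrite ler_wpM2r// ler_piMr// indicE; case: (_ \in _).
Qed.

Lemma kerw_int a b w p : cc a -> cc b -> leb2.-integrable setT (EFin \o kerw a b w p).
Proof.
move=> ha hb; have [G [iG G0 hG]] := kerw_dominated w ha hb.
apply: le_integrable iG => //.
  by apply/measurable_EFinP; apply: measurable_kerw; [exact: ha.1|exact: hb.1].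
by move=> q _ /=; rewrite lee_fin (ger0_norm (G0 q)).
Qed.

Definition kerop a b w p : R := \int[leb2]_q kerw a b w p q.

Lemma kerop_continuous a b w : cc a -> cc b -> continuous (kerop a b w).
Proof.
move=> ha hb p; apply: seq_continuous_plane => u up.
have [G [iG G0 hG]] := kerw_dominated w ha hb.
apply: fine_cvg.
rewrite -[kerop a b w p]/(fine _) fineK; last exact: (integrable_fin_num measurableT (kerw_int w p ha hb)).
apply: (@dominated_cvg _ _ _ leb2 setT measurableT
  (fun n q => (kerw a b w (u n) q)%:E) _ (EFin \o G)) => //.
- by move=> n; apply/measurable_EFinP; apply: measurable_kerw; [exact: ha.1|exact: hb.1].
- move=> q _; apply: cvg_EFin; first exact: nearW.
  apply: cvgM; last exact: cvg_cst.
  exact: (continuous_cvg _ (@ker_continuous_l a b q ha.1 hb.1 p) up).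
- by move=> n q _; rewrite lee_fin.
Qed.

Lemma kerop_bsupp a b w : cc a -> cc b -> bsupp (kerop a b w).
Proof.
move=> ha hb; have [C [M [C0 hC]]] := ker_bound ha hb.
exists M => p pM.
rewrite -[RHS](_ : \int[leb2]_(q in [set: PT]) 0 = 0); last by rewrite Rintegral_cst// mul0r.
apply: eq_Rintegral => q _; rewrite /kerw.
have := hC p q; rewrite indicE memNset ?mulr0 ?mul0r.
  by rewrite normr_le0 => /eqP ->; rewrite mul0r.
by move=> /boxP; rewrite leNgt pM.
Qed.

Lemma cc_kerop a b w : cc a -> cc b -> cc (kerop a b w).
Proof. by move=> ha hb; split; [exact: kerop_continuous|exact: kerop_bsupp]. Qed.

(** Moving [p] along either axis moves only the first argument of one of the two kernels. This is
    why [partialx] of the kernel appears even for a derivative in [y]. *)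
Lemma pair_shift (h : R) p q :
  [/\ pairx (h *: (1, 0) + p) q = h *: (1, 0) + pairx p q,
      pairy (h *: (1, 0) + p) q = pairy p q,
      pairx (h *: (0, 1) + p) q = pairx p q &
      pairy (h *: (0, 1) + p) q = h *: (1, 0) + pairy p q].
Proof.
have z : h *: (0 : R) = 0 by rewrite scaler0.
by split; apply/pair_equal_spec; split; rewrite /= ?z ?add0r.
Qed.

Lemma scaled_comp_derive (F : R * R -> R) a (c : R) (p p' v v' : R * R) :
  (forall h : R, F (h *: v + p) = c * a (h *: v' + p')) -> derivable a p' v' ->
  derivable F p v /\ 'D_v F p = c * 'D_v' a p'.
Proof.
move=> FE da.
have E : (fun h : R => h^-1 *: ((F \o shift p) (h *: v) - F p)) =
    (fun h : R => h^-1 *: (((c \*: a) \o shift p') (h *: v') - (c \*: a) p')).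
  apply/funext => h; congr (_ *: (_ - _)); first exact: FE.
  by have := FE 0; rewrite !scale0r !add0r.
rewrite /derivable /derive E; split; first exact: (derivableZ da).
exact: (deriveZ _ da).
Qed.

Lemma kerop_partial a b w p : rtest a -> rtest b ->
  (derivable (kerop a b w) p (1, 0) /\ partialx (kerop a b w) p = kerop (partialx a) b w p) /\
  (derivable (kerop a b w) p (0, 1) /\ partialy (kerop a b w) p = kerop a (partialx b) w p).
Proof.
move=> ha hb.
have ax := rtest_partialx ha; have bx := rtest_partialx hb.
have ca := cc_rtest ha; have cb := cc_rtest hb.
have cax := cc_rtest ax; have cbx := cc_rtest bx.
have Dx q p' : derivable (fun p => kerw a b w p q) p' (1, 0) /\
    'D_(1, 0) (fun p => kerw a b w p q) p' = kerw (partialx a) b w p' q.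
  have FE h : kerw a b w (h *: (1, 0) + p') q = b (pairy p' q) * w q * a (h *: (1, 0) + pairx p' q).
    by have [e1 e2 _ _] := pair_shift h p' q; rewrite /kerw e1 e2; ring.
  have [d ->] := @scaled_comp_derive (fun p => kerw a b w p q) a _ p' _ (1, 0) (1, 0) FE (rtest_derivable _ ha).1.
  by split=> //; rewrite /kerw /partialx; ring.
have Dy q p' : derivable (fun p => kerw a b w p q) p' (0, 1) /\
    'D_(0, 1) (fun p => kerw a b w p q) p' = kerw a (partialx b) w p' q.
  have FE h : kerw a b w (h *: (0, 1) + p') q = a (pairx p' q) * w q * b (h *: (1, 0) + pairy p' q).
    by have [_ _ e1 e2] := pair_shift h p' q; rewrite /kerw e1 e2; ring.
  have [d ->] := @scaled_comp_derive (fun p => kerw a b w p q) b _ p' _ (0, 1) (1, 0) FE (rtest_derivable _ hb).1.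
  by split=> //; rewrite /kerw /partialx; ring.
have [G [iG G0 hG]] := kerw_dominated w cax cb.
have [G' [iG' G0' hG']] := kerw_dominated w ca cbx.
split.
  have [] := @derive_under_integral R (kerw a b w) p (1, 0) G.
  - by move=> h _; exact: kerw_int.
  - by move=> h q _; exact: (Dx q _).1.
  - exact: iG.
  - by move=> h q _; rewrite (Dx q _).2.
  by move=> d e; split=> //; apply: etrans e _; apply: eq_Rintegral => q _; exact: (Dx q p).2.
have [] := @derive_under_integral R (kerw a b w) p (0, 1) G'.
- by move=> h _; exact: kerw_int.
- by move=> h q _; exact: (Dy q _).1.
- exact: iG'.
- by move=> h q _; rewrite (Dy q _).2.
by move=> d e; split=> //; apply: etrans e _; apply: eq_Rintegral => q _; exact: (Dy q p).2.
Qed.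

(** Smoothness comes from the kernel alone: derivatives fall on [a] and [b], and [w] stays an
    arbitrary square integrable function. *)
Lemma rtest_kerop a b w : rtest a -> rtest b -> rtest (kerop a b w).
Proof.
move=> ha hb; split; last by apply: kerop_bsupp; exact: cc_rtest.
move=> k; elim: k a b ha hb => [|k IH] a b ha hb.
  by split=> //; apply: kerop_continuous; exact: cc_rtest.
have cont : continuous (kerop a b w) by apply: kerop_continuous; exact: cc_rtest.
have der p := kerop_partial w p ha hb.
have ex : partialx (kerop a b w) = kerop (partialx a) b w.
  by apply/funext => p; exact: (der p).1.2.
have ey : partialy (kerop a b w) = kerop a (partialx b) w.
  by apply/funext => p; exact: (der p).2.2.
refine (conj cont (conj (fun p => conj (der p).1.1 (der p).2.1) _)).
rewrite ex ey.
exact (conj (IH _ _ (rtest_partialx ha) hb) (IH _ _ ha (rtest_partialx hb))).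
Qed.

End Kernel.

Section SigmaFinitePlane.
Context {R : realType}.
Local Notation PT := (measurableTypeR R * measurableTypeR R)%type.

Lemma sigma_finite_leb2 : sigma_finite setT (@leb2 R).
Proof.
exists (fun n : nat => box n%:R).
  apply/seteqP; split=> // p _; exists (Num.truncn `|p|).+1 => //.
  by apply/boxP; rewrite ltW// truncnS_gt.
by move=> n; split; [exact: measurable_box|exact: leb2_box_lty].
Qed.

(* [leb2] again, as the sigma-finite measure needed to form [leb2s \x leb2s]. *)
Definition plane_measure : set PT -> \bar R := leb2.
HB.instance Definition _ := Measure.on plane_measure.
HB.instance Definition _ := Measure_isSigmaFinite.Build _ _ _ plane_measure sigma_finite_leb2.
End SigmaFinitePlane.

(** * The bilinear form of a kernel operator *)

Section KernelForm.
Context {R : realType}.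
Local Notation PT := (measurableTypeR R * measurableTypeR R)%type.
Local Notation L := (Lsp (@leb2 R)).
Implicit Types (a b : R * R -> R) (p : R * R) (f g w : L).

Definition leb2s : {sigma_finite_measure set PT -> \bar R} := @plane_measure R.

Lemma integrable_tensor (u v : PT -> R) :
  leb2.-integrable setT (EFin \o u) -> leb2.-integrable setT (EFin \o v) ->
  (leb2s \x leb2s)%E.-integrable setT (EFin \o (fun z : PT * PT => u z.1 * v z.2)).
Proof.
move=> /integrableP[mu iu] /integrableP[mv iv].
have mu' : measurable_fun setT u by exact/measurable_EFinP.
have mv' : measurable_fun setT v by exact/measurable_EFinP.
apply/integrable12ltyP.
  apply/measurable_EFinP; apply: measurable_funM.
    by apply: (measurableT_comp mu'); exact: measurable_fst.
  by apply: (measurableT_comp mv'); exact: measurable_snd.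
have mnv : measurable_fun setT (EFin \o (fun q => `|v q|)).
  by apply/measurable_EFinP; exact: measurableT_comp.
have mnu : measurable_fun setT (EFin \o (fun q => `|u q|)).
  by apply/measurable_EFinP; exact: measurableT_comp.
pose F (z : PT * PT) : R := u z.1 * v z.2.
have E1 p : (\int[leb2s]_q `|(EFin \o F) (p, q)| =
    `|u p|%R%:E * \int[leb2]_q `|v q|%R%:E)%E.
  rewrite -ge0_integralZl_EFin//.
  by apply: eq_integral => q _ /=; rewrite normrM EFinM.
rewrite [X in (X < _)%E](_ : _ = (\int[leb2s]_p (`|u p|%R%:E * \int[leb2]_q `|v q|%R%:E))%E); last first.
  by apply: eq_integral => p _; exact: E1.
have iv' : (\int[leb2]_q `|v q|%R%:E < +oo)%E by exact: iv.
have fv : (\int[leb2]_q `|v q|%R%:E)%E \is a fin_num by rewrite ge0_fin_numE// integral_ge0.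
rewrite ge0_integralZr//; last exact: integral_ge0.
have u0 : (0 <= \int[leb2s]_p `|u p|%R%:E)%E by exact: integral_ge0.
by apply: lte_mul_pinfty => //; rewrite ge0_fin_numE.
Qed.

Definition kerform a b f g : R := \int[leb2]_p (f p * kerop a b g p).

Definition kerfun a b f g (z : PT * PT) : R := f z.1 * kerw a b g z.1 z.2.

Lemma measurable_ker a b : continuous a -> continuous b ->
  measurable_fun setT (fun z : PT * PT => a (pairx z.1 z.2) * b (pairy z.1 z.2)).
Proof.
move=> ca cb.
have hx : measurable_fun setT (fun z : PT * PT => (z.1.1, z.2.1) : PT).
  apply: measurable_fun_pair.
    exact: (measurableT_comp measurable_fst measurable_fst).
  exact: (measurableT_comp measurable_fst measurable_snd).
have hy : measurable_fun setT (fun z : PT * PT => (z.1.2, z.2.2) : PT).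
  apply: measurable_fun_pair.
    exact: (measurableT_comp measurable_snd measurable_fst).
  exact: (measurableT_comp measurable_snd measurable_snd).
exact: (measurable_funM (measurableT_comp (continuous_measurable_plane ca) hx)
  (measurableT_comp (continuous_measurable_plane cb) hy)).
Qed.

Lemma measurable_kerfun a b f g : continuous a -> continuous b ->
  measurable_fun setT (kerfun a b f g).
Proof.
move=> ca cb.
have hf := measurableT_comp (measurable_Lsp f) (@measurable_fst _ _ PT PT).
have hg := measurableT_comp (measurable_Lsp g) (@measurable_snd _ _ PT PT).
exact: (measurable_funM hf (measurable_funM (measurable_ker ca cb) hg)).
Qed.

Lemma kerfun_int a b f g : cc a -> cc b ->
  (leb2s \x leb2s)%E.-integrable setT (EFin \o kerfun a b f g).
Proof.
move=> ha hb; have [C [M [C0 hC]]] := ker_bound ha hb.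
have i1 := integrableZl measurableT C (integrable_tensor (indic_box_int M f) (indic_box_int M g)).
apply: le_integrable i1 => //.
  by apply/measurable_EFinP; apply: measurable_kerfun; [exact: ha.1|exact: hb.1].
move=> [p q] _; rewrite /kerfun /kerw /= lee_fin.
rewrite [leRHS]ger0_norm ?mulr_ge0// !normrM mulrA (mulrC `|f p|) -normrM.
have := hC p q; set k := `|_ * _| => hk.
have -> : C * (\1_(box M) p * `|f p| * (\1_(box M) q * `|g q|)) =
  C * \1_(box M) p * \1_(box M) q * `|f p| * `|g q| by ring.
by rewrite !ler_wpM2r.
Qed.

Lemma kerform_fubini a b f g : cc a -> cc b ->
  kerform a b f g = fine (\int[leb2s]_p \int[leb2s]_q (kerfun a b f g (p, q))%:E)%E.
Proof.
move=> ha hb; congr fine; apply: eq_integral => p _.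
have iw := kerw_int g p ha hb.
rewrite -[RHS]/(\int[leb2]_q (kerfun a b f g (p, q))%:E)%E /kerfun/=.
rewrite (eq_integral (fun q => ((f p)%:E * (kerw a b g p q)%:E)%E)); last by [].
rewrite (integralZl measurableT iw) EFinM /kerop /Rintegral fineK//.
exact: integrable_fin_num.
Qed.

Definition tr a : R * R -> R := fun z => a (z.2, z.1).

Lemma cc_tr a : cc a -> cc (tr a).
Proof.
move=> [ca [M hM]]; split; last first.
  by exists M => p; rewrite prod_normE => hp; apply: hM; rewrite prod_normE /= maxC.
move=> p; apply: (@continuous_comp _ _ _ (fun z : R * R => (z.2, z.1) : R * R) a).
  exact: continuous_pair (@continuous_snd_plane R) (@continuous_fst_plane R) p.
exact: ca.
Qed.

(** Fubini. Comparing the form with its transpose is what later turns the commutator with the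
    Hamiltonian into a count of odd profiles. *)
Lemma kerform_swap a b f g : cc a -> cc b ->
  kerform a b f g = kerform (tr a) (tr b) g f.
Proof.
move=> ha hb; rewrite kerform_fubini// kerform_fubini; [|exact: cc_tr|exact: cc_tr].
congr fine.
rewrite (Fubini (kerfun_int f g ha hb)).
apply: eq_integral => q _; apply: eq_integral => p _; congr EFin.
by rewrite /kerfun /kerw /tr /pairx /pairy /=; ring.
Qed.

Lemma kerop_int_dot a b f g : cc a -> cc b ->
  leb2.-integrable setT (EFin \o (fun p : PT => f p * kerop a b g p)).
Proof.
move=> ha hb; have [c s] := cc_kerop g ha hb.
apply/Lfun1_integrable; apply: (Lfun2_mul_Lfun1 (LfunP f)).
exact: cc_L2 c s.
Qed.

Lemma kerform_comb_ker1 (s t : R) a a' b f g : cc a -> cc a' -> cc b ->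
  kerform (fun z => s * a z + t * a' z) b f g = s * kerform a b f g + t * kerform a' b f g.
Proof.
move=> ha ha' hb.
have i1 := kerop_int_dot f g ha hb; have i2 := kerop_int_dot f g ha' hb.
rewrite -(RintegralZl s measurableT i1) -(RintegralZl t measurableT i2).
rewrite -(RintegralD measurableT (integrableZl measurableT s i1) (integrableZl measurableT t i2)).
apply: eq_Rintegral => p _.
have j1 := kerw_int g p ha hb; have j2 := kerw_int g p ha' hb.
have -> : kerop (fun z => s * a z + t * a' z) b g p = s * kerop a b g p + t * kerop a' b g p.
  rewrite -(RintegralZl s measurableT j1) -(RintegralZl t measurableT j2).
  rewrite -(RintegralD measurableT (integrableZl measurableT s j1) (integrableZl measurableT t j2)).
  by apply: eq_Rintegral => q _; rewrite /kerw; ring.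
ring.
Qed.

Lemma kerform_comb_ker2 (s t : R) a b b' f g : cc a -> cc b -> cc b' ->
  kerform a (fun z => s * b z + t * b' z) f g = s * kerform a b f g + t * kerform a b' f g.
Proof.
move=> ha hb hb'.
have i1 := kerop_int_dot f g ha hb; have i2 := kerop_int_dot f g ha hb'.
rewrite -(RintegralZl s measurableT i1) -(RintegralZl t measurableT i2).
rewrite -(RintegralD measurableT (integrableZl measurableT s i1) (integrableZl measurableT t i2)).
apply: eq_Rintegral => p _.
have j1 := kerw_int g p ha hb; have j2 := kerw_int g p ha hb'.
have -> : kerop a (fun z => s * b z + t * b' z) g p = s * kerop a b g p + t * kerop a b' g p.
  rewrite -(RintegralZl s measurableT j1) -(RintegralZl t measurableT j2).
  rewrite -(RintegralD measurableT (integrableZl measurableT s j1) (integrableZl measurableT t j2)).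
  by apply: eq_Rintegral => q _; rewrite /kerw; ring.
ring.
Qed.

Lemma kerform_comb1 (s : R) a b f f' g : cc a -> cc b ->
  kerform a b (s *: f + f') g = s * kerform a b f g + kerform a b f' g.
Proof.
move=> ha hb.
have i1 := kerop_int_dot f g ha hb; have i2 := kerop_int_dot f' g ha hb.
rewrite -(RintegralZl s measurableT i1).
rewrite -(RintegralD measurableT (integrableZl measurableT s i1) i2).
by apply: eq_Rintegral => p _; rewrite -[(s *: f + f') p]/(s * f p + f' p); ring.
Qed.

Lemma kerform_comb2 (s : R) a b f g g' : cc a -> cc b ->
  kerform a b f (s *: g + g') = s * kerform a b f g + kerform a b f g'.
Proof.
move=> ha hb; rewrite !(kerform_swap f)//.
by apply: kerform_comb1; exact: cc_tr.
Qed.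

End KernelForm.

(** * Kernels concentrating on the diagonal *)

Section ApproximateIdentity.
Context {R : realType}.
Local Notation PT := (measurableTypeR R * measurableTypeR R)%type.
Local Notation L := (Lsp (@leb2 R)).
Implicit Types (Psi X : R -> R) (p : R * R) (f g w : L).

Definition cc1 (Psi : R -> R) := continuous Psi /\ exists M : R, forall t, M < `|t| -> Psi t = 0.

(* Localised in [t - t'] at scale [e] and in [t + t'] at scale [1 / e]. *)
Definition kap (e : R) Psi X : R * R -> R := fun z => Psi (lin e^-1 (- e^-1) z) * X (lin e e z).

Lemma cc1_bounded Psi : cc1 Psi -> exists B : R, 0 <= B /\ forall t, `|Psi t| <= B.
Proof.
move=> [cP [M hM]].
have [B [_ hB]] := compact_bounded (continuous_compact (continuous_subspaceT cP) (@segment_compact R (- M) M)).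
exists (Num.max 0 (B + 1)); split; first by rewrite le_max lexx.
move=> t; have [tM|tM] := leP `|t| M.
  rewrite le_max; apply/orP; right; apply: (hB (B + 1)); first by rewrite ltrDl.
  by exists t => //=; rewrite in_itv/= -ler_norml.
by rewrite hM// normr0 le_max lexx.
Qed.

Lemma cc_kap e Psi X : 0 < e -> cc1 Psi -> cc1 X -> cc (kap e Psi X).
Proof.
move=> e0 [cP [M hM]] [cX [N hN]]; split.
  apply: continuousM_plane => z.
    by apply: (@continuous_comp _ _ _ (lin e^-1 (- e^-1)) Psi); [exact: lin_continuous|exact: cP].
  by apply: (@continuous_comp _ _ _ (lin e e) X); [exact: lin_continuous|exact: cX].
exists (`|M| * e + `|N| / e) => z.
have [hM'|/hM PM] := leP `|lin e^-1 (- e^-1) z| M; last by rewrite /kap PM mul0r.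
have [hN'|/hN PN] := leP `|lin e e z| N; last by rewrite /kap PN mulr0.
have h1 : `|z.1 - z.2| <= `|M| * e.
  have l1 : lin e^-1 (- e^-1) z = (z.1 - z.2) / e by rewrite /lin; ring.
  move: hM'; rewrite l1 normf_div (gtr0_norm e0) ler_pdivrMr// => /le_trans; apply.
  by apply: ler_wpM2r; [exact: ltW|exact: ler_norm].
have h2 : `|z.1 + z.2| <= `|N| / e.
  have l2 : lin e e z = (z.1 + z.2) * e by rewrite /lin; ring.
  rewrite ler_pdivlMr//; move: hN'; rewrite l2 normrM (gtr0_norm e0) => /le_trans; apply.
  exact: ler_norm.
rewrite ltNge => /negP[]; rewrite prod_normE ge_max.
move: h1 h2; rewrite !ler_norml => /andP[a1 a2] /andP[a3 a4].
have M0 : 0 <= `|M| * e by rewrite mulr_ge0// ltW.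
have N0 : 0 <= `|N| / e by rewrite divr_ge0// ltW.
by apply/andP; split; apply/andP; split; lra.
Qed.

Lemma cc_tensor Psi1 Psi2 : cc1 Psi1 -> cc1 Psi2 -> cc (fun t : R * R => Psi1 t.1 * Psi2 t.2).
Proof.
move=> [c1 [M hM]] [c2 [N hN]]; split.
  apply: continuousM_plane => z.
    by apply: (@continuous_comp _ _ _ fst Psi1); [exact: continuous_fst_plane|exact: c1].
  by apply: (@continuous_comp _ _ _ snd Psi2); [exact: continuous_snd_plane|exact: c2].
exists (Num.max M N) => z; rewrite prod_normE lt_max !gt_max.
by move=> /orP[/andP[/hM -> _]|/andP[_ /hN ->]]; rewrite ?mul0r ?mulr0.
Qed.

Definition tensor_mass Psi1 Psi2 : R := \int[leb2]_t (Psi1 t.1 * Psi2 t.2).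
Definition tensor_absmass Psi1 Psi2 : R := \int[leb2]_t `|Psi1 t.1 * Psi2 t.2|.

Lemma tensor_absmassE Psi1 Psi2 : cc1 Psi1 -> cc1 Psi2 ->
  (\int[leb2]_t `|Psi1 t.1 * Psi2 t.2|%R%:E)%E = (tensor_absmass Psi1 Psi2)%:E.
Proof.
move=> h1 h2; rewrite /tensor_absmass /Rintegral fineK//.
have := integrable_abse (cc_int (cc_tensor h1 h2)).
exact: integrable_fin_num.
Qed.

Lemma tensor_absmass_ge0 Psi1 Psi2 : 0 <= tensor_absmass Psi1 Psi2.
Proof. exact: Rintegral_ge0. Qed.

(** The kernel with its cut-offs in [t + t'] removed. It depends only on [(p - q) / e], so its
    integral in either variable is [e ^+ 2] times a constant, which is the input of Schur's test. *)
Definition dens (e : R) Psi1 Psi2 (z : PT * PT) : R :=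
  `|Psi1 (lin e^-1 (- e^-1) (pairx z.1 z.2)) * Psi2 (lin e^-1 (- e^-1) (pairy z.1 z.2))|.

Lemma measurable_dens e Psi1 Psi2 : continuous Psi1 -> continuous Psi2 ->
  measurable_fun setT (dens e Psi1 Psi2).
Proof.
move=> c1 c2; apply: measurableT_comp => //.
apply: (@measurable_ker R (Psi1 \o lin e^-1 (- e^-1)) (Psi2 \o lin e^-1 (- e^-1))) => z.
  by apply: continuous_comp; [exact: lin_continuous|exact: c1].
by apply: continuous_comp; [exact: lin_continuous|exact: c2].
Qed.

Lemma dens_mass_r e Psi1 Psi2 p : 0 < e -> cc1 Psi1 -> cc1 Psi2 ->
  (\int[leb2]_q (dens e Psi1 Psi2 (p, q))%:E)%E = (e ^+ 2 * tensor_absmass Psi1 Psi2)%:E.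
Proof.
move=> e0 h1 h2.
have e1 : - e != 0 by rewrite oppr_eq0 gt_eqF.
have m1 : measurable_fun setT (fun q : PT => (dens e Psi1 Psi2 (p, q))%:E).
  apply/measurable_EFinP; apply: (measurableT_comp (measurable_dens e h1.1 h2.1)).
  exact: measurable_pair1.
have G0 (q : PT) : (0 <= (dens e Psi1 Psi2 (p, q))%:E)%E by rewrite lee_fin /dens.
rewrite (ge0_integral_affine p e1 m1 G0) sqrrN [RHS]EFinM -tensor_absmassE//.
congr (_ * _)%E; apply: eq_integral => t _; congr (`|Psi1 _ * Psi2 _|%R%:E).
  by rewrite /lin /pairx/=; field; rewrite gt_eqF.
by rewrite /lin /pairy/=; field; rewrite gt_eqF.
Qed.

Lemma dens_mass_l e Psi1 Psi2 q : 0 < e -> cc1 Psi1 -> cc1 Psi2 ->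
  (\int[leb2]_p (dens e Psi1 Psi2 (p, q))%:E)%E = (e ^+ 2 * tensor_absmass Psi1 Psi2)%:E.
Proof.
move=> e0 h1 h2.
have e1 : e != 0 by rewrite gt_eqF.
have m1 : measurable_fun setT (fun p : PT => (dens e Psi1 Psi2 (p, q))%:E).
  apply/measurable_EFinP; apply: (measurableT_comp (measurable_dens e h1.1 h2.1)).
  exact: measurable_pair2.
have G0 (p : PT) : (0 <= (dens e Psi1 Psi2 (p, q))%:E)%E by rewrite lee_fin /dens.
rewrite (ge0_integral_affine q e1 m1 G0) [RHS]EFinM -tensor_absmassE//.
congr (_ * _)%E; apply: eq_integral => t _; congr (`|Psi1 _ * Psi2 _|%R%:E).
  by rewrite /lin /pairx/=; field; rewrite gt_eqF.
by rewrite /lin /pairy/=; field; rewrite gt_eqF.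
Qed.

Lemma dens_sqr_l e Psi1 Psi2 f : 0 < e -> cc1 Psi1 -> cc1 Psi2 ->
  (\int[leb2s \x leb2s]_z (dens e Psi1 Psi2 z * (f z.1 * f z.1))%:E =
   (e ^+ 2 * tensor_absmass Psi1 Psi2 * dot f f)%:E)%E.
Proof.
move=> e0 h1 h2.
have mz : measurable_fun setT (fun z : PT * PT => (dens e Psi1 Psi2 z * (f z.1 * f z.1))%:E).
  apply/measurable_EFinP; apply: measurable_funM; first exact: measurable_dens h1.1 h2.1.
  have h := measurableT_comp (measurable_Lsp f) (@measurable_fst _ _ PT PT).
  exact: (measurable_funM h h).
rewrite (fubini_tonelli1 _ mz); last first.
  by move=> z; rewrite lee_fin mulr_ge0 ?normr_ge0// -expr2 sqr_ge0.
rewrite [RHS]EFinM dotE -ge0_integralZl_EFin//; last 3 first.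
- by move=> x _; rewrite lee_fin -expr2 sqr_ge0.
- by apply/measurable_EFinP; apply: measurable_funM; exact: measurable_Lsp.
- by rewrite mulr_ge0 ?sqr_ge0 ?tensor_absmass_ge0.
apply: eq_integral => p _; rewrite -(dens_mass_r p e0 h1 h2) /fubini_F muleC.
rewrite -ge0_integralZl_EFin//.
- by apply: eq_integral => q _; rewrite -EFinM mulrC.
- by move=> q _; rewrite lee_fin /dens.
- apply/measurable_EFinP; apply: (measurableT_comp (measurable_dens e h1.1 h2.1)).
  exact: measurable_pair1.
- by rewrite -expr2 sqr_ge0.
Qed.

Lemma dens_sqr_r e Psi1 Psi2 f : 0 < e -> cc1 Psi1 -> cc1 Psi2 ->
  (\int[leb2s \x leb2s]_z (dens e Psi1 Psi2 z * (f z.2 * f z.2))%:E =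
   (e ^+ 2 * tensor_absmass Psi1 Psi2 * dot f f)%:E)%E.
Proof.
move=> e0 h1 h2.
have mz : measurable_fun setT (fun z : PT * PT => (dens e Psi1 Psi2 z * (f z.2 * f z.2))%:E).
  apply/measurable_EFinP; apply: measurable_funM; first exact: measurable_dens h1.1 h2.1.
  have h := measurableT_comp (measurable_Lsp f) (@measurable_snd _ _ PT PT).
  exact: (measurable_funM h h).
rewrite (fubini_tonelli2 _ mz); last first.
  by move=> z; rewrite lee_fin mulr_ge0 ?normr_ge0// -expr2 sqr_ge0.
rewrite [RHS]EFinM dotE -ge0_integralZl_EFin//; last 3 first.
- by move=> x _; rewrite lee_fin -expr2 sqr_ge0.
- by apply/measurable_EFinP; apply: measurable_funM; exact: measurable_Lsp.
- by rewrite mulr_ge0 ?sqr_ge0 ?tensor_absmass_ge0.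
apply: eq_integral => p _; rewrite -(dens_mass_l p e0 h1 h2) /fubini_G muleC.
rewrite -ge0_integralZl_EFin//.
- by apply: eq_integral => q _; rewrite -EFinM mulrC.
- by move=> q _; rewrite lee_fin /dens.
- apply/measurable_EFinP; apply: (measurableT_comp (measurable_dens e h1.1 h2.1)).
  exact: measurable_pair2.
- by rewrite -expr2 sqr_ge0.
Qed.

End ApproximateIdentity.

(** * Bounds uniform in the scale, by Schur's test *)

Section Schur.
Context {R : realType}.
Local Notation PT := (measurableTypeR R * measurableTypeR R)%type.
Local Notation L := (Lsp (@leb2 R)).
Implicit Types (Psi X : R -> R) (p : R * R) (f g w : L).

Lemma kap_le_dens Psi1 X1 Psi2 X2 : cc1 X1 -> cc1 X2 -> exists B : R, 0 <= B /\
  forall e p q, `|kap e Psi1 X1 (pairx p q) * kap e Psi2 X2 (pairy p q)| <= B * dens e Psi1 Psi2 (p, q).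
Proof.
move=> /cc1_bounded[B1 [B10 h1]] /cc1_bounded[B2 [B20 h2]].
exists (B1 * B2); split; first exact: mulr_ge0.
move=> e p q; rewrite /kap /dens/= mulrACA normrM mulrC; apply: ler_wpM2r => //.
by rewrite normrM; apply: ler_pM.
Qed.

(** Bound [|f p| |g q|] by the sum of the squares and integrate each square against [dens], whose
    mass cancels the prefactor [(e ^+ 2)^-1]. *)
Lemma kerform_schur Psi1 X1 Psi2 X2 : cc1 Psi1 -> cc1 X1 -> cc1 Psi2 -> cc1 X2 ->
  exists D : R, 0 <= D /\ forall e f g, 0 < e ->
    `|(e ^+ 2)^-1 * kerform (kap e Psi1 X1) (kap e Psi2 X2) f g| <= D * (dot f f + dot g g).
Proof.
move=> hP1 hX1 hP2 hX2; have [B [B0 hB]] := kap_le_dens Psi1 Psi2 hX1 hX2.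
exists (B * tensor_absmass Psi1 Psi2); split; first by rewrite mulr_ge0 ?tensor_absmass_ge0.
move=> e f g e0.
have e2 : 0 < e ^+ 2 by rewrite exprn_gt0.
have k1 := cc_kap e0 hP1 hX1; have k2 := cc_kap e0 hP2 hX2.
have iK := kerfun_int f g k1 k2.
rewrite normrM gtr0_norm ?invr_gt0// ler_pdivrMl//.
rewrite kerform_fubini// -/(fubini_F leb2s (EFin \o kerfun _ _ f g)).
rewrite [X in fine X](_ : _ = \int[leb2s \x leb2s]_z (EFin \o kerfun (kap e Psi1 X1) (kap e Psi2 X2) f g) z)%E; last first.
  exact: (integral12_prod_meas1 iK).
pose T1 (z : PT * PT) : R := dens e Psi1 Psi2 z * (f z.1 * f z.1).
pose T2 (z : PT * PT) : R := dens e Psi1 Psi2 z * (g z.2 * g z.2).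
have md := measurable_dens e hP1.1 hP2.1.
have mT1 : measurable_fun setT T1.
  have h := measurableT_comp (measurable_Lsp f) (@measurable_fst _ _ PT PT).
  exact: (measurable_funM md (measurable_funM h h)).
have mT2 : measurable_fun setT T2.
  have h := measurableT_comp (measurable_Lsp g) (@measurable_snd _ _ PT PT).
  exact: (measurable_funM md (measurable_funM h h)).
have T10 z : 0 <= T1 z by rewrite /T1 mulr_ge0 ?normr_ge0// -expr2 sqr_ge0.
have T20 z : 0 <= T2 z by rewrite /T2 mulr_ge0 ?normr_ge0// -expr2 sqr_ge0.
have Ifin := integrable_fin_num measurableT iK.
rewrite -lee_fin -[X in (X <= _)%E]/(`|(fine _)%:E|)%E (fineK Ifin).
apply: (le_trans (le_abse_integral _ measurableT (measurable_int _ iK))).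
apply: (@le_trans _ _ (\int[leb2s \x leb2s]_z (B%:E * ((T1 z)%:E + (T2 z)%:E)))%E).
  apply: ge0_le_integral => //.
  - by apply: measurableT_comp => //; exact: (measurable_int _ iK).
  - apply/measurable_EFinP; apply: measurable_funM => //; exact: measurable_funD mT1 mT2.
  move=> [p q] _; rewrite /= -EFinD -EFinM lee_fin /kerfun /kerw /T1 /T2 /=.
  have := hB e p q; set k := kap e Psi1 X1 _ * _; set dd := dens _ _ _ _ => hk.
  have d0 : 0 <= dd by rewrite /dd normr_ge0.
  apply: (@le_trans _ _ (B * dd * (`|f p| * `|g q|))).
    by rewrite mulrCA normrM (normrM (f p)); apply: ler_wpM2r => //; exact: mulr_ge0.
  rewrite -mulrDr mulrA ler_wpM2l ?mulr_ge0//.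
  rewrite -!expr2 -(real_normK (num_real (f p))) -(real_normK (num_real (g q))).
  have := sqr_ge0 (`|f p| - `|g q|); have := sqr_ge0 (`|f p|); have := sqr_ge0 (`|g q|).
  by rewrite sqrrB; lra.
rewrite ge0_integralZl//; last 2 first.
  by apply: emeasurable_funD; exact/measurable_EFinP.
  by move=> z _; rewrite adde_ge0 ?lee_fin.
rewrite ge0_integralD//; last 4 first.
  by move=> z _; rewrite lee_fin.
  exact/measurable_EFinP.
  by move=> z _; rewrite lee_fin.
  exact/measurable_EFinP.
rewrite (dens_sqr_l f e0 hP1 hP2) (dens_sqr_r g e0 hP1 hP2).
by rewrite -EFinD -EFinM lee_fin le_eqVlt; apply/orP; left; apply/eqP; ring.
Qed.

(** Apply [kerform_schur] to [t *: f] for all [t] and take the discriminant. A bound by a product of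
    norms is small as soon as one argument is, which the density argument in [kerform_limit]
    needs. *)
Lemma kerform_CS Psi1 X1 Psi2 X2 : cc1 Psi1 -> cc1 X1 -> cc1 Psi2 -> cc1 X2 ->
  exists D : R, 0 <= D /\ forall e f g, 0 < e ->
    `|(e ^+ 2)^-1 * kerform (kap e Psi1 X1) (kap e Psi2 X2) f g| <=
      D * (Num.sqrt (dot f f) * Num.sqrt (dot g g)).
Proof.
move=> hP1 hX1 hP2 hX2; have [D [D0 hD]] := kerform_schur hP1 hX1 hP2 hX2.
exists (2 * D); split; first exact: mulr_ge0.
move=> e f g e0.
have k1 := cc_kap e0 hP1 hX1; have k2 := cc_kap e0 hP2 hX2.
set T := (_ * kerform _ _ f g).
have : (T / 2) ^+ 2 <= (D * dot g g) * (D * dot f f).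
  apply: poly2_ge0 => t.
  have := hD e (t *: f) g e0.
  have -> : kerform (kap e Psi1 X1) (kap e Psi2 X2) (t *: f) g = t * kerform (kap e Psi1 X1) (kap e Psi2 X2) f g.
    have := kerform_comb1 (t - 1) f f g k1 k2.
    by rewrite -{2}(scale1r f) -scalerDl subrK => ->; ring.
  rewrite dotZl (dotC f) dotZl mulrCA -/T ler_norml => /andP[h1 h2].
  by move: h1; rewrite mulrDr; lra.
move=> h.
have -> : 2 * D * (Num.sqrt (dot f f) * Num.sqrt (dot g g)) =
    2 * Num.sqrt ((D * dot g g) * (D * dot f f)).
  rewrite [X in 2 * Num.sqrt X]mulrACA -expr2 sqrtrM ?sqr_ge0// sqrtr_sqr ger0_norm//.
  by rewrite sqrtrM ?dot_ge0//; ring.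
have -> : `|T| = 2 * Num.sqrt ((T / 2) ^+ 2).
  by rewrite sqrtr_sqr normf_div (gtr0_norm (ltr0n _ 2)); field.
by rewrite ler_wpM2l// ler_wsqrtr.
Qed.

End Schur.

(** * Limits of the rescaled kernel forms *)

Section Limit.
Context {R : realType}.
Local Notation PT := (measurableTypeR R * measurableTypeR R)%type.
Local Notation L := (Lsp (@leb2 R)).
Implicit Types (Psi X : R -> R) (p : R * R) (f g w : L).

Definition eps (n : nat) : R := n.+1%:R^-1.

Lemma eps_gt0 n : 0 < eps n. Proof. by rewrite /eps invr_gt0. Qed.

Lemma eps_cvg0 : eps n @[n --> \oo] --> 0. Proof. exact: cvg_harmonic. Qed.

Lemma eps_affine_cvg (c d : R) : c + - eps n * d @[n --> \oo] --> c.
Proof.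
have h : c + - eps n * d @[n --> \oo] --> c + - 0 * d.
  apply: cvgD; first exact: cvg_cst.
  by apply: cvgM; [apply: cvgN; exact: eps_cvg0|exact: cvg_cst].
by rewrite oppr0 mul0r addr0 in h.
Qed.

Lemma affine_eps_cvg p (t : PT) : (affine p (- eps n) t : R * R) @[n --> \oo] --> p.
Proof.
have h : ((p.1 + - eps n * t.1, p.2 + - eps n * t.2) : R * R) @[n --> \oo] --> ((p.1, p.2) : R * R).
  exact: (cvg_pair (@eps_affine_cvg p.1 t.1) (@eps_affine_cvg p.2 t.2)).
by rewrite -surjective_pairing in h.
Qed.

Lemma kerw_rescale e Psi1 X1 Psi2 X2 g p t : 0 < e ->
  kerw (kap e Psi1 X1) (kap e Psi2 X2) g p (affine p (- e) t) =
  Psi1 t.1 * Psi2 t.2 * (X1 (e * (p.1 + (p.1 + - e * t.1))) * X2 (e * (p.2 + (p.2 + - e * t.2)))) *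
    g (affine p (- e) t).
Proof.
move=> e0; rewrite /kerw /kap /lin /pairx /pairy /=; congr (_ * _).
have e1 : e != 0 by rewrite gt_eqF.
have -> : e^-1 * p.1 + - e^-1 * (p.1 + - e * t.1) = t.1 by field.
have -> : e^-1 * p.2 + - e^-1 * (p.2 + - e * t.2) = t.2 by field.
by rewrite -!mulrDr mulrACA.
Qed.

(** Substitute [q = p - e t]: the Jacobian cancels [(e ^+ 2)^-1], the profiles [Psi1] and [Psi2]
    lose their dependence on [e], and the arguments of [X1] and [X2] tend to 0. Dominated
    convergence does the rest. *)
Lemma kernel_limit_pt Psi1 X1 Psi2 X2 g p :
  cc1 Psi1 -> cc1 X1 -> cc1 Psi2 -> cc1 X2 -> cc (g : R * R -> R) ->
  exists C : R, [/\ 0 <= C,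
    forall n p, `|(eps n ^+ 2)^-1 * kerop (kap (eps n) Psi1 X1) (kap (eps n) Psi2 X2) g p| <= C &
    (eps n ^+ 2)^-1 * kerop (kap (eps n) Psi1 X1) (kap (eps n) Psi2 X2) g p @[n --> \oo] -->
      X1 0 * X2 0 * tensor_mass Psi1 Psi2 * g p].
Proof.
move=> hP1 hX1 hP2 hX2 hg.
have [B1 [B10 b1]] := cc1_bounded hX1; have [B2 [B20 b2]] := cc1_bounded hX2.
have [Bg bg] := cc_bounded hg.1 hg.2.
have Bg0 : 0 <= Bg by apply: le_trans (bg 0).
have iT := cc_int (cc_tensor hP1 hP2).
pose J n (p : R * R) (t : PT) := kerw (kap (eps n) Psi1 X1) (kap (eps n) Psi2 X2) g p (affine p (- eps n) t).
have kE n p' : (eps n ^+ 2)^-1 * kerop (kap (eps n) Psi1 X1) (kap (eps n) Psi2 X2) g p' =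
    \int[leb2]_t J n p' t.
  have e0 := eps_gt0 n.
  have e1 : - eps n != 0 by rewrite oppr_eq0 gt_eqF.
  have k1 := cc_kap e0 hP1 hX1; have k2 := cc_kap e0 hP2 hX2.
  rewrite /kerop (Rintegral_affine p' e1 (kerw_int g p' k1 k2)) sqrrN mulrA mulVf ?mul1r//.
  by rewrite expf_neq0// gt_eqF.
pose G (t : PT) : R := B1 * B2 * Bg * `|Psi1 t.1 * Psi2 t.2|.
have iG : leb2.-integrable setT (EFin \o G).
  exact: (integrableZl measurableT (B1 * B2 * Bg) (integrable_abse iT)).
have G0 t : 0 <= G t by rewrite /G !mulr_ge0.
have JG n p' t : `|J n p' t| <= G t.
  rewrite /J kerw_rescale ?eps_gt0//.
  have -> : G t = `|Psi1 t.1 * Psi2 t.2| * (B1 * B2) * Bg by rewrite /G; ring.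
  rewrite normrM normrM; apply: ler_pM => //; apply: ler_wpM2l => //.
  by rewrite normrM; apply: ler_pM.
have mJ n p' : measurable_fun setT (J n p').
  have k1 := cc_kap (eps_gt0 n) hP1 hX1; have k2 := cc_kap (eps_gt0 n) hP2 hX2.
  exact: (measurableT_comp (measurable_kerw g p' k1.1 k2.1) (@measurable_affine R p' (- eps n))).
have iJ n p' : leb2.-integrable setT (EFin \o J n p').
  apply: le_integrable iG => //; first exact/measurable_EFinP.
  by move=> t _; rewrite /= lee_fin (ger0_norm (G0 t)).
exists (\int[leb2]_t G t); split.
- exact: Rintegral_ge0.
- move=> n p'; rewrite kE; apply: (le_trans (le_normr_Rintegral measurableT (iJ n p'))).
  by apply: le_Rintegral => //; exact: (integrable_abse (iJ n p')).
under eq_fun do rewrite kE.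
have -> : X1 0 * X2 0 * tensor_mass Psi1 Psi2 * g p =
    \int[leb2]_t (X1 0 * X2 0 * g p * (Psi1 t.1 * Psi2 t.2)).
  by rewrite (RintegralZl _ measurableT iT) /tensor_mass; ring.
apply: fine_cvg; rewrite fineK; last first.
  apply: integrable_fin_num => //; exact: (integrableZl measurableT (X1 0 * X2 0 * g p) iT).
apply: (@dominated_cvg _ _ _ leb2 setT measurableT (fun n t => (J n p t)%:E) _ (EFin \o G)) => //.
- by move=> n; exact/measurable_EFinP.
- move=> t _; apply: cvg_EFin; first exact: nearW.
  have X_cvg X (x y : R) : cc1 X -> X (eps n * (x + (x + - eps n * y))) @[n --> \oo] --> X 0.
    move=> hX; have h : eps n * (x + (x + - eps n * y)) @[n --> \oo] --> 0 * (x + x).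
      apply: cvgM; first exact: eps_cvg0.
      by apply: cvgD; [exact: cvg_cst|exact: eps_affine_cvg].
    by rewrite mul0r in h; exact: (continuous_cvg _ (hX.1 0) h).
  have g_cvg : g (affine p (- eps n) t) @[n --> \oo] --> g p.
    have h := @affine_eps_cvg p t.
    exact: (continuous_cvg _ (hg.1 p) h).
  have -> : X1 0 * X2 0 * g p * (Psi1 t.1 * Psi2 t.2) = Psi1 t.1 * Psi2 t.2 * (X1 0 * X2 0) * g p by ring.
  rewrite (_ : fine \o _ = (fun n => Psi1 t.1 * Psi2 t.2 * (X1 (eps n * (p.1 + (p.1 + - eps n * t.1))) * X2 (eps n * (p.2 + (p.2 + - eps n * t.2)))) *
    g (affine p (- eps n) t))); last first.
    by apply/funext => n /=; rewrite /J kerw_rescale// eps_gt0.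
  apply: cvgM; last exact: g_cvg.
  apply: cvgM; first exact: cvg_cst.
  by apply: cvgM; exact: X_cvg.
- by move=> n t _; rewrite lee_fin.
Qed.

Lemma kerform_limit_cc Psi1 X1 Psi2 X2 f g :
  cc1 Psi1 -> cc1 X1 -> cc1 Psi2 -> cc1 X2 -> cc (f : R * R -> R) -> cc (g : R * R -> R) ->
  (eps n ^+ 2)^-1 * kerform (kap (eps n) Psi1 X1) (kap (eps n) Psi2 X2) f g @[n --> \oo] -->
    X1 0 * X2 0 * tensor_mass Psi1 Psi2 * dot f g.
Proof.
move=> hP1 hX1 hP2 hX2 hf hg.
pose T n p := (eps n ^+ 2)^-1 * kerop (kap (eps n) Psi1 X1) (kap (eps n) Psi2 X2) g p.
have k1 n := cc_kap (eps_gt0 n) hP1 hX1; have k2 n := cc_kap (eps_gt0 n) hP2 hX2.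
have kE n : (eps n ^+ 2)^-1 * kerform (kap (eps n) Psi1 X1) (kap (eps n) Psi2 X2) f g =
    \int[leb2]_p (f p * T n p).
  rewrite -(RintegralZl _ measurableT (kerop_int_dot f g (k1 n) (k2 n))).
  by apply: eq_Rintegral => p _; rewrite /T; ring.
under eq_fun do rewrite kE.
have ifg := dot_int f g.
have -> : X1 0 * X2 0 * tensor_mass Psi1 Psi2 * dot f g =
    \int[leb2]_p (X1 0 * X2 0 * tensor_mass Psi1 Psi2 * (f p * g p)).
  by rewrite (RintegralZl _ measurableT ifg).
apply: fine_cvg; rewrite fineK; last first.
  by apply: integrable_fin_num => //; exact: (integrableZl measurableT _ ifg).
have [C [C0 hC _]] := kernel_limit_pt 0 hP1 hX1 hP2 hX2 hg.
apply: (@dominated_cvg _ _ _ leb2 setT measurableT (fun n p => (f p * T n p)%:E) _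
  (EFin \o (fun p => C * `|f p|))) => //.
- move=> n; apply/measurable_EFinP; apply: measurable_funM; first exact: measurable_Lsp.
  apply: measurable_funM => //; apply: continuous_measurable_plane.
  exact: (cc_kerop g (k1 n) (k2 n)).1.
- move=> p _; apply: cvg_EFin; first exact: nearW.
  have [_ [_ _ h]] := kernel_limit_pt p hP1 hX1 hP2 hX2 hg.
  have -> : X1 0 * X2 0 * tensor_mass Psi1 Psi2 * (f p * g p) =
    f p * (X1 0 * X2 0 * tensor_mass Psi1 Psi2 * g p) by ring.
  by apply: cvgM; [exact: cvg_cst|exact: h].
- exact: (integrableZl measurableT C (integrable_abse (cc_int hf))).
- by move=> n p _; rewrite /= lee_fin normrM mulrC; apply: ler_wpM2r => //; exact: hC.
Qed.

(** Every function met later is a limit of test functions by construction of the graphs, so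
    membership in this closure is proved case by case. *)
Definition cc_closure w := exists phi : nat -> L,
  (forall n, cc (phi n : R * R -> R)) /\ form_cvg (@dot _ _ _ _) phi w.

Lemma kerform_limit Psi1 X1 Psi2 X2 f g :
  cc1 Psi1 -> cc1 X1 -> cc1 Psi2 -> cc1 X2 -> cc_closure f -> cc_closure g ->
  (eps n ^+ 2)^-1 * kerform (kap (eps n) Psi1 X1) (kap (eps n) Psi2 X2) f g @[n --> \oo] -->
    X1 0 * X2 0 * tensor_mass Psi1 Psi2 * dot f g.
Proof.
move=> hP1 hX1 hP2 hX2 [phi [cphi lphi]] [psi [cpsi lpsi]].
have [D [D0 hD]] := kerform_CS hP1 hX1 hP2 hX2.
set kk := X1 0 * X2 0 * tensor_mass Psi1 Psi2.
pose T n f g := (eps n ^+ 2)^-1 * kerform (kap (eps n) Psi1 X1) (kap (eps n) Psi2 X2) f g.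
have k1 n := cc_kap (eps_gt0 n) hP1 hX1; have k2 n := cc_kap (eps_gt0 n) hP2 hX2.
have hC := @dotC _ _ _ (@leb2 R); have hDl := @dotDl _ _ _ (@leb2 R).
have hZl := @dotZl _ _ _ (@leb2 R); have h0 := @dot_ge0 _ _ _ (@leb2 R).
have sq (u : nat -> L) v : form_cvg (@dot _ _ _ _) u v ->
    Num.sqrt (dot (u n - v) (u n - v)) @[n --> \oo] --> 0.
  by move=> h; rewrite -[X in _ --> X]sqrtr0; apply: (continuous_cvg _ (@sqrt_continuous R 0) h).
have s1 := sq _ _ lphi; have s2 := sq _ _ lpsi.
have s3 : Num.sqrt (dot (phi j) (phi j)) @[j --> \oo] --> Num.sqrt (dot f f).
  by have h := form_cvg_dot hC hDl hZl h0 lphi lphi; exact: (continuous_cvg _ (@sqrt_continuous R _) h).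
have s4 := form_cvg_dot hC hDl hZl h0 lphi lpsi.
(* Bounds, uniformly in [n], the error of replacing [f] and [g] by [phi j] and [psi j]. Hence [j]
   can be fixed before [n] tends to infinity. *)
pose A j := D * (Num.sqrt (dot (phi j - f) (phi j - f)) * Num.sqrt (dot g g)) +
  D * (Num.sqrt (dot (phi j) (phi j)) * Num.sqrt (dot (psi j - g) (psi j - g))) +
  `|kk * (dot (phi j) (psi j) - dot f g)|.
have A0 : A j @[j --> \oo] --> 0.
  have h : A j @[j --> \oo] --> D * (0 * Num.sqrt (dot g g)) + D * (Num.sqrt (dot f f) * 0) +
     `|kk * (dot f g - dot f g)|.
    apply: cvgD; first apply: cvgD.
    - by apply: cvgM; [exact: cvg_cst|apply: cvgM; [exact: s1|exact: cvg_cst]].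
    - by apply: cvgM; [exact: cvg_cst|apply: cvgM; [exact: s3|exact: s2]].
    - apply: cvg_norm; apply: cvgM; first exact: cvg_cst.
      by apply: cvgB; [exact: s4|exact: cvg_cst].
  by rewrite subrr !mulr0 mul0r mulr0 normr0 !addr0 in h.
apply/cvgrPdist_lt => e e0.
have e2 : 0 < e / 2 by rewrite divr_gt0.
have /cvgrPdist_lt/(_ _ e2)[j _ hj] := A0.
have {hj} := hj j (leqnn j).
rewrite /= sub0r normrN => /(le_lt_trans (ler_norm _)) Aj.
have lim := kerform_limit_cc hP1 hX1 hP2 hX2 (cphi j) (cpsi j).
have /cvgrPdist_lt/(_ _ e2) := lim.
apply: filterS => n hn.
have alg2 (r x y : R) : r * (-1 * x + y) = r * y - r * x by ring.
have alg (k x y t t1 t2 : R) : k * x - t = t1 - t + (t2 - t1) - k * (y - x) + (k * y - t2) by ring.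
have split3 : kk * dot f g - T n f g =
   (T n (phi j - f) g + T n (phi j) (psi j - g)) - kk * (dot (phi j) (psi j) - dot f g) +
   (kk * dot (phi j) (psi j) - T n (phi j) (psi j)).
  have E1 : T n (phi j - f) g = T n (phi j) g - T n f g.
    by rewrite /T addrC -[- f]scaleN1r (kerform_comb1 (-1) f (phi j) g (k1 n) (k2 n)); exact: alg2.
  have E2 : T n (phi j) (psi j - g) = T n (phi j) (psi j) - T n (phi j) g.
    by rewrite /T addrC -[- g]scaleN1r (kerform_comb2 (-1) (phi j) g (psi j) (k1 n) (k2 n)); exact: alg2.
  by rewrite E1 E2; exact: alg.
rewrite -/(T n f g) split3.
apply: le_lt_trans (ler_normD _ _) _.
have -> : e = e / 2 + e / 2 by rewrite -splitr.
apply: ler_ltD; last exact: hn.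
apply: le_trans (ltW Aj); rewrite /A.
apply: le_trans (ler_normB _ _) _; apply: lerD => //.
apply: le_trans (ler_normD _ _) _; apply: lerD; apply: hD; exact: eps_gt0.
Qed.

End Limit.

(** * The symmetrised cut-off and its profiles *)

Section Bump.
Context {R : realType}.
Implicit Types (Psi X : R -> R).

Lemma derive1_reflect Psi t : (forall t, derivable Psi t 1) ->
  derivable (fun t => Psi (- t)) t 1 /\ derive1 (fun t => Psi (- t)) t = - derive1 Psi (- t).
Proof.
move=> dP.
have dN : derivable (-%R : R -> R) t 1.
  have di : derivable (@id R) t 1 by exact: derivable_id.
  exact (derivableN di).
split.
  apply/derivable1_diffP; apply: (@differentiable_comp _ _ _ _ (-%R : R -> R) Psi).
    exact/derivable1_diffP.
  exact/derivable1_diffP.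
have C := @derive1_comp R (-%R : R -> R) Psi t dN (dP _).
refine (etrans C _).
have di : derivable (@id R) t 1 by exact: derivable_id.
have -> : derive1 (-%R : R -> R) t = -1.
  by rewrite derive1E; refine (etrans (deriveN di) _); rewrite derive_id.
by rewrite mulrN1.
Qed.

Lemma derive1n_reflect Psi n : smooth1 Psi ->
  derive1n n (fun t => Psi (- t)) = (fun t => (-1) ^+ n * derive1n n Psi (- t)).
Proof.
move=> sP; elim: n => [|n IH].
  by apply/funext => t /=; rewrite expr0 mul1r.
rewrite derive1nS IH; apply/funext => t.
have [d e] := derive1_reflect t (sP n).
have h : derive1 ((-1) ^+ n \*: (fun t => derive1n n Psi (- t))) t = (-1) ^+ n * derive1 (fun t => derive1n n Psi (- t)) t.
  by rewrite !derive1E; exact: (deriveZ _ d).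
refine (etrans h _).
by rewrite e derive1nS exprS; ring.
Qed.

Lemma smooth1_reflect Psi : smooth1 Psi -> smooth1 (fun t => Psi (- t)).
Proof.
move=> sP n t; rewrite derive1n_reflect//.
have [d _] := derive1_reflect t (sP n).
exact: (derivableZ (k := (-1) ^+ n) d).
Qed.

Lemma derive1nD Psi X n : smooth1 Psi -> smooth1 X ->
  derive1n n (fun t => Psi t + X t) = (fun t => derive1n n Psi t + derive1n n X t).
Proof.
move=> sP sX; elim: n => [//|n IH].
rewrite derive1nS IH; apply/funext => t; rewrite !derive1nS !derive1E.
exact: (deriveD (sP n t) (sX n t)).
Qed.

Lemma smooth1D Psi X : smooth1 Psi -> smooth1 X -> smooth1 (fun t => Psi t + X t).
Proof.
move=> sP sX n t; rewrite derive1nD//; exact: (derivableD (sP n t) (sX n t)).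
Qed.

Lemma cc1_derive Psi : smooth1 Psi -> cc1 Psi -> cc1 (derive1 Psi).
Proof.
move=> sP [_ [M hM]]; split; first exact: smooth1_continuous (smooth1_derive sP).
by exists M => t tM; rewrite derive1E; exact: derive_outside hM tM.
Qed.

Lemma cc1_idM Psi : cc1 Psi -> cc1 (fun t => t * Psi t).
Proof.
move=> [cP [M hM]]; split; last by exists M => t /hM ->; rewrite mulr0.
by move=> t; apply: cvgM; [exact: cvg_id|exact: cP].
Qed.

Lemma cc1D Psi X : cc1 Psi -> cc1 X -> cc1 (fun t => Psi t + X t).
Proof.
move=> [cP [M hM]] [cX [N hN]]; split.
  by move=> t; apply: cvgD; [exact: cP|exact: cX].
by exists (Num.max M N) => t; rewrite gt_max => /andP[/hM -> /hN ->]; rewrite addr0.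
Qed.

Lemma cc1_reflect Psi : smooth1 Psi -> cc1 Psi -> cc1 (fun t => Psi (- t)).
Proof.
move=> sP [cP [M hM]]; split; first exact: smooth1_continuous (smooth1_reflect sP).
by exists M => t; rewrite -normrN => /hM.
Qed.

(** A cut-off is not assumed even. Symmetrising it gives the profile in [t - t'] a definite parity,
    and so do its derivatives and its products with powers of [t]. *)
Definition bump (F : R -> R) : R -> R := fun t => F t + F (- t).

Lemma bump_even F t : bump F (- t) = bump F t.
Proof. by rewrite /bump opprK addrC. Qed.

Lemma rtest_kap e Psi X : 0 < e -> smooth1 Psi -> smooth1 X -> cc1 Psi -> cc1 X ->
  rtest (kap e Psi X).
Proof.
move=> e0 sP sX cP cX; split; last exact: (cc_kap e0 cP cX).2.
by move=> k; apply: (CkM (Ck_comp_lin _ _ _ sP) (Ck_comp_lin _ _ _ sX)).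
Qed.

Lemma partialx_kap e Psi X : smooth1 Psi -> smooth1 X ->
  partialx (kap e Psi X) = (fun z => e^-1 * kap e (derive1 Psi) X z + e * kap e Psi (derive1 X) z).
Proof.
move=> sP sX; apply/funext => z.
have [d1 e1] := derive_comp_lin e^-1 (- e^-1) z (1, 0) (sP 0%N).
have [d2 e2] := derive_comp_lin e e z (1, 0) (sX 0%N).
refine (etrans (deriveM d1 d2) _).
rewrite e1 e2 -![_ *: _]/(_ * _) /kap/=.
have -> : lin e^-1 (- e^-1) (1, 0) = e^-1 by rewrite /lin /= mulr0 addr0 mulr1.
have -> : lin e e (1, 0) = e by rewrite /lin /= mulr0 addr0 mulr1.
by move: (derive1 Psi _) (derive1 X _) => x y; ring.
Qed.

Lemma tr_kap e Psi X z : tr (kap e Psi X) z = kap e (fun t => Psi (- t)) X z.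
Proof.
rewrite /tr /kap; congr (Psi _ * X _); rewrite /lin /=; ring.
Qed.

(** The integrand is the derivative in the first coordinate of [Psi p.1 * X p.2], which has bounded
    support. *)
Lemma tensor_mass_derive Psi X : smooth1 Psi -> cc1 Psi -> cc1 X ->
  tensor_mass (derive1 Psi) X = 0.
Proof.
move=> sP cP cX.
pose f (p : R * R) : R := X p.2 * (Psi \o lin 1 0) p.
have l10 p : lin 1 0 p = p.1 by rewrite /lin mul1r mul0r addr0.
have df p : derivable f p (1, 0) /\ 'D_(1, 0) f p = X p.2 * 'D_(1, 0) (Psi \o lin 1 0) p.
  apply: scaled_comp_derive; last exact: (derive_comp_lin _ _ _ _ (sP 0%N)).1.
  by move=> h; rewrite /f /= [h *: 0]mulr0 add0r.
have Df p : 'D_(1, 0) f p = derive1 Psi p.1 * X p.2.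
  rewrite (df p).2 (derive_comp_lin _ _ _ _ (sP 0%N)).2.
  have -> : lin 1 0 (1, 0) = 1 :> R by rewrite /lin /= mulr0 addr0 mulr1.
  by rewrite l10 mulr1 mulrC.
have fE : f = (fun p => Psi p.1 * X p.2) by apply/funext => p; rewrite /f /= l10 mulrC.
have cf : cc f by rewrite fE; exact: cc_tensor.
have E : 'D_(1, 0) f = (fun p => derive1 Psi p.1 * X p.2) by apply/funext.
have cDf : continuous ('D_(1, 0) f).
  by rewrite E; exact: (cc_tensor (cc1_derive sP cP) cX).1.
have := integral_derive_eq0 cf.1 cf.2 (fun p => (df p).1) cDf.
by rewrite E.
Qed.

Section Cutoff.
Variable F : R -> R.
Hypothesis hF : cutoff F.

Lemma cutoff_smooth : smooth1 F.
Proof. by have [] := hF. Qed.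

Lemma cutoff_cc1 : cc1 F.
Proof.
have [_ _ _ h] := hF; split; first exact: smooth1_continuous cutoff_smooth.
by exists 2 => t /ltW; exact: h.
Qed.

Lemma cutoff0 : F 0 = 1.
Proof. by have [_ _ h _] := hF; apply: h; rewrite normr0. Qed.

Lemma cutoff_derive0 : derive1 F 0 = 0.
Proof.
rewrite derive1E; apply: derive_locally_cst; rewrite cutoff0.
apply/nbhs_ballP; exists 1 => //= q; rewrite -ball_normE /= sub0r normrN => /ltW.
by have [_ _ h _] := hF; exact: h.
Qed.

Lemma bump_smooth : smooth1 (bump F).
Proof. by apply: smooth1D; [exact: cutoff_smooth|exact: smooth1_reflect cutoff_smooth]. Qed.

Lemma bump_cc1 : cc1 (bump F).
Proof. by apply: cc1D; [exact: cutoff_cc1|exact: cc1_reflect cutoff_smooth cutoff_cc1]. Qed.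

Lemma bump_derive_odd t : derive1 (bump F) (- t) = - derive1 (bump F) t.
Proof.
have [_ e] := derive1_reflect t (@bump_smooth 0%N).
have E : (fun t => bump F (- t)) = bump F by apply/funext => s; exact: bump_even.
by move: e; rewrite /= E => ->; rewrite opprK.
Qed.

Lemma bump_derive2_even t : derive1 (derive1 (bump F)) (- t) = derive1 (derive1 (bump F)) t.
Proof.
have sb := smooth1_derive bump_smooth.
have [_ e] := derive1_reflect t (sb 0%N).
have E : (fun t => derive1 (bump F) (- t)) = \- derive1 (bump F).
  by apply/funext => s; exact: bump_derive_odd.
move: e; rewrite /= E derive1E => e.
have dd : derivable (derive1 (bump F)) t 1 by exact: (sb 0%N).
have := deriveN dd; rewrite -[in RHS]derive1E => e'.
by apply: oppr_inj; exact: etrans (esym e) e'.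
Qed.

Lemma bump_mass : 0 < tensor_mass (bump F) (bump F).
Proof.
have [_ F01 F1 _] := hF.
have b0 t : 0 <= bump F t.
  by have /andP[h1 _] := F01 t; have /andP[h2 _] := F01 (- t); rewrite /bump addr_ge0.
have iT := cc_int (cc_tensor bump_cc1 bump_cc1).
apply: (@lt_le_trans _ _ (\int[leb2]_(p in [set: measurableTypeR R * measurableTypeR R]) \1_(box (1 : R)) p)).
  rewrite /Rintegral integral_indic//; last exact: measurable_box.
  rewrite setIT /box leb2X// !lebesgue_measure_itv/= lte_fin gt0_cp//.
  by rewrite -EFinD -EFinM /= mulr_gt0// opprK addr_gt0.
apply: (le_Rintegral (mu := leb2)) => //.
  apply: bounded_bsupp_integrable.
  - exact: measurable_indic (measurable_box 1).
  - exists 1 => p pM; rewrite indicE memNset//.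
    by move=> /boxP; rewrite leNgt pM.
  - by exists 1 => p; rewrite indicE; case: (_ \in _); rewrite ?normr1 ?normr0.
move=> p _; rewrite indicE; case: (boolP (p \in _)) => [|_]; last exact: mulr_ge0.
rewrite inE => -[/=]; rewrite !in_itv/= -!ler_norml => h1 h2.
have b1 t : `|t| <= 1 -> 1 <= bump F t.
  by move=> t1; rewrite /bump (F1 _ t1) lerDl; have /andP[] := F01 (- t).
by rewrite -[leLHS]mulr1; apply: ler_pM => //; exact: b1.
Qed.

End Cutoff.

End Bump.

(** * Resolvent of the free Hamiltonian *)

Section Deficiency.
Context {R : realType}.
Local Notation PT := (measurableTypeR R * measurableTypeR R)%type.
Local Notation L := (Lsp (@leb2 R)).
Local Notation E := (L * L)%type.
Implicit Types (Psi X : R -> R) (a b : R * R -> R) (p : R * R) (f g w : L).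

Lemma toLE (f : R * R -> R) : cc f -> toL f = f :> (PT -> R).
Proof. by move=> [c s]; exact: toLspE (cc_L2 c s). Qed.

(** Multiplication by a function of a coordinate is absorbed into the kernel, so unbounded
    coefficients only ever meet functions of bounded support. *)
Lemma kerop_mul1 (c : R -> R) a b w p : cc a -> cc b ->
  c p.1 * kerop a b w p = kerop (fun z => c z.1 * a z) b w p.
Proof.
move=> ha hb; rewrite -(RintegralZl (c p.1) measurableT (kerw_int w p ha hb)).
by apply: eq_Rintegral => q _; rewrite /kerw /= !mulrA.
Qed.

Lemma kerop_mul2 (c : R -> R) a b w p : cc a -> cc b ->
  c p.2 * kerop a b w p = kerop a (fun z => c z.1 * b z) w p.
Proof.
move=> ha hb; rewrite -(RintegralZl (c p.2) measurableT (kerw_int w p ha hb)).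
apply: eq_Rintegral => q _; rewrite /kerw /=.
by move: (a _) (b _) => x y; ring.
Qed.

Lemma cc_coord (c : R -> R) a : continuous c -> cc a -> cc (fun z => c z.1 * a z).
Proof.
move=> cc0; apply: ccM => z.
by apply: (@continuous_comp _ _ _ fst c); [exact: continuous_fst_plane|exact: cc0].
Qed.

Lemma continuous_idR : continuous (fun t : R => t).
Proof. by move=> t; exact: cvg_id. Qed.

Lemma continuous_sqrR : continuous (fun t : R => t ^+ 2).
Proof. by move=> t; exact: exprn_continuous. Qed.

Lemma kerform_schrodinger a f w : rtest a ->
  \int[leb2]_p (f p * schrodinger (kerop a a w) p) =
  - kerform (partialx (partialx a)) a f w - kerform a (partialx (partialx a)) f w
  + kerform a (fun z => z.1 ^+ 2 * a z) f w + kerform (fun z => z.1 * a z) a f w.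
Proof.
move=> ta; have ha := cc_rtest ta.
have ta1 := rtest_partialx ta; have ta2 := rtest_partialx ta1.
have ha2 := cc_rtest ta2.
have hy := cc_coord continuous_sqrR ha; have hx := cc_coord continuous_idR ha.
have E1 : partialx (kerop a a w) = kerop (partialx a) a w.
  by apply/funext => p; have [[_ ->] _] := kerop_partial w p ta ta.
have E2 : partialx (partialx (kerop a a w)) = kerop (partialx (partialx a)) a w.
  by rewrite E1; apply/funext => p; have [[_ ->] _] := kerop_partial w p ta1 ta.
have E3 : partialy (kerop a a w) = kerop a (partialx a) w.
  by apply/funext => p; have [_ [_ ->]] := kerop_partial w p ta ta.
have E4 : partialy (partialy (kerop a a w)) = kerop a (partialx (partialx a)) w.
  by rewrite E3; apply/funext => p; have [_ [_ ->]] := kerop_partial w p ta ta1.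
have i1 := kerop_int_dot f w ha2 ha; have i2 := kerop_int_dot f w ha ha2.
have i3 := kerop_int_dot f w ha hy; have i4 := kerop_int_dot f w hx ha.
have alg (x a1 a2 a3 a4 : R) : x * (- a1 - a2 + (a3 + a4)) = (-1) * (x * a1) + (-1) * (x * a2) + x * a3 + x * a4.
  by ring.
transitivity (\int[leb2]_(p in [set: PT]) ((-1) * (f p * kerop (partialx (partialx a)) a w p) +
   (-1) * (f p * kerop a (partialx (partialx a)) w p) + f p * kerop a (fun z => z.1 ^+ 2 * a z) w p +
   f p * kerop (fun z => z.1 * a z) a w p)).
  apply: eq_Rintegral => p _; rewrite /schrodinger E2 E4 mulrDl.
  rewrite (kerop_mul2 (fun t => t ^+ 2) w p ha ha) (kerop_mul1 (fun t => t) w p ha ha).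
  exact: alg.
have j1 := integrableZl measurableT (-1) i1; have j2 := integrableZl measurableT (-1) i2.
have j12 := integrableD measurableT j1 j2; have j123 := integrableD measurableT j12 i3.
rewrite (RintegralD measurableT j123 i4) (RintegralD measurableT j12 i3) (RintegralD measurableT j1 j2).
have alg2 (x y x' y' u t : R) : x = -1 * x' -> y = -1 * y' -> x + y + u + t = - x' - y' + u + t.
  by move=> -> ->; rewrite !mulN1r.
exact (alg2 _ _ _ _ _ _ (RintegralZl (-1) measurableT i1) (RintegralZl (-1) measurableT i2)).
Qed.

Lemma kerform_ypartialx a f w : rtest a ->
  \int[leb2]_p (f p * (2 * p.2 * partialx (kerop a a w) p)) =
  2 * kerform (partialx a) (fun z => z.1 * a z) f w.
Proof.
move=> ta; have ha := cc_rtest ta.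
have ha1 := cc_rtest (rtest_partialx ta).
have hx := cc_coord continuous_idR ha.
rewrite -(RintegralZl _ measurableT (kerop_int_dot f w ha1 hx)).
apply: eq_Rintegral => p _.
have [[_ ->] _] := kerop_partial w p ta ta.
rewrite -(kerop_mul2 (fun t => t) w p ha1 ha).
by move: (f p) (kerop _ _ _ _) => x y; ring.
Qed.

Lemma kerform_comb_ker3 (s t r : R) a a' a'' b f g : cc a -> cc a' -> cc a'' -> cc b ->
  kerform (fun z => s * a z + t * a' z + r * a'' z) b f g =
  s * kerform a b f g + t * kerform a' b f g + r * kerform a'' b f g.
Proof.
move=> ha ha' ha'' hb.
have h : cc (fun z => s * a z + t * a' z).
  by apply: ccD; apply: ccM => //; exact: (@continuous_cst_plane R).
have C1 := kerform_comb_ker1 s t f g ha ha' hb.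
have C2 := kerform_comb_ker1 1 r f g h ha'' hb.
rewrite C1 mul1r in C2; refine (etrans _ C2).
by congr (kerform _ b f g); apply/funext => z; rewrite mul1r.
Qed.

Lemma kerform_comb_ker3' (s t r : R) a b b' b'' f g : cc a -> cc b -> cc b' -> cc b'' ->
  kerform a (fun z => s * b z + t * b' z + r * b'' z) f g =
  s * kerform a b f g + t * kerform a b' f g + r * kerform a b'' f g.
Proof.
move=> ha hb hb' hb''.
have h : cc (fun z => s * b z + t * b' z).
  by apply: ccD; apply: ccM => //; exact: (@continuous_cst_plane R).
have C1 := kerform_comb_ker2 s t f g ha hb hb'.
have C2 := kerform_comb_ker2 1 r f g ha h hb''.
rewrite C1 mul1r in C2; refine (etrans _ C2).
by congr (kerform a _ f g); apply/funext => z; rewrite mul1r.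
Qed.

Section Kap.
Variables (e : R) (e0 : 0 < e).
Local Notation K Psi1 X1 Psi2 X2 := (kerform (kap e Psi1 X1) (kap e Psi2 X2)).

(** Write [t] as half the sum of [t - t'] and [t + t']; each half rescales the argument of one
    profile. The next lemma is the square of this identity. *)
Lemma kap_fst Psi X z :
  z.1 * kap e Psi X z = (e / 2) * kap e (fun t => t * Psi t) X z + (e^-1 / 2) * kap e Psi (fun t => t * X t) z.
Proof.
rewrite /kap /lin; set P := Psi _; set Q := X _.
by field; rewrite gt_eqF.
Qed.

Lemma kap_fst_sqr Psi X z :
  z.1 ^+ 2 * kap e Psi X z = (e ^+ 2 / 4) * kap e (fun t => t * (t * Psi t)) X z
   + 2^-1 * kap e (fun t => t * Psi t) (fun t => t * X t) z
   + (e^-1 ^+ 2 / 4) * kap e Psi (fun t => t * (t * X t)) z.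
Proof.
rewrite /kap /lin; set P := Psi _; set Q := X _.
by field; rewrite gt_eqF.
Qed.

(** In the mixed term the factors [e^-1] and [e] cancel, leaving the coefficient 2; this is the only
    term that will survive the antisymmetrisation. *)
Lemma partialx_kap2 Psi X : smooth1 Psi -> smooth1 X -> cc1 Psi -> cc1 X ->
  partialx (partialx (kap e Psi X)) = (fun z => e^-1 ^+ 2 * kap e (derive1 (derive1 Psi)) X z
    + 2 * kap e (derive1 Psi) (derive1 X) z + e ^+ 2 * kap e Psi (derive1 (derive1 X)) z).
Proof.
move=> sP sX cP cX.
have sP' := smooth1_derive sP; have sX' := smooth1_derive sX.
have cP' := cc1_derive sP cP; have cX' := cc1_derive sX cX.
have t1 := rtest_kap e0 sP' sX cP' cX; have t2 := rtest_kap e0 sP sX' cP cX'.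
rewrite (partialx_kap e sP sX) (partialx_comb e^-1 t1 (rtestZ e t2)).
have -> : partialx (fun z => e * kap e Psi (derive1 X) z) = (fun z => e * partialx (kap e Psi (derive1 X)) z).
  by apply/funext => z; exact: (deriveZ e (rtest_derivable z t2).1).
rewrite (partialx_kap e sP' sX) (partialx_kap e sP sX'); apply/funext => z.
move: (kap _ _ _ z) (kap _ _ _ z) (kap _ _ _ z) => x y u.
by field; rewrite gt_eqF.
Qed.

Lemma tr_kap_even Psi X : (forall t, Psi (- t) = Psi t) -> tr (kap e Psi X) = kap e Psi X.
Proof.
move=> h; apply/funext => z; rewrite tr_kap.
by have -> : (fun t => Psi (- t)) = Psi by apply/funext.
Qed.

Lemma tr_kap_odd Psi X : (forall t, Psi (- t) = - Psi t) ->
  tr (kap e Psi X) = (fun z => -1 * kap e Psi X z + 0 * kap e Psi X z).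
Proof.
move=> h; apply/funext => z; rewrite tr_kap.
have -> : (fun t => Psi (- t)) = (fun t => - Psi t) by apply/funext.
by rewrite /kap mul0r addr0 mulN1r mulNr.
Qed.

Lemma kap_swap_even Psi1 X1 Psi2 X2 f g : cc1 Psi1 -> cc1 X1 -> cc1 Psi2 -> cc1 X2 ->
  (forall t, Psi1 (- t) = Psi1 t) -> (forall t, Psi2 (- t) = Psi2 t) ->
  K Psi1 X1 Psi2 X2 f g = K Psi1 X1 Psi2 X2 g f.
Proof.
move=> h1 h2 h3 h4 e1 e2.
by rewrite (kerform_swap f g (cc_kap e0 h1 h2) (cc_kap e0 h3 h4)) !tr_kap_even.
Qed.

Lemma kap_swap_odd1 Psi1 X1 Psi2 X2 f g : cc1 Psi1 -> cc1 X1 -> cc1 Psi2 -> cc1 X2 ->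
  (forall t, Psi1 (- t) = - Psi1 t) -> (forall t, Psi2 (- t) = Psi2 t) ->
  K Psi1 X1 Psi2 X2 f g = - K Psi1 X1 Psi2 X2 g f.
Proof.
move=> h1 h2 h3 h4 e1 e2.
have ha := cc_kap e0 h1 h2; have hb := cc_kap e0 h3 h4.
rewrite (kerform_swap f g ha hb) (tr_kap_even _ e2) (tr_kap_odd _ e1).
by rewrite (kerform_comb_ker1 (-1) 0 g f ha ha hb) mul0r addr0 mulN1r.
Qed.

Lemma kap_swap_odd2 Psi1 X1 Psi2 X2 f g : cc1 Psi1 -> cc1 X1 -> cc1 Psi2 -> cc1 X2 ->
  (forall t, Psi1 (- t) = Psi1 t) -> (forall t, Psi2 (- t) = - Psi2 t) ->
  K Psi1 X1 Psi2 X2 f g = - K Psi1 X1 Psi2 X2 g f.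
Proof.
move=> h1 h2 h3 h4 e1 e2.
have ha := cc_kap e0 h1 h2; have hb := cc_kap e0 h3 h4.
rewrite (kerform_swap f g ha hb) (tr_kap_even _ e1) (tr_kap_odd _ e2).
by rewrite (kerform_comb_ker2 (-1) 0 g f ha hb hb) mul0r addr0 mulN1r.
Qed.

Section Cutoff.
Variables (F : R -> R) (hF : cutoff F).
Local Notation be := (bump F).
Local Notation be' := (derive1 be).
Local Notation be'' := (derive1 be').
Local Notation F' := (derive1 F).
Local Notation F'' := (derive1 F').
Local Notation a := (kap e be F).
Local Notation t_ P := (fun t : R => t * P t).

Let sb := bump_smooth hF.
Let sF := cutoff_smooth hF.
Let cb := bump_cc1 hF.
Let cF := cutoff_cc1 hF.
Let cb' : cc1 be' := cc1_derive sb cb.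
Let cb'' : cc1 be'' := cc1_derive (smooth1_derive sb) cb'.
Let cF' : cc1 F' := cc1_derive sF cF.
Let cF'' : cc1 F'' := cc1_derive (smooth1_derive sF) cF'.
Let ctb := cc1_idM cb.
Let cttb := cc1_idM ctb.
Let ctF := cc1_idM cF.
Let cttF := cc1_idM ctF.
Let ev := bump_even F.
Let od' := bump_derive_odd hF.
Let ev'' := bump_derive2_even hF.

Lemma odd_tbump t : - t * be (- t) = - (t * be t).
Proof. by rewrite bump_even mulNr. Qed.

Lemma even_ttbump t : - t * (- t * be (- t)) = t * (t * be t).
Proof. by rewrite bump_even !mulrA mulrNN. Qed.

Lemma rtest_a : rtest a.
Proof. exact: rtest_kap. Qed.

(* Exchanging [f] and [g] reflects the first profile of each kernel, so that
   only the terms with one odd profile survive. *)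
Lemma schrodinger_commutator f g :
  \int[leb2]_p (f p * schrodinger (kerop a a g) p) -
  \int[leb2]_p (g p * schrodinger (kerop a a f) p) =
  - 4 * K be' F' be F f g - 4 * K be F be' F' f g + K be F (t_ be) (t_ F) f g
  + e * K (t_ be) F be F f g.
Proof.
rewrite !(kerform_schrodinger _ _ rtest_a) (partialx_kap2 sb sF cb cF).
have -> : (fun z => z.1 * a z) =
    (fun z => (e / 2) * kap e (t_ be) F z + (e^-1 / 2) * kap e be (t_ F) z).
  by apply/funext => z; exact: kap_fst.
have -> : (fun z => z.1 ^+ 2 * a z) =
    (fun z => (e ^+ 2 / 4) * kap e (fun t => t * (t * be t)) F z
   + 2^-1 * kap e (t_ be) (t_ F) z
   + (e^-1 ^+ 2 / 4) * kap e be (fun t => t * (t * F t)) z).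
  by apply/funext => z; exact: kap_fst_sqr.
have k0 := cc_kap e0 cb cF.
have k1 := cc_kap e0 cb'' cF; have k2 := cc_kap e0 cb' cF'; have k3 := cc_kap e0 cb cF''.
have k4 := cc_kap e0 cttb cF; have k5 := cc_kap e0 ctb ctF; have k6 := cc_kap e0 cb cttF.
have k7 := cc_kap e0 ctb cF; have k8 := cc_kap e0 cb ctF.
rewrite !(kerform_comb_ker3 _ _ _ _ _ k1 k2 k3 k0) !(kerform_comb_ker3' _ _ _ _ _ k0 k1 k2 k3).
rewrite !(kerform_comb_ker3' _ _ _ _ _ k0 k4 k5 k6) !(kerform_comb_ker1 _ _ _ _ k7 k8 k0).
(* The symmetric forms cancel exactly, among them all those whose coefficients diverge like [e^-1]
   or [e^-1 ^+ 2]. *)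
rewrite (kap_swap_even g f cb'' cF cb cF ev'' ev) (kap_swap_even g f cb cF'' cb cF ev ev).
rewrite (kap_swap_even g f cb cF cb'' cF ev ev'') (kap_swap_even g f cb cF cb cF'' ev ev).
rewrite (kap_swap_even g f cb cF cttb cF ev even_ttbump) (kap_swap_even g f cb cF cb cttF ev ev).
rewrite (kap_swap_even g f cb ctF cb cF ev ev).
(* The antisymmetric forms double instead: the coefficients [-2], [1 / 2] and [e / 2] become [-4],
   [1] and [e]. *)
rewrite (kap_swap_odd1 g f cb' cF' cb cF od' ev) (kap_swap_odd2 g f cb cF cb' cF' ev od').
rewrite (kap_swap_odd2 g f cb cF ctb ctF ev odd_tbump) (kap_swap_odd1 g f ctb cF cb cF odd_tbump ev).
do 11! move: (kerform _ _ _ _) => ?.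
by field; rewrite gt_eqF.
Qed.

(** A form with exactly one odd profile is antisymmetric and vanishes on the diagonal. This removes
    the term of order [e^-2], and in the two remaining terms the powers of [e] cancel. *)
Lemma ypartialx_diagonal f :
  \int[leb2]_p (f p * (2 * p.2 * partialx (kerop a a f) p)) =
  K be' F (t_ be) F f f + K be F' be (t_ F) f f.
Proof.
rewrite (kerform_ypartialx _ _ rtest_a) (partialx_kap e sb sF).
have -> : (fun z => z.1 * a z) =
    (fun z => (e / 2) * kap e (t_ be) F z + (e^-1 / 2) * kap e be (t_ F) z).
  by apply/funext => z; exact: kap_fst.
have k1 := cc_kap e0 cb' cF; have k2 := cc_kap e0 cb cF'.
have k7 := cc_kap e0 ctb cF; have k8 := cc_kap e0 cb ctF.
have k78 : cc (fun z => (e / 2) * kap e (t_ be) F z + (e^-1 / 2) * kap e be (t_ F) z).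
  by apply: ccD; apply: ccM => //; exact: (@continuous_cst_plane R).
rewrite (kerform_comb_ker1 _ _ _ _ k1 k2 k78) !(kerform_comb_ker2 _ _ _ _ _ k7 k8)//.
have z1 : K be' F be (t_ F) f f = 0.
  by have := kap_swap_odd1 f f cb' cF cb ctF od' ev; move: (kerform _ _ _ _) => x h; lra.
have z2 : K be F' (t_ be) F f f = 0.
  by have := kap_swap_odd2 f f cb cF' ctb cF ev odd_tbump; move: (kerform _ _ _ _) => x h; lra.
rewrite z1 z2; do 2! move: (kerform _ _ _ _) => ?.
by field; rewrite gt_eqF.
Qed.

(** The test function is [i] times the smoothed [w]. With this factor the real part of the pairing
    with [H0] becomes a commutator, the term in [l] vanishes by symmetry of the kernel, and the term
    in [v] becomes the smoothed squared norm. *)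
Lemma deficiency_identity (w : E) (l v : R) :
  (forall phi, test2 phi -> dot2 w (h0 phi - l *: phi - v *: rot phi) = 0) ->
  - 4 * K be' F' be F w.2 w.1 - 4 * K be F be' F' w.2 w.1 + K be F (t_ be) (t_ F) w.2 w.1
  + e * K (t_ be) F be F w.2 w.1
  + (K be' F (t_ be) F w.1 w.1 + K be F' be (t_ F) w.1 w.1)
  + (K be' F (t_ be) F w.2 w.2 + K be F' be (t_ F) w.2 w.2)
  + v * (K be F be F w.1 w.1 + K be F be F w.2 w.2) = 0.
Proof.
move=> hw.
have ta := rtest_a; have ka := cc_rtest ta.
have cO g := cc_kerop g ka ka.
pose o : E := (toL (kerop a a w.1), toL (kerop a a w.2)).
have o1 : o.1 = kerop a a w.1 :> (PT -> R) := toLE (cO _).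
have o2 : o.2 = kerop a a w.2 :> (PT -> R) := toLE (cO _).
have to : test2 o by split; rewrite ?o1 ?o2; exact: rtest_kerop.
have := hw _ (test2_rot to).
rewrite (h0_rot to) rotrot.
have D f g : dot f (toL (kerop a a g)) = K be F be F f g.
  by rewrite /dot; apply: eq_Rintegral => p _; rewrite (toLE (cO g)).
have ccS g : cc (schrodinger (kerop a a g)) := cc_schrodinger (rtest_kerop g ta ta).
have ccY g : cc (fun p => 2 * p.2 * partialx (kerop a a g) p) := cc_ypartialx (rtest_kerop g ta ta).
have i f (u : R * R -> R) : cc u -> leb2.-integrable setT (EFin \o (fun p : PT => f p * u p)).
  move=> [c s]; apply/Lfun1_integrable; apply: (Lfun2_mul_Lfun1 (LfunP f)); exact: cc_L2 c s.
have H1 f : dot f (h0 o).1 = \int[leb2]_p (f p * schrodinger (kerop a a w.1) p) +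
    \int[leb2]_p (f p * (2 * p.2 * partialx (kerop a a w.2) p)).
  rewrite -(RintegralD measurableT (i f _ (ccS w.1)) (i f _ (ccY w.2))) /dot.
  by apply: eq_Rintegral => p _; rewrite (h01E to) o1 o2 /h0re mulrDr.
have H2 f : dot f (h0 o).2 = \int[leb2]_p (f p * schrodinger (kerop a a w.2) p) -
    \int[leb2]_p (f p * (2 * p.2 * partialx (kerop a a w.1) p)).
  rewrite -(RintegralB measurableT (i f _ (ccS w.2)) (i f _ (ccY w.1))) /dot.
  by apply: eq_Rintegral => p _; rewrite (h02E to) o1 o2 /h0im mulrBr.
have dN (f g : L) : dot f (- g) = - dot f g by rewrite dotC dot_Nl dotC.
have B (u u' : E) c : dot2 w (u - c *: u') = dot2 w u - c * dot2 w u'.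
  by rewrite dot2C dot2Dl -scaleNr dot2Zl mulNr !(dot2C _ w).
rewrite !B.
have -> : dot2 w (rot (h0 o)) = - dot w.1 (h0 o).2 + dot w.2 (h0 o).1.
  by rewrite /dot2 /rot /= dN.
have -> : dot2 w (rot o) = - K be F be F w.1 w.2 + K be F be F w.2 w.1.
  by rewrite /dot2 /rot /= dN !D.
have -> : dot2 w (- o) = - (K be F be F w.1 w.1 + K be F be F w.2 w.2).
  by rewrite /dot2 /= !dN !D opprD.
have H1' := etrans (H1 w.2) (congr1 (fun t => _ + t) (ypartialx_diagonal w.2)).
have H2' := etrans (H2 w.1) (congr1 (fun t => _ - t) (ypartialx_diagonal w.1)).
rewrite H1' H2'.
have C := schrodinger_commutator w.2 w.1.
rewrite (kap_swap_even w.1 w.2 cb cF cb cF ev ev) => hyp.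
rewrite -C -[RHS]hyp.
move: (Rintegral _ _ _) (Rintegral _ _ _) => S1 S2.
do 7! move: (kerform _ _ _ _) => ?.
by ring.
Qed.

End Cutoff.

End Kap.

(** Divide the identity by [e ^+ 2] and let [e] tend to 0. Two terms vanish as integrals of a
    derivative ([L5], [L7]), one by its factor [e] ([L4]), and the others because [F'] or [t F] is 0
    at 0. Only the mass of [bump F] times [v |w|^2] remains. *)
Theorem deficiency_zero (F : R -> R) (w : E) (l v : R) : cutoff F ->
  cc_closure w.1 -> cc_closure w.2 -> v != 0 ->
  (forall phi, test2 phi -> dot2 w (h0 phi - l *: phi - v *: rot phi) = 0) ->
  dot2 w w = 0.
Proof.
move=> hF c1 c2 v0 hw.
have sb := bump_smooth hF; have sF := cutoff_smooth hF.
have cb := bump_cc1 hF; have cF := cutoff_cc1 hF.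
have cb' := cc1_derive sb cb; have cF' := cc1_derive sF cF.
have ctb := cc1_idM cb; have ctF := cc1_idM cF.
have F0 := cutoff0 hF; have F'0 := cutoff_derive0 hF.
have cM (u z : nat -> R) (x y : R) : u n @[n --> \oo] --> x -> z n @[n --> \oo] --> y ->
  u n * z n @[n --> \oo] --> x * y by exact: cvgM.
have cD (u z : nat -> R) (x y : R) : u n @[n --> \oo] --> x -> z n @[n --> \oo] --> y ->
  u n + z n @[n --> \oo] --> x + y by exact: cvgD.
have L1 := kerform_limit cb' cF' cb cF c2 c1.
have L2 := kerform_limit cb cF cb' cF' c2 c1.
have L3 := kerform_limit cb cF ctb ctF c2 c1.
have L4 := cM _ _ _ _ eps_cvg0 (kerform_limit ctb cF cb cF c2 c1).
have L5 := kerform_limit cb' cF ctb cF c1 c1.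
have L6 := kerform_limit cb cF' cb ctF c1 c1.
have L7 := kerform_limit cb' cF ctb cF c2 c2.
have L8 := kerform_limit cb cF' cb ctF c2 c2.
have L9 := kerform_limit cb cF cb cF c1 c1.
have L10 := kerform_limit cb cF cb cF c2 c2.
rewrite (tensor_mass_derive sb cb ctb) in L5 L7.
rewrite F0 F'0 ?(mul0r, mulr0) in L1 L2 L3 L4 L5 L6 L7 L8 L9 L10.
rewrite !mul1r in L9 L10.
set m := tensor_mass _ _ in L9 L10.
have m0 : 0 < m := bump_mass hF.
have cc (c : R) : c @[_ --> \oo] --> c by exact: cvg_cst.
have Lim := cD _ _ _ _ (cD _ _ _ _ (cD _ _ _ _ (cD _ _ _ _ (cD _ _ _ _ (cD _ _ _ _
  (cM _ _ _ _ (cc (-4)) L1) (cM _ _ _ _ (cc (-4)) L2)) L3) L4)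
  (cD _ _ _ _ L5 L6)) (cD _ _ _ _ L7 L8)) (cM _ _ _ _ (cc v) (cD _ _ _ _ L9 L10)).
have Z : (fun _ : nat => 0 : R) @ \oo --> 0 + v * (m * dot2 w w).
  have -> : (0 + v * (m * dot2 w w) : R) = -4 * 0 + -4 * 0 + 0 + 0 + (0 + 0) + (0 + 0) + v * (m * dot w.1 w.1 + m * dot w.2 w.2).
    by rewrite /dot2 mulrDr; ring.
  apply: cvg_trans Lim; apply: near_eq_cvg; near=> n => /=.
  have := @deficiency_identity (eps n) (eps_gt0 n) F hF w l v hw.
  move/(congr1 ( *%R (eps n ^+ 2)^-1)); rewrite mulr0 => hyp.
  rewrite -[RHS]hyp.
  move: (eps n) (eps n ^+2)^-1 => e r.
  do 10! move: (kerform _ _ _ _) => ?.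
  by ring.
have U : (0 : R) = 0 + v * (m * dot2 w w).
  have c0 : (fun _ : nat => 0 : R) @ \oo --> (0 : R) by exact: cvg_cst.
  have hd : hausdorff_space R by exact: Rhausdorff.
  exact (etrans (esym (cvg_lim hd c0)) (cvg_lim hd Z)).
move/esym/eqP: U; rewrite add0r mulf_eq0 (negPf v0) mulf_eq0 (gt_eqF m0) /=.
by move/eqP.
Unshelve. all: by end_near.
Qed.

End Deficiency.

Local Notation dC := (@dot2C _ _ _ _).
Local Notation dDl := (@dot2Dl _ _ _ _).
Local Notation dZl := (@dot2Zl _ _ _ _).
Local Notation dge := (@dot2_ge0 _ _ _ _).

(** * The closed free Hamiltonian and solvability off the real axis *)

Section Graph.
Context {R : realType}.
Local Notation L := (Lsp (@leb2 R)).
Local Notation E := (L * L)%type.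
Implicit Types (u w g v : E) (f : L).

Definition h0_graph u g := exists phi : nat -> E,
  [/\ forall n, test2 (phi n), form_cvg (@dot2 _ _ _ _) phi u &
      form_cvg (@dot2 _ _ _ _) (fun n => h0 (phi n)) g].

Lemma form_cvg_rot (un : nat -> E) u :
  form_cvg (@dot2 _ _ _ _) un u -> form_cvg (@dot2 _ _ _ _) (fun n => rot (un n)) (rot u).
Proof.
rewrite /form_cvg => h.
have -> : (fun n => dot2 (rot (un n) - rot u) (rot (un n) - rot u)) =
    (fun n => dot2 (un n - u) (un n - u)); last exact: h.
apply/funext => n.
have -> : rot (un n) - rot u = rot (un n - u).
  by rewrite -[- u]scaleN1r rotD rotZ scaleN1r.
by rewrite dot2_rotrot.
Qed.

Lemma h0_graphZ a u g : h0_graph u g -> h0_graph (a *: u) (a *: g).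
Proof.
move=> [phi [tp up gp]]; exists (fun n => a *: phi n); split.
- by move=> n; exact: test2Z.
- exact: (form_cvgZ dC dZl a up).
- have -> : (fun n => h0 (a *: phi n)) = (fun n => a *: h0 (phi n)).
    by apply/funext => n; exact: h0Z.
  exact: (form_cvgZ dC dZl a gp).
Qed.

Lemma h0_graph_rot u g : h0_graph u g -> h0_graph (rot u) (rot g).
Proof.
move=> [phi [tp up gp]]; exists (fun n => rot (phi n)); split.
- by move=> n; exact: test2_rot.
- exact: form_cvg_rot.
- have -> : (fun n => h0 (rot (phi n))) = (fun n => rot (h0 (phi n))).
    by apply/funext => n; exact: h0_rot.
  exact: form_cvg_rot.
Qed.

Lemma h0_graph_shift u g k : h0_graph u g -> dot2 k k = 0 -> h0_graph u (g + k).
Proof.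
move=> [phi [tp up gp]] k0; exists phi; split=> //.
exact: (form_cvg_shift dC dDl dZl dge gp k0).
Qed.

Lemma seq_cvg_unique (x : nat -> R) (s t : R) :
  x @ \oo --> s -> x @ \oo --> t -> s = t.
Proof.
move=> hs ht; have hd : hausdorff_space R by exact: Rhausdorff.
exact (etrans (esym (cvg_lim hd hs)) (cvg_lim hd ht)).
Qed.

Lemma h0_graph_sym u g w k : h0_graph u g -> h0_graph w k -> dot2 g w = dot2 u k.
Proof.
move=> [phi [tp up gp]] [psi [tq uq gq]].
have A := form_cvg_dot dC dDl dZl dge gp uq.
have B := form_cvg_dot dC dDl dZl dge up gq.
apply: (seq_cvg_unique A).
have -> : (fun n => dot2 (h0 (phi n)) (psi n)) = (fun n => dot2 (phi n) (h0 (psi n))); last exact: B.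
by apply/funext => n; exact: h0_sym.
Qed.

(** The quadratic form of a symmetric operator has no imaginary part. *)
Lemma h0_graph_rot_self u g : h0_graph u g -> dot2 g (rot u) = 0.
Proof.
move=> h; have S := h0_graph_sym h (h0_graph_rot h).
have r := dot2_rot u g.
by rewrite (dot2C g) in S *; lra.
Qed.

Definition h0_minus (l n : R) u : E := h0 u - l *: u - n *: rot u.

Lemma h0_minusD l n u w : test2 u -> test2 w -> h0_minus l n (u + w) = h0_minus l n u + h0_minus l n w.
Proof.
move=> tu tw; rewrite /h0_minus (h0D tu tw) rotD !scalerDr !opprD.
by rewrite (addrACA (h0 u)) (addrACA (h0 u - _)).
Qed.

Lemma h0_minusZ l n a u : test2 u -> h0_minus l n (a *: u) = a *: h0_minus l n u.
Proof.
move=> tu; rewrite /h0_minus h0Z// rotZ !scalerBr !scalerA (mulrC l) (mulrC n).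
by [].
Qed.

(** The cross term is the imaginary part of the quadratic form of [h0 - l], hence 0. The identity
    provides the coercivity constant [(n ^+ 2)^-1] for least squares. *)
Lemma h0_minus_norm l n u : test2 u ->
  dot2 (h0_minus l n u) (h0_minus l n u) = dot2 (h0 u - l *: u) (h0 u - l *: u) + n ^+ 2 * dot2 u u.
Proof.
move=> tu.
have cross : dot2 (h0 u - l *: u) (rot u) = 0.
  have h : dot2 (h0 u) (rot u) = 0.
    have S := h0_sym tu (test2_rot tu); rewrite (h0_rot tu) in S.
    have r := dot2_rot u (h0 u).
    by rewrite (dot2C (h0 u)) in S *; lra.
  by rewrite dot2Dl -scaleNr dot2Zl h (dot2C u) dot2_rot_self mulr0 addr0.
have alg (A B : E) (c : R) : dot2 A B = 0 ->
    dot2 (A - c *: B) (A - c *: B) = dot2 A A + c ^+ 2 * dot2 B B.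
  move=> AB; rewrite -scaleNr dot2Dl !(formDr dC dDl) !dot2Zl !(formZr dC dZl) (dot2C B A) AB.
  by ring.
by rewrite (alg _ _ _ cross) dot2_rotrot.
Qed.

Lemma cc_h0_minus l n u : test2 u ->
  cc ((h0_minus l n u).1 : R * R -> R) /\ cc ((h0_minus l n u).2 : R * R -> R).
Proof.
move=> tu; have [t1 t2] := tu; have c1 := cc_rtest t1; have c2 := cc_rtest t2.
have cZ (a : R) (f : L) : cc (f : R * R -> R) -> cc (fun p => a * f p).
  by apply: ccM; exact: (@continuous_cst_plane R).
split.
  have -> : ((h0_minus l n u).1 : R * R -> R) = (fun p => h0re u.1 u.2 p + - (l * u.1 p) + - (n * - u.2 p)).
    by apply/funext => p; rewrite -(h01E tu).
  apply: ccD; first apply: ccD; [exact: cc_h0re|exact/ccN/cZ|apply/ccN].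
  have -> : (fun p => n * - u.2 p) = (fun p => - n * u.2 p) by apply/funext => p; rewrite mulrN mulNr.
  exact: cZ.
have -> : ((h0_minus l n u).2 : R * R -> R) = (fun p => h0im u.1 u.2 p + - (l * u.2 p) + - (n * u.1 p)).
  by apply/funext => p; rewrite -(h02E tu).
by apply: ccD; first apply: ccD; [exact: cc_h0im|exact/ccN/cZ|exact/ccN/cZ].
Qed.

Lemma cc_closure_sub (f k : L) (psi : nat -> L) : cc_closure f ->
  (forall n, cc (psi n : R * R -> R)) -> form_cvg (@dot _ _ _ _) psi k -> cc_closure (f - k).
Proof.
move=> [phi [cphi lphi]] cpsi lpsi; exists (fun n => phi n + (-1) *: psi n); split.
  move=> n; apply: (@ccD _ (phi n : R * R -> R) (fun p => -1 * psi n p)) => //.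
  by apply: ccM => //; exact: (@continuous_cst_plane R).
rewrite -[- k]scaleN1r.
exact: (form_cvgD (@dotC _ _ _ _) (@dotDl _ _ _ _) (@dotZl _ _ _ _) (@dot_ge0 _ _ _ _) lphi
  (form_cvgZ (@dotC _ _ _ _) (@dotZl _ _ _ _) (-1) lpsi)).
Qed.

Theorem resolvent_solution (F : R -> R) (l n : R) : cutoff F -> n != 0 ->
  forall f : E, cc_closure f.1 -> cc_closure f.2 ->
  exists v, h0_graph v (f + l *: v + n *: rot v).
Proof.
move=> hF n0 k k1 k2.
pose S : set E := [set u | test2 u].
pose K : set E := [set u | cc_closure u.1 /\ cc_closure u.2].
have [v [phi [tp vp kp]]] : exists v phi,
  [/\ forall i, S (phi i), form_cvg (@dot2 _ _ _ _) phi v &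
      form_cvg (@dot2 _ _ _ _) (fun i => h0_minus l n (phi i)) k].
  apply: (@least_squares_solution R E (@dot2 _ _ _ _) dC dDl dZl dge (@dot2_complete _ _ _ _)
    S (h0_minus l n) (n ^+ 2)^-1 K).
  - exact: test2_0.
  - by move=> u w; exact: test2D.
  - by move=> a u; exact: test2Z.
  - by move=> u w; exact: h0_minusD.
  - by move=> a u; exact: h0_minusZ.
  - move=> u tu; rewrite (h0_minus_norm _ _ tu).
    have n2 : 0 < n ^+ 2 by rewrite exprn_even_gt0.
    by rewrite ler_pdivlMl// lerDr dge.
  - move=> f' g' psi [f1 f2] tpsi /form_cvg_dot2P[g1 g2]; split.
    + exact: (cc_closure_sub f1 (fun i => (cc_h0_minus l n (tpsi i)).1) g1).
    + exact: (cc_closure_sub f2 (fun i => (cc_h0_minus l n (tpsi i)).2) g2).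
  - move=> w [w1 w2] hw; exact: (deficiency_zero hF w1 w2 n0 hw).
  - by split.
exists v, phi; split=> //.
have -> : (fun i => h0 (phi i)) = (fun i => h0_minus l n (phi i) + l *: phi i + n *: rot (phi i)).
  by apply/funext => i; rewrite /h0_minus addrAC !subrK.
apply: (form_cvgD dC dDl dZl dge); first apply: (form_cvgD dC dDl dZl dge) => //.
  exact: (form_cvgZ dC dZl l vp).
exact: (form_cvgZ dC dZl n (form_cvg_rot vp)).
Qed.

End Graph.

(** * The free Hamiltonian has no eigenvalues *)

Section Translation.
Context {R : realType}.
Local Notation PT := (measurableTypeR R * measurableTypeR R)%type.
Local Notation L := (Lsp (@leb2 R)).
Local Notation E := (L * L)%type.
Implicit Types (u w g v : E) (f h : L) (x : R).

Definition tx x (p : PT) : PT := ((x, 0) : R * R) + p.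
Definition shiftL x f : L := toLsp (@leb2 R) (f \o tx x).
Definition shift2 x u : E := (shiftL x u.1, shiftL x u.2).

Lemma txE x : tx x = affine (x, 0) 1.
Proof. by apply/funext => p; rewrite /affine !mul1r. Qed.

Lemma shiftLE x f : shiftL x f = f \o tx x :> (PT -> R).
Proof.
apply: toLspE; apply/Lfun2P; have /Lfun2P[mf jf] := LfunP f; rewrite txE; split.
  exact: (measurableT_comp mf (measurable_affine _ _)).
exact: (integrable_affine (x, 0) (oner_neq0 R) jf).
Qed.

Lemma dot_shift x f h : dot (shiftL x f) (shiftL x h) = dot f h.
Proof.
rewrite {2}/dot (Rintegral_affine (x, 0) (oner_neq0 R) (dot_int f h)) expr1n mul1r.
by apply: eq_Rintegral => p _; rewrite !shiftLE txE.
Qed.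

Lemma dot2_shift x u w : dot2 (shift2 x u) (shift2 x w) = dot2 u w.
Proof. by rewrite /dot2 !dot_shift. Qed.

Lemma shiftL_comb x (a : R) f h : shiftL x (a *: f + h) = a *: shiftL x f + shiftL x h.
Proof.
apply/LfuneqP => p.
have -> : (a *: shiftL x f + shiftL x h) p = a * shiftL x f p + shiftL x h p by [].
by rewrite !shiftLE.
Qed.

Lemma shift2_comb x (a : R) u w : shift2 x (a *: u + w) = a *: shift2 x u + shift2 x w.
Proof. by rewrite /shift2 /= !shiftL_comb. Qed.

Lemma shift2B x u w : shift2 x (u - w) = shift2 x u - shift2 x w.
Proof. by have := shift2_comb x (-1) w u; rewrite !scaleN1r !(addrC (- _)). Qed.

Lemma test2_shift x u : test2 u -> test2 (shift2 x u).
Proof.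
move=> [u1 u2]; have E1 := shiftLE x u.1; have E2 := shiftLE x u.2.
split.
  rewrite /shift2 /= E1; exact: (rtest_shift _ u1).
rewrite /shift2 /= E2; exact: (rtest_shift _ u2).
Qed.

Lemma partialx_shift (f : R * R -> R) x :
  partialx (fun p => f ((x, 0) + p)) = (fun p => partialx f ((x, 0) + p)).
Proof. by apply/funext => p; exact: (derive_affine f (x, 0) (1, 0) p).1. Qed.

Lemma partialy_shift (f : R * R -> R) x :
  partialy (fun p => f ((x, 0) + p)) = (fun p => partialy f ((x, 0) + p)).
Proof. by apply/funext => p; exact: (derive_affine f (x, 0) (0, 1) p).1. Qed.

(** The potential is linear in the translated coordinate, so a translation changes it by a
    constant. *)
Lemma schrodinger_shift (f : R * R -> R) x p :
  schrodinger (fun p => f ((x, 0) + p)) p = schrodinger f ((x, 0) + p) - x * f ((x, 0) + p).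
Proof.
rewrite /schrodinger !partialx_shift !partialy_shift.
by move: (partialx _ _) (partialy _ _) (f _) => s t r /=; ring.
Qed.

Lemma h0_shift x u : test2 u -> h0 (shift2 x u) = shift2 x (h0 u) - x *: shift2 x u.
Proof.
move=> tu; have ts := test2_shift x tu.
have E1 := shiftLE x u.1; have E2 := shiftLE x u.2.
apply/pair_equal_spec; split; apply/LfuneqP => p.
  rewrite [LHS](congr1 (@^~ p) (h01E ts)).
  have -> : (shift2 x (h0 u) - x *: shift2 x u).1 p = shiftL x (h0 u).1 p - x * shiftL x u.1 p by [].
  rewrite /shift2 /= E1 E2 shiftLE /= (h01E tu) /h0re.
  rewrite [schrodinger _ _](schrodinger_shift u.1 x p) [partialx _](partialx_shift u.2 x) /tx/=.
  by move: (schrodinger _ _) (partialx _ _) (u.1 _) => s t r; ring.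
rewrite [LHS](congr1 (@^~ p) (h02E ts)).
have -> : (shift2 x (h0 u) - x *: shift2 x u).2 p = shiftL x (h0 u).2 p - x * shiftL x u.2 p by [].
rewrite /shift2 /= E1 E2 shiftLE /= (h02E tu) /h0im.
rewrite [schrodinger _ _](schrodinger_shift u.2 x p) [partialx _](partialx_shift u.1 x) /tx/=.
by move: (schrodinger _ _) (partialx _ _) (u.2 _) => s t r; ring.
Qed.

Lemma form_cvg_shift2 x (un : nat -> E) u : form_cvg (@dot2 _ _ _ _) un u ->
  form_cvg (@dot2 _ _ _ _) (fun n => shift2 x (un n)) (shift2 x u).
Proof.
rewrite /form_cvg => h.
have -> : (fun n => dot2 (shift2 x (un n) - shift2 x u) (shift2 x (un n) - shift2 x u)) =
    (fun n => dot2 (un n - u) (un n - u)); last exact: h.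
by apply/funext => n; rewrite -shift2B dot2_shift.
Qed.

Lemma h0_graph_translate x u g : h0_graph u g -> h0_graph (shift2 x u) (shift2 x g - x *: shift2 x u).
Proof.
move=> [phi [tp up gp]]; exists (fun n => shift2 x (phi n)); split.
- by move=> n; exact: test2_shift.
- exact: form_cvg_shift2.
- have -> : (fun n => h0 (shift2 x (phi n))) = (fun n => shift2 x (h0 (phi n)) + - x *: shift2 x (phi n)).
    by apply/funext => n; rewrite (h0_shift x (tp n)) scaleNr.
  rewrite -scaleNr; apply: (form_cvgD dC dDl dZl dge); first exact: form_cvg_shift2.
  exact: (form_cvgZ dC dZl (- x) (form_cvg_shift2 x up)).
Qed.

Lemma eigenfunction_shift_orthogonal (l x : R) u : h0_graph u (l *: u) -> x != 0 ->
  dot2 (shift2 x u) u = 0.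
Proof.
move=> hu x0; have S := h0_graph_sym (h0_graph_translate x hu) hu.
have e : shift2 x (l *: u) = l *: shift2 x u.
  have z : shift2 x 0 = 0 by have := shift2B x 0 0; rewrite !subrr.
  by rewrite -[in LHS](addr0 (l *: u)) shift2_comb z addr0.
move: S; rewrite e dot2Dl -scaleNr !dot2Zl (formZr dC dZl) => S.
have : x * dot2 (shift2 x u) u = 0 by move: S; move: (dot2 _ _) => t; lra.
by move/eqP; rewrite mulf_eq0 (negPf x0) => /eqP.
Qed.

(** Weak continuity of translations is proved only for continuous functions of bounded support,
    where dominated convergence is immediate; [h0_no_eigenvalue] uses it only for the approximating
    test functions. *)
Lemma shift_continuous f h : cc (f : R * R -> R) -> cc (h : R * R -> R) ->
  dot (shiftL (eps n) f) h @[n --> \oo] --> dot f h.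
Proof.
move=> cf ch; have [B hB] := cc_bounded cf.1 cf.2.
have ih : leb2.-integrable setT (EFin \o (fun p : PT => B * `|h p|)).
  exact: (integrableZl measurableT B (integrable_abse (cc_int ch))).
have E n : dot (shiftL (eps n) f) h = fine (\int[leb2]_p (f (tx (eps n) p) * h p)%:E)%E.
  by congr fine; apply: eq_integral => p _; rewrite shiftLE.
rewrite (_ : (fun n => _) = (fun n => fine (\int[leb2]_p (f (tx (eps n) p) * h p)%:E)%E)); last first.
  exact/funext.
apply: fine_cvg; rewrite dotE.
apply: (@dominated_cvg _ _ _ leb2 setT measurableT
  (fun n (p : PT) => (f (tx (eps n) p) * h p)%:E) _ (EFin \o (fun p : PT => B * `|h p|))) => //.
- move=> n; apply/measurable_EFinP; apply: measurable_funM; last exact: measurable_Lsp.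
  by rewrite txE; exact: (measurableT_comp (measurable_Lsp f) (measurable_affine _ _)).
- move=> p _; apply: cvg_EFin; first exact: nearW.
  apply: cvgM; last exact: cvg_cst.
  (* The translation by [eps n] is an affine map of scale [- eps n] evaluated at [(-1, 0)], so the
     earlier limit applies. *)
  have c := @affine_eps_cvg R p (-1, 0).
  have z : (fun n => affine p (- eps n) (-1, 0) : R * R) = (fun n => tx (eps n) p).
    by apply/funext => n; rewrite /tx /affine; congr pair; rewrite /=; ring.
  rewrite z in c.
  by have := cvg_comp _ _ c (cf.1 p).
- by move=> n p _ /=; rewrite lee_fin normrM ler_wpM2r.
Qed.

(** Expand [phi m] around [u]: since the translates of [u] are orthogonal to [u], the pairing of a
    translate of [phi m] with [phi m] is small with [phi m - u], uniformly in the translation.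
    Shrinking the translation bounds [|phi m|^2] itself, and then [m] tends to infinity. *)
Theorem h0_no_eigenvalue (l : R) u : h0_graph u (l *: u) -> dot2 u u = 0.
Proof.
move=> hu; have [phi [tp up gp]] := hu.
have bound m : dot2 (phi m) (phi m) <= Num.sqrt (dot2 (phi m - u) (phi m - u)) *
    (Num.sqrt (dot2 (phi m) (phi m)) + Num.sqrt (dot2 u u)).
  have c : dot2 (shift2 (eps n) (phi m)) (phi m) @[n --> \oo] --> dot2 (phi m) (phi m).
    have [t1 t2] := tp m.
    by apply: cvgD; apply: shift_continuous; exact: cc_rtest.
  set b := (X in _ <= X).
  have cb : (fun _ : nat => b) @ \oo --> b by exact: cvg_cst.
  apply: (ler_cvg_to c cb); apply: nearW => n.
  have o : dot2 (shift2 (eps n) u) u = 0.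
    by apply: (eigenfunction_shift_orthogonal hu); rewrite gt_eqF// eps_gt0.
  set s := shift2 (eps n) in o *.
  have -> : dot2 (s (phi m)) (phi m) = dot2 (s (phi m - u)) (phi m) + dot2 (s u) (phi m - u).
    by rewrite /s shift2B (formBl dDl dZl) (formBr dC dDl dZl) o subr0 subrK.
  have b1 := form_le_sqrt dC dDl dZl dge (s (phi m - u)) (phi m).
  have b2 := form_le_sqrt dC dDl dZl dge (s u) (phi m - u).
  rewrite !dot2_shift in b1 b2.
  have h1 := le_trans (ler_norm _) b1; have h2 := le_trans (ler_norm _) b2.
  apply: le_trans (lerD h1 h2) _; rewrite /b.
  have alg (r1 r2 r3 : R) : r1 * r2 + r3 * r1 <= r1 * (r2 + r3) by rewrite mulrDr (mulrC r3).
  exact: alg.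
have C1 := form_cvg_dot dC dDl dZl dge up up.
have sq (x : nat -> R) (y : R) : x n @[n --> \oo] --> y -> Num.sqrt (x n) @[n --> \oo] --> Num.sqrt y.
  by move=> h; have := cvg_comp _ _ h (@sqrt_continuous _ y).
have C2 : Num.sqrt (dot2 (phi n - u) (phi n - u)) *
    (Num.sqrt (dot2 (phi n) (phi n)) + Num.sqrt (dot2 u u)) @[n --> \oo] --> (0 : R).
  rewrite -(mul0r (Num.sqrt (dot2 u u) + Num.sqrt (dot2 u u))) -{1}sqrtr0.
  apply: cvgM; first exact: sq up.
  by apply: cvgD; [exact: sq C1|exact: cvg_cst].
apply/eqP; rewrite eq_le dge andbT.
by apply: (ler_cvg_to C1 C2); apply: nearW => n; exact: bound.
Qed.

End Translation.

(** * Bounded perturbations controlled by a weight *)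

Section Multiplier.
Context {R : realType}.
Local Notation PT := (measurableTypeR R * measurableTypeR R)%type.
Local Notation L := (Lsp (@leb2 R)).
Local Notation E := (L * L)%type.
Implicit Types (c : PT -> R) (f g h : L) (u v : E).

Definition multiplier c := measurable_fun setT c /\ exists B : R, forall p, `|c p| <= B.
Definition mulL c f : L := toLsp (@leb2 R) (fun p => c p * f p).
Definition mul2 c u : E := (mulL c u.1, mulL c u.2).

Lemma mulLE c f : multiplier c -> mulL c f = (fun p => c p * f p) :> (PT -> R).
Proof.
move=> [mc [B hB]]; apply: toLspE; apply/Lfun2P.
have /Lfun2P[mf jf] := LfunP f; split; first exact: measurable_funM.
have i := integrableZl measurableT (B ^+ 2) jf.
apply: le_integrable i => //.
  by apply/measurable_EFinP; apply: measurable_funX; exact: measurable_funM.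
move=> p _ /=; rewrite lee_fin exprMn normrM [leRHS]normrM; apply: ler_wpM2r => //.
rewrite (normrX 2 (c p)) (normrX 2 B) lerXn2r ?nnegrE//.
exact: le_trans (hB p) (ler_norm B).
Qed.

Lemma dot_mulL_le c (B : R) f : multiplier c -> (forall p, `|c p| <= B) ->
  dot (mulL c f) (mulL c f) <= B ^+ 2 * dot f f.
Proof.
move=> mc hB; rewrite -(RintegralZl (B ^+ 2) measurableT (dot_int f f)).
apply: le_Rintegral => //; first exact: dot_int.
  exact: (integrableZl measurableT (B ^+ 2) (dot_int f f)).
move=> p _; rewrite (mulLE f mc) -!expr2 exprMn ler_wpM2r ?sqr_ge0//.
by rewrite -real_normK ?num_real// lerXn2r ?nnegrE// (le_trans _ (hB p)).
Qed.

Lemma mulLB c f g : multiplier c -> mulL c (f - g) = mulL c f - mulL c g.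
Proof.
move=> mc; apply/LfuneqP => p.
have -> : (mulL c f - mulL c g) p = mulL c f p - mulL c g p by [].
by rewrite !mulLE// -mulrBr.
Qed.

Lemma mulLZ c (a : R) f : multiplier c -> mulL c (a *: f) = a *: mulL c f.
Proof.
move=> mc; apply/LfuneqP => p.
have -> : (a *: mulL c f) p = a * mulL c f p by [].
by rewrite !mulLE// mulrCA.
Qed.

Lemma mul2Z c (a : R) u : multiplier c -> mul2 c (a *: u) = a *: mul2 c u.
Proof. by move=> mc; rewrite /mul2 /= !mulLZ. Qed.

Lemma form_cvg_mulL c (fn : nat -> L) f : multiplier c -> form_cvg (@dot _ _ _ _) fn f ->
  form_cvg (@dot _ _ _ _) (fun n => mulL c (fn n)) (mulL c f).
Proof.
move=> mc hf; have [_ [B hB]] := mc; rewrite /form_cvg.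
apply: (@squeeze_cvgr _ _ _ _ (fun=> 0) (fun n => B ^+ 2 * dot (fn n - f) (fn n - f))).
- by apply: nearW => n; rewrite dot_ge0 -mulLB// dot_mulL_le.
- exact: cvg_cst.
- by rewrite -(mulr0 (B ^+ 2)); apply: cvgM; [exact: cvg_cst|exact: hf].
Qed.

Lemma form_cvg_mul2 c (un : nat -> E) u : multiplier c -> form_cvg (@dot2 _ _ _ _) un u ->
  form_cvg (@dot2 _ _ _ _) (fun n => mul2 c (un n)) (mul2 c u).
Proof.
by move=> mc /form_cvg_dot2P[h1 h2]; apply/form_cvg_dot2P; split; exact: form_cvg_mulL.
Qed.

Lemma dot_ae_eq f g f' g' : {ae leb2, forall p, f p * g p = f' p * g' p} ->
  dot f g = dot f' g'.
Proof.
move=> h; congr fine; apply: ae_eq_integral => //.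
- by apply/measurable_EFinP; apply: measurable_funM; exact: measurable_Lsp.
- by apply/measurable_EFinP; apply: measurable_funM; exact: measurable_Lsp.
- by move: h; apply: filterS => p e _; congr EFin.
Qed.

Section Weighted.
Variables (V W : PT -> R) (A q : R).
Hypothesis Vc : continuous (V : R * R -> R).
Hypothesis VA : forall p, `|V p| <= A.
Hypothesis mW : measurable_fun setT W.
Hypothesis W_ge0 : forall p, 0 <= W p.
Hypothesis VW : forall p, W p != 0 -> `|V p| <= q * W p ^+ 2.
Hypothesis W0 : {ae leb2, forall p, W p = 0 -> V p = 0}.

(** Quotients by [W] are 0 where [W] vanishes, so [k] is [|V|] off the zeros of [W] and 0 on them;
    by [W0] the difference is negligible. The source term uses [b] and the perturbation uses the
    signed [b']; they have the same square. *)
Let b p := `|V p| / W p.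
Let b' p := V p / W p.
Let k p := W p * b p.

Lemma multiplier_V : multiplier V.
Proof. by split; [exact: continuous_measurable_plane|exists A]. Qed.

Lemma continuous_absV : continuous (fun p : R * R => `|V p|).
Proof. by move=> p; apply: cvg_norm; exact: Vc. Qed.

Lemma multiplier_absV : multiplier (fun p => `|V p|).
Proof.
split; first exact: (continuous_measurable_plane continuous_absV).
by exists A => p; rewrite normr_id.
Qed.

Lemma k_cases p : (W p != 0 /\ k p = `|V p|) \/ (W p = 0 /\ k p = 0).
Proof.
rewrite /k /b; have [->|w0] := eqVneq (W p) 0; first by right; rewrite mul0r.
by left; rewrite mulrCA divff// mulr1.
Qed.

Lemma k_bounds p : 0 <= k p <= A.
Proof.
have A0 : 0 <= A by apply: le_trans (VA p).
by case: (k_cases p) => [[_ ->]|[_ ->]]; rewrite ?lexx ?normr_ge0 ?VA.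
Qed.

(** This is [|V| <= q W^2] multiplied by [|V| / W^2]. It also keeps the quotient [b] bounded
    although [1 / W] need not be. *)
Lemma b_sqr_le p : b p ^+ 2 <= q * k p.
Proof.
have [[w0 ->]|[w0 ->]] := k_cases p; last by rewrite /b w0 invr0 !mulr0 expr0n.
have w2 : 0 < W p ^+ 2 by rewrite exprn_even_gt0.
rewrite /b expr_div_n ler_pdivrMr// (mulrC q) -mulrA [leLHS]expr2 ler_wpM2l//.
exact: VW.
Qed.

Lemma b'_sqr p : b' p ^+ 2 = b p ^+ 2.
Proof. by rewrite /b' /b !expr_div_n real_normK// num_real. Qed.

Lemma measurable_invW : measurable_fun setT (fun p => (W p)^-1).
Proof.
have -> : (fun p => (W p)^-1) = (fun p => W p `^ (- 1)) by apply/funext => p; rewrite powR_inv1.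
exact: measurableT_comp (measurable_powR _) mW.
Qed.

Lemma multiplier_k : multiplier k.
Proof.
split.
  apply: measurable_funM => //; apply: measurable_funM measurable_invW.
  exact: multiplier_absV.1.
by exists A => p; have /andP[k0 kA] := k_bounds p; rewrite ger0_norm.
Qed.

Lemma b_le p : `|b p| <= Num.sqrt (`|q| * A).
Proof.
rewrite -sqrtr_sqr ler_wsqrtr// (le_trans (b_sqr_le p))//.
have /andP[k0 kA] := k_bounds p.
by rewrite (le_trans (ler_wpM2r k0 (ler_norm q)))// ler_wpM2l.
Qed.

Lemma multiplier_b : multiplier b.
Proof.
split; first by apply: measurable_funM measurable_invW; exact: multiplier_absV.1.
by exists (Num.sqrt (`|q| * A)); exact: b_le.
Qed.

Lemma multiplier_b' : multiplier b'.
Proof.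
split; first by apply: measurable_funM measurable_invW; exact: multiplier_V.1.
exists (Num.sqrt (`|q| * A)) => p.
by rewrite -sqrtr_sqr b'_sqr sqrtr_sqr b_le.
Qed.

(** [k] need not be continuous, but [|V|] is, and it preserves continuous functions of bounded
    support; the two multiplications agree almost everywhere. *)
Lemma mul_k_cc_closure f : cc_closure f -> cc_closure (mulL k f).
Proof.
move=> [phi [cphi lphi]]; exists (fun n => mulL (fun p => `|V p|) (phi n)); split.
  move=> n; rewrite (mulLE _ multiplier_absV).
  exact: (ccM continuous_absV (cphi n)).
have -> : mulL k f = mulL (fun p => `|V p|) f + (mulL k f - mulL (fun p => `|V p|) f).
  by rewrite addrC subrK.
apply: (form_cvg_shift (@dotC _ _ _ _) (@dotDl _ _ _ _) (@dotZl _ _ _ _) (@dot_ge0 _ _ _ _)).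
  exact: form_cvg_mulL multiplier_absV lphi.
apply: dot_ae0; move: W0; apply: filterS => p h.
have -> : (mulL k f - mulL (fun p => `|V p|) f) p = mulL k f p - mulL (fun p => `|V p|) f p by [].
rewrite (mulLE _ multiplier_absV) (mulLE _ multiplier_k).
by have [[_ ->]|[/h -> ->]] := k_cases p; rewrite ?normr0 subrr.
Qed.

Variables (F : R -> R) (l C : R).
Hypothesis hF : cutoff F.
Hypothesis C0 : 0 <= C.
Hypothesis weighted_bound : forall (n : R) (h f v : E), 0 < n -> dot2 h h = 1 ->
  f.1 = (fun p => W p * h.1 p) :> (PT -> R) -> f.2 = (fun p => W p * h.2 p) :> (PT -> R) ->
  h0_graph v (f + l *: v + n *: rot v) ->
  exists w : E, [/\ w.1 = (fun p => W p * v.1 p) :> (PT -> R),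
    w.2 = (fun p => W p * v.2 p) :> (PT -> R) & dot2 w w <= C ^+ 2].
Hypothesis qC : q * C < 1.

Lemma weighted_energy (n : R) u : 0 < n -> h0_graph u (l *: u - mul2 V u) ->
  cc_closure u.1 -> cc_closure u.2 ->
  dot2 (mul2 b u) (mul2 b u) = 1 ->
  dot2 (mul2 k u) u <= C + Num.sqrt (n * C) * Num.sqrt (dot2 u u).
Proof.
move=> n0 hu c1 c2 b1.
have [v hv] := resolvent_solution l hF (lt0r_neq0 n0)
  (mul_k_cc_closure c1 : cc_closure (mul2 k u).1) (mul_k_cc_closure c2 : cc_closure (mul2 k u).2).
have bE f := mulLE f multiplier_b; have kE f := mulLE f multiplier_k.
have b'E f := mulLE f multiplier_b'; have VE f := mulLE f multiplier_V.
have [w [w1 w2 wC]] : exists w : E, [/\ w.1 = (fun p => W p * v.1 p) :> (PT -> R),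
    w.2 = (fun p => W p * v.2 p) :> (PT -> R) & dot2 w w <= C ^+ 2].
  apply: (weighted_bound n0 b1 _ _ hv); rewrite /mul2 /= bE kE;
    by apply/funext => p; rewrite /k mulrA.
have wC' : Num.sqrt (dot2 w w) <= C.
  by rewrite -(ger0_norm C0) -sqrtr_sqr ler_wsqrtr.
have b'1 : dot2 (mul2 b' u) (mul2 b' u) = 1.
  have h f : dot (mulL b' f) (mulL b' f) = dot (mulL b f) (mulL b f).
    apply: eq_Rintegral => p _; rewrite bE b'E mulrACA [RHS]mulrACA.
    by have := b'_sqr p; rewrite !expr2 => ->.
  by rewrite -b1 /dot2 !h.
have S := h0_graph_sym hv hu.
rewrite !dDl !dZl -scaleN1r (formDr dC dDl) !(formZr dC dZl) in S.
(* The weight moves from the potential to [v], which is what brings in the bounded quantity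
   [W v]. *)
have VB : dot2 v (mul2 V u) = dot2 w (mul2 b' u).
  rewrite /dot2 /mul2 /=; congr (_ + _); apply: dot_ae_eq; move: W0; apply: filterS => p h;
  rewrite VE b'E ?w1 ?w2 /b'; have [w0|w0] := eqVneq (W p) 0; rewrite ?(h w0) ?w0 ?(mul0r, mulr0)//;
  by field.
have kb : dot2 (mul2 k u) (rot v) = dot2 (mul2 b u) (rot w).
  have oppE (g : L) p : (- g) p = - g p by [].
  rewrite /dot2 /mul2 /rot /=; congr (_ + _); apply: eq_Rintegral => p _;
    rewrite kE bE ?oppE ?w1 ?w2 /k; by ring.
(* The imaginary part of the resolvent equation paired with [v]: it expresses [n |v|^2] through the
   source, hence bounds it by [C]. *)
have RS := h0_graph_rot_self hv.
rewrite !dDl !dZl (dC v (rot v)) dot2_rot_self dot2_rotrot mulr0 addr0 kb in RS.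
have B1 := form_le_sqrt dC dDl dZl dge (mul2 b u) (rot w).
rewrite b1 sqrtr1 mul1r dot2_rotrot in B1.
have B2 := form_le_sqrt dC dDl dZl dge w (mul2 b' u).
rewrite b'1 sqrtr1 mulr1 -VB in B2.
have B3 := form_le_sqrt dC dDl dZl dge (rot v) u.
rewrite dot2_rotrot in B3.
(* [n |v|] is the square root of [n] times [n |v|^2]. It tends to 0 with [n] although [|v|] itself
   may blow up. *)
have vn : n * Num.sqrt (dot2 v v) <= Num.sqrt (n * C).
  rewrite -[X in X * _](ger0_norm (ltW n0)) -sqrtr_sqr -sqrtrM ?sqr_ge0//.
  apply: ler_wsqrtr; rewrite expr2 -mulrA ler_wpM2l ?(ltW n0)//.
  have := le_trans B1 wC'; rewrite ler_norml => /andP[h _].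
  by move: RS h; move: (dot2 (mul2 b u) _) (n * _) => x y; lra.
have su : 0 <= Num.sqrt (dot2 u u) by exact: sqrtr_ge0.
have H1 : - (n * dot2 (rot v) u) <= Num.sqrt (n * C) * Num.sqrt (dot2 u u).
  apply: le_trans (ler_wpM2r su vn); rewrite -mulrN -mulrA ler_wpM2l ?(ltW n0)//.
  by apply: le_trans B3; rewrite -normrN ler_norm.
have H2 : - dot2 v (mul2 V u) <= C.
  by apply: le_trans wC'; apply: le_trans B2; rewrite -normrN ler_norm.
rewrite (_ : dot2 (mul2 k u) u = - dot2 v (mul2 V u) + - (n * dot2 (rot v) u)); first exact: lerD.
move: S; move: (dot2 _ _) (dot2 _ _) (dot2 _ _) (dot2 _ _) => x y z t; lra.
Qed.

Lemma weighted_vanish u : h0_graph u (l *: u - mul2 V u) -> dot2 (mul2 b u) (mul2 b u) = 0.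
Proof.
move=> hu0; apply/eqP; apply: contraT => nb.
set s := dot2 _ _ in nb.
have s0 : 0 < s by rewrite lt_neqAle eq_sym nb dge.
(* The weighted bound is stated for sources of norm 1, so [u] is rescaled until [b u] has norm 1. *)
pose x : E := (Num.sqrt s)^-1 *: u.
have hx : h0_graph x (l *: x - mul2 V x).
  have := h0_graphZ (Num.sqrt s)^-1 hu0.
  by rewrite /x (mul2Z _ _ multiplier_V) scalerBr !scalerA (mulrC l).
have b1 : dot2 (mul2 b x) (mul2 b x) = 1.
  have alg (t : R) : 0 < t -> (Num.sqrt t)^-1 * ((Num.sqrt t)^-1 * t) = 1.
    by move=> t0; rewrite mulrA -invfM -expr2 (sqr_sqrtr (ltW t0)) mulVf// gt_eqF.
  have gen (y : E) (r : R) : dot2 (r *: y) (r *: y) = r * (r * dot2 y y).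
    by rewrite dZl (formZr dC dZl).
  have e1 : mul2 b x = (Num.sqrt s)^-1 *: mul2 b u := mul2Z _ _ multiplier_b.
  rewrite e1; exact (etrans (gen _ _) (alg _ s0)).
have [phi [tp xp _]] := hx; have /form_cvg_dot2P[xp1 xp2] := xp.
have c1 : cc_closure x.1 by exact: (ex_intro _ (fun n => (phi n).1) (conj (fun n => cc_rtest (tp n).1) xp1)).
have c2 : cc_closure x.2 by exact: (ex_intro _ (fun n => (phi n).2) (conj (fun n => cc_rtest (tp n).2) xp2)).
set N := dot2 (mul2 k x) x.
have NC : N <= C.
  have lim : C + Num.sqrt (eps n * C) * Num.sqrt (dot2 x x) @[n --> \oo] --> C + Num.sqrt (0 * C) * Num.sqrt (dot2 x x).
    apply: cvgD; first exact: cvg_cst.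
    apply: cvgM; last exact: cvg_cst.
    have e0 : eps n * C @[n --> \oo] --> 0 * C by apply: cvgM; [exact: eps_cvg0|exact: cvg_cst].
    by have := cvg_comp _ _ e0 (@sqrt_continuous _ (0 * C)).
  rewrite mul0r sqrtr0 mul0r addr0 in lim.
  have cN : (fun _ : nat => N) @ \oo --> N by exact: cvg_cst.
  apply: (ler_cvg_to cN lim); apply: nearW => n.
  exact: (weighted_energy (eps_gt0 n) hx c1 c2 b1).
have qN : 1 <= q * N.
  rewrite -b1 /N /dot2 mulrDr.
  have h f : dot (mulL b f) (mulL b f) <= q * dot (mulL k f) f.
    rewrite -(RintegralZl q measurableT (dot_int (mulL k f) f)).
    apply: le_Rintegral => //; first exact: dot_int.
      exact: (integrableZl measurableT q (dot_int (mulL k f) f)).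
    move=> p _; rewrite (mulLE f multiplier_b) (mulLE f multiplier_k).
    rewrite -expr2 exprMn -[k p * f p * f p]mulrA mulrA -expr2 ler_wpM2r ?sqr_ge0//.
    exact: b_sqr_le.
  exact (lerD (h x.1) (h x.2)).
have [q0|q0] := leP 0 q.
  (* Here [1 <= q * N <= q * C < 1]. In the other case [q] is negative, and [b ^+ 2 <= q * k] makes
     [b] vanish identically. *)
  by have := le_lt_trans (le_trans qN (ler_wpM2l q0 NC)) qC; rewrite ltxx.
have b0 p : b p = 0.
  apply/eqP; rewrite -sqrf_eq0 eq_le sqr_ge0 andbT (le_trans (b_sqr_le p))//.
  by have /andP[kp _] := k_bounds p; exact: mulr_le0_ge0 (ltW q0) kp.
suff : dot2 (mul2 b x) (mul2 b x) = 0 by rewrite b1 => /eqP; rewrite oner_eq0.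
have z f : dot (mulL b f) (mulL b f) = 0.
  apply: dot_ae0; apply: nearW => p; by rewrite (mulLE f multiplier_b) b0 mul0r.
exact: (etrans (congr2 +%R (z x.1) (z x.2)) (addr0 0)).
Qed.

Theorem perturbed_no_eigenvalue u : h0_graph u (l *: u - mul2 V u) -> dot2 u u = 0.
Proof.
move=> hu; have := weighted_vanish hu; rewrite {1}/dot2 => /eqP.
rewrite paddr_eq0 ?dot_ge0// => /andP[/eqP/dot_eq0 b1 /eqP/dot_eq0 b2].
have z f : {ae leb2, forall p, mulL b f p = 0} -> dot (mulL V f) (mulL V f) = 0.
  move=> hb; apply: dot_ae0; move: W0 hb; apply: filterS2 => p h.
  rewrite (mulLE f multiplier_b) (mulLE f multiplier_V) /b.
  have [w0 _|w0] := eqVneq (W p) 0; first by rewrite (h w0) mul0r.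
  move/eqP; rewrite !mulf_eq0 invr_eq0 (negPf w0) orbF normr_eq0 => /orP[/eqP ->|/eqP ->].
    by rewrite mul0r.
  by rewrite mulr0.
have V0 : dot2 (mul2 V u) (mul2 V u) = 0 by exact: (etrans (congr2 +%R (z u.1 b1) (z u.2 b2)) (addr0 0)).
apply: (@h0_no_eigenvalue _ l).
by have := h0_graph_shift hu V0; rewrite subrK.
Qed.

End Weighted.

End Multiplier.

(** * Back to complex functions *)

Section ComplexFunctions.
Context {R : realType}.
Local Notation PT := (measurableTypeR R * measurableTypeR R)%type.
Local Notation L := (Lsp (@leb2 R)).
Local Notation E := (L * L)%type.
Local Notation cfun := (R * R -> R[i]).
Implicit Types (u v g phi : cfun) (w : E).
Local Open Scope complex_scope.

Definition toE u : E := (toL (fun p => complex.Re (u p)), toL (fun p => complex.Im (u p))).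
Definition ofE w : cfun := fun p => w.1 p +i* w.2 p.

Lemma toE1 u : L2 u -> (toE u).1 = (fun p => complex.Re (u p)) :> (PT -> R).
Proof. by move=> [h _]; exact: toLspE h. Qed.

Lemma toE2 u : L2 u -> (toE u).2 = (fun p => complex.Im (u p)) :> (PT -> R).
Proof. by move=> [_ h]; exact: toLspE h. Qed.

Lemma L2_ofE w : L2 (ofE w).
Proof. by split; exact: LfunP. Qed.

Lemma ofEK w : toE (ofE w) = w.
Proof.
have e1 : (toE (ofE w)).1 = w.1 by apply/LfuneqP => p; rewrite (toE1 (L2_ofE w)).
have e2 : (toE (ofE w)).2 = w.2 by apply/LfuneqP => p; rewrite (toE2 (L2_ofE w)).
by rewrite [LHS]surjective_pairing e1 e2 -surjective_pairing.
Qed.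

Lemma complex_eta (z : R[i]) : complex.Re z +i* complex.Im z = z.
Proof. by case: z. Qed.

Lemma toEK u : L2 u -> ofE (toE u) = u.
Proof.
move=> hu; apply/funext => p; rewrite /ofE (toE1 hu) (toE2 hu).
exact: complex_eta.
Qed.

Lemma ofEB w w' : ofE (w - w') = (fun p => ofE w p - ofE w' p).
Proof. by apply/funext => p. Qed.

Lemma L2B u v : L2 u -> L2 v -> L2 (fun p => u p - v p) /\ toE (fun p => u p - v p) = toE u - toE v.
Proof.
move=> hu hv.
have -> : (fun p => u p - v p) = ofE (toE u - toE v) by rewrite ofEB !toEK.
by split; [exact: L2_ofE|exact: ofEK].
Qed.

Lemma normc_sqr (z : R[i]) : Normc.normc z ^+ 2 = complex.Re z ^+ 2 + complex.Im z ^+ 2.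
Proof. by case: z => a b /=; rewrite sqr_sqrtr// addr_ge0// sqr_ge0. Qed.

Lemma normc_ge0 (z : R[i]) : 0 <= Normc.normc z.
Proof. by case: z => a b /=; exact: sqrtr_ge0. Qed.

Lemma L2norm_poweR u :
  L2norm u = ((\int[leb2]_p (complex.Re (u p) ^+ 2 + complex.Im (u p) ^+ 2)%:E) `^ 2^-1)%E.
Proof.
rewrite /L2norm unlock /=; congr (_ `^ _)%E; apply: eq_integral => p _ /=.
by rewrite ger0_norm ?normc_ge0// powR_mulrn ?normc_ge0// normc_sqr.
Qed.

Lemma L2normE u : L2 u -> L2norm u = (Num.sqrt (dot2 (toE u) (toE u)))%:E.
Proof.
move=> hu; rewrite L2norm_poweR -powR12_sqrt ?dot2_ge0// -poweR_EFin; congr (_ `^ _)%E.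
rewrite /dot2 EFinD !dotE -ge0_integralD//.
- by apply: eq_integral => p _; rewrite (toE1 hu) (toE2 hu) -!expr2.
- by move=> p _; rewrite lee_fin -expr2 sqr_ge0.
- by apply/measurable_EFinP; apply: measurable_funM; exact: measurable_Lsp.
- by move=> p _; rewrite lee_fin -expr2 sqr_ge0.
- by apply/measurable_EFinP; apply: measurable_funM; exact: measurable_Lsp.
Qed.

(** [operator_norm] does not ask the image to be square integrable; this recovers it from the
    finiteness of its norm. *)
Lemma L2norm_lty_L2 u : measurable_fun setT (fun p : PT => complex.Re (u p)) ->
  measurable_fun setT (fun p : PT => complex.Im (u p)) -> (L2norm u < +oo)%E -> L2 u.
Proof.
move=> mr mi; rewrite L2norm_poweR => /(lty_poweRy (lt0r_neq0 _)) h.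
have {}h : (\int[leb2]_p (complex.Re (u p) ^+ 2 + complex.Im (u p) ^+ 2)%:E < +oo)%E.
  by apply: h; rewrite invr_gt0.
have mr2 := measurable_funX 2 mr; have mi2 := measurable_funX 2 mi.
have i : leb2.-integrable setT (EFin \o (fun p : PT => complex.Re (u p) ^+ 2 + complex.Im (u p) ^+ 2)).
  apply/integrableP; split; first by apply/measurable_EFinP; exact: measurable_funD.
  rewrite (_ : (\int[leb2]_x _ = \int[leb2]_p (complex.Re (u p) ^+ 2 + complex.Im (u p) ^+ 2)%:E)%E)//.
  by apply: eq_integral => p _ /=; rewrite ger0_norm// addr_ge0// sqr_ge0.
split; apply/Lfun2P; split=> //; apply: le_integrable i => //.
- exact/measurable_EFinP.
- by move=> p _ /=; rewrite lee_fin !ger0_norm ?addr_ge0 ?sqr_ge0// lerDl sqr_ge0.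
- exact/measurable_EFinP.
- by move=> p _ /=; rewrite lee_fin !ger0_norm ?addr_ge0 ?sqr_ge0// lerDr sqr_ge0.
Qed.

Lemma L2norm_cvgP (phi : nat -> cfun) u : (forall n, L2 (phi n)) -> L2 u ->
  (L2norm (fun p => phi n p - u p)%R @[n --> \oo] --> 0)%E <->
  form_cvg (@dot2 _ _ _ _) (fun n => toE (phi n)) (toE u).
Proof.
move=> hphi hu.
have E : (fun n => L2norm (fun p => phi n p - u p)) =
    (fun n => (Num.sqrt (dot2 (toE (phi n) - toE u) (toE (phi n) - toE u)))%:E).
  by apply/funext => n; have [h e] := L2B (hphi n) hu; rewrite L2normE// e.
rewrite E /form_cvg; split=> h.
  have h' : Num.sqrt (dot2 (toE (phi n) - toE u) (toE (phi n) - toE u)) @[n --> \oo] --> (0 : R).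
    have hE : (Num.sqrt (dot2 (toE (phi n) - toE u) (toE (phi n) - toE u)))%:E @[n --> \oo] --> (0 : R)%:E by exact: h.
    exact (fine_cvg hE).
  have -> : (fun n => dot2 (toE (phi n) - toE u) (toE (phi n) - toE u)) =
     (fun n => Num.sqrt (dot2 (toE (phi n) - toE u) (toE (phi n) - toE u)) *
               Num.sqrt (dot2 (toE (phi n) - toE u) (toE (phi n) - toE u))).
    by apply/funext => n; rewrite -expr2 sqr_sqrtr// dot2_ge0.
  by rewrite -[X in _ --> X](mulr0 (0 : R)); exact: cvgM.
apply: cvg_EFin; first exact: nearW.
rewrite -[X in _ --> X]sqrtr0.
by have := cvg_comp _ _ h (@sqrt_continuous R 0).
Qed.

Lemma compact_bsupp (f : R * R -> R) u : compact (closure [set p | u p != 0]) ->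
  (forall p, u p = 0 -> f p = 0) -> bsupp f.
Proof.
move=> /compact_bounded[M [_ hM]] uf; exists (M + 1) => p Mp; apply: uf.
apply/eqP; apply: contraT => up.
have := hM (M + 1); rewrite ltrDl ltr01 => /(_ isT p) h.
have : `|p| <= M + 1 by apply: h; exact: subset_closure.
by rewrite leNgt Mp.
Qed.

Lemma bsupp_compact (f g : R * R -> R) u : bsupp f -> bsupp g ->
  (forall p, f p = 0 -> g p = 0 -> u p = 0) -> compact (closure [set p | u p != 0]).
Proof.
move=> [M hM] [N hN] hu.
pose K : set (R * R) := `[- Num.max M N, Num.max M N] `*` `[- Num.max M N, Num.max M N].
have cK : compact K by apply: compact_setX; exact: segment_compact.
apply: (subclosed_compact (@closed_closure _ _) cK).
have clK : closed K by apply: compact_closed => //; exact: norm_hausdorff.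
have -> : K = closure K by apply/closure_id.
apply: closure_subset => p /= up.
suff pM : `|p| <= Num.max M N by exact: (boxP (Num.max M N) p).2 pM.
rewrite leNgt; apply: contraNN up; rewrite gt_max => /andP[/hM f0 /hN g0].
by apply/eqP; exact: hu.
Qed.

Lemma test_function_test2 phi : test_function phi ->
  rtest (fun p => complex.Re (phi p)) /\ rtest (fun p => complex.Im (phi p)).
Proof.
move=> [ck cs]; split; (split; first by move=> k; have [] := ck k);
  by apply: (compact_bsupp cs) => p ->.
Qed.

Lemma L2_test phi : test_function phi -> L2 phi.
Proof.
move=> /test_function_test2[/cc_rtest[c1 s1] /cc_rtest[c2 s2]].
by split; exact: cc_L2.
Qed.

Lemma test2_toE phi : test_function phi -> test2 (toE phi).
Proof.
move=> h; have [t1 t2] := test_function_test2 h; have h2 := L2_test h.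
by split; [rewrite (toE1 h2)|rewrite (toE2 h2)].
Qed.

Lemma test_function_ofE w : test2 w -> test_function (ofE w).
Proof.
move=> [[c1 s1] [c2 s2]]; split; first by move=> k; split; [exact: c1|exact: c2].
by apply: (bsupp_compact s1 s2) => p /= e1 e2; rewrite /ofE e1 e2.
Qed.

Lemma mul_neg_i (a b : R) : - 'i%C * (a +i* b) = b +i* (- a).
Proof. by apply/eqP; rewrite eq_complex /=; apply/andP; split; apply/eqP; ring. Qed.

Lemma mul_real_complex (c : R) (z : R[i]) :
  c%:C * z = (c * complex.Re z) +i* (c * complex.Im z).
Proof. by case: z => a b; apply/eqP; rewrite eq_complex /=; apply/andP; split; apply/eqP; ring. Qed.

Lemma magnetic_DxE u : magnetic_Dx u = (fun p =>
  (partialx (fun q => complex.Im (u q)) p + p.2 * complex.Re (u p)) +i*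
  (- partialx (fun q => complex.Re (u q)) p + p.2 * complex.Im (u p))).
Proof. by apply/funext => p; rewrite /magnetic_Dx /Dx mul_neg_i mul_real_complex. Qed.

Lemma DyE u : Dy u = (fun p => partialy (fun q => complex.Im (u q)) p +i*
  (- partialy (fun q => complex.Re (u q)) p)).
Proof. by apply/funext => p; rewrite /Dy mul_neg_i. Qed.

Lemma derivable_ymul (f : R * R -> R) (p : R * R) : rtest f ->
  derivable (fun q : R * R => q.2 * f q) p (1, 0) /\ partialx (fun q => q.2 * f q) p = p.2 * partialx f p.
Proof.
move=> hf; apply: scaled_comp_derive; last exact: (rtest_derivable p hf).1.
by move=> h /=; rewrite [h *: 0]mulr0 add0r.
Qed.

Lemma H0_exprE phi p : test_function phi ->
  H0_expr phi p = h0re (fun p => complex.Re (phi p)) (fun p => complex.Im (phi p)) p +i*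
                  h0im (fun p => complex.Re (phi p)) (fun p => complex.Im (phi p)) p.
Proof.
move=> /test_function_test2[]; set f := (fun p => complex.Re (phi p)).
set g := (fun p => complex.Im (phi p)) => tf tg.
have tfx := rtest_partialx tf; have tgx := rtest_partialx tg.
have tfy := rtest_partialy tf; have tgy := rtest_partialy tg.
have [yf yfE] := derivable_ymul p tf; have [yg ygE] := derivable_ymul p tg.
have A1 : partialx (fun q => partialx g q + q.2 * f q) p = partialx (partialx g) p + p.2 * partialx f p.
  by rewrite -yfE; exact: (deriveD (rtest_derivable p tgx).1 yf).
have A2 : partialx (fun q => - partialx f q + q.2 * g q) p = - partialx (partialx f) p + p.2 * partialx g p.
  rewrite -ygE; refine (etrans (deriveD (derivableN (rtest_derivable p tfx).1) yg) _).
  by rewrite (deriveN (rtest_derivable p tfx).1).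
have A3 : partialy (fun q => - partialy f q) p = - partialy (partialy f) p.
  exact: (deriveN (rtest_derivable p tfy).2).
rewrite /H0_expr magnetic_DxE (magnetic_DxE phi) !DyE mul_real_complex /=.
rewrite -/f -/g A1 A2 A3 /h0re /h0im /schrodinger.
rewrite -[complex.Re (phi p)]/(f p) -[complex.Im (phi p)]/(g p).
move: (partialx _ p) (partialx _ p) (partialx _ p) (partialx _ p) (partialy _ p) (partialy _ p) (f p) (g p).
move=> x1 x2 x3 x4 x5 x6 x7 x8.
by apply/eqP; rewrite eq_complex /=; apply/andP; split; apply/eqP; ring.
Qed.

Lemma H0_expr_toE phi : test_function phi -> H0_expr phi = ofE (h0 (toE phi)).
Proof.
move=> h; apply/funext => p; rewrite (H0_exprE _ h) /ofE.
have t := test2_toE h; have h2 := L2_test h.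
by rewrite (h01E t) (h02E t) (toE1 h2) (toE2 h2).
Qed.

Lemma H0_graph u g : L2 u -> L2 g -> h0_graph (toE u) (toE g) -> H0 (u, g).
Proof.
move=> hu hg [phi [tp up gp]]; split=> //=; exists (fun n => ofE (phi n)).
have tf n := test_function_ofE (tp n).
have L n : L2 (H0_expr (ofE (phi n))) by rewrite (H0_expr_toE (tf n)); exact: L2_ofE.
split=> //.
- apply/(L2norm_cvgP (fun n => L2_ofE (phi n)) hu).
  by have -> : (fun n => toE (ofE (phi n))) = phi by apply/funext => n; exact: ofEK.
- apply/(L2norm_cvgP L hg).
  have -> // : (fun n => toE (H0_expr (ofE (phi n)))) = (fun n => h0 (phi n)).
  by apply/funext => n; rewrite (H0_expr_toE (tf n)) !ofEK.
Qed.

(** A bounded multiplier is continuous for the norm, so [V] times the approximating sequence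
    converges and can be subtracted from the images. *)
Lemma H_graph (V : R * R -> R) u g : multiplier (V : PT -> R) -> H V (u, g) ->
  h0_graph (toE u) (toE g - mul2 (V : PT -> R) (toE u)).
Proof.
move=> mV [/= hu hg [phi [tp up gp]]].
have Lp n := L2_test (tp n).
have HE n : (fun p => H0_expr (phi n) p + (V p)%:C * phi n p) =
    ofE (h0 (toE (phi n)) + mul2 (V : PT -> R) (toE (phi n))).
  apply/funext => p; rewrite (H0_expr_toE (tp n)) mul_real_complex /ofE.
  have -> : (h0 (toE (phi n)) + mul2 (V : PT -> R) (toE (phi n))).1 p =
    (h0 (toE (phi n))).1 p + mulL (V : PT -> R) (toE (phi n)).1 p by [].
  have -> : (h0 (toE (phi n)) + mul2 (V : PT -> R) (toE (phi n))).2 p =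
    (h0 (toE (phi n))).2 p + mulL (V : PT -> R) (toE (phi n)).2 p by [].
  by rewrite !(mulLE _ mV) (toE1 (Lp n)) (toE2 (Lp n)).
have LH n : L2 (fun p => H0_expr (phi n) p + (V p)%:C * phi n p) by rewrite HE; exact: L2_ofE.
have {}up := (L2norm_cvgP Lp hu).1 up.
have {}gp := (L2norm_cvgP LH hg).1 gp.
exists (fun n => toE (phi n)); split=> //; first by move=> n; exact: test2_toE.
have -> : (fun n => h0 (toE (phi n))) =
  (fun n => toE (fun p => H0_expr (phi n) p + (V p)%:C * phi n p) + (-1) *: mul2 (V : PT -> R) (toE (phi n))).
  by apply/funext => n; rewrite HE ofEK scaleN1r addrK.
rewrite -[- mul2 _ (toE u)]scaleN1r.
apply: (form_cvgD dC dDl dZl dge) => //.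
apply: (form_cvgZ dC dZl).
exact: form_cvg_mul2.
Qed.

Lemma toE_scale (c : R) u : L2 u -> toE (fun p => c%:C * u p) = c *: toE u.
Proof.
move=> hu; rewrite -[RHS]ofEK; congr toE; apply/funext => p.
have e1 : (c *: toE u).1 p = c * (toE u).1 p by [].
have e2 : (c *: toE u).2 p = c * (toE u).2 p by [].
by rewrite mul_real_complex /ofE e1 e2 (toE1 hu) (toE2 hu).
Qed.

Lemma toE_ae0 u : L2 u -> dot2 (toE u) (toE u) = 0 -> {ae leb2, forall p, u p = 0}.
Proof.
move=> hu /eqP; rewrite paddr_eq0 ?dot_ge0// => /andP[/eqP/dot_eq0 h1 /eqP/dot_eq0 h2].
move: h1 h2; apply: filterS2 => p; rewrite (toE1 hu) (toE2 hu) => e1 e2.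
by rewrite -(complex_eta (u p)) e1 e2.
Qed.

End ComplexFunctions.

(** * The weight and the resolvent bound in real form *)

Section Weight.
Context {R : realType}.
Local Notation PT := (measurableTypeR R * measurableTypeR R)%type.
Local Notation L := (Lsp (@leb2 R)).
Local Notation E := (L * L)%type.
Local Open Scope complex_scope.
Variables (F : R -> R) (eta0 gamma : R).
Hypothesis hF : cutoff F.
Local Notation W := (weight F eta0 gamma).

Lemma bracket_ge1 (t : R) : 1 <= bracket t.
Proof. by rewrite -[leLHS]sqrtr1 ler_wsqrtr// lerDl sqr_ge0. Qed.

Lemma bracket_gt0 (t : R) : 0 < bracket t.
Proof. exact: lt_le_trans ltr01 (bracket_ge1 t). Qed.

Lemma weight_ge0 p : 0 <= W p.
Proof.
have [_ F01 _ _] := hF; have /andP[h _] := F01 (p.2 / eta0).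
by rewrite /weight !mulr_ge0 ?powR_ge0.
Qed.

Lemma measurable_bracket : measurable_fun setT (@bracket R).
Proof.
apply: continuous_measurable_fun => t.
have h : continuous (fun t : R => 1 + t ^+ 2).
  by move=> x; apply: cvgD; [exact: cvg_cst|exact: exprn_continuous].
exact: (continuous_comp (h t) (@sqrt_continuous R _)).
Qed.

Lemma measurable_weight : measurable_fun setT (W : PT -> R).
Proof.
have m1 : measurable_fun setT (fun p : PT => p.1) := @measurable_fst _ _ _ _.
have m2 : measurable_fun setT (fun p : PT => p.2) := @measurable_snd _ _ _ _.
have mF : measurable_fun setT F.
  exact: continuous_measurable_fun (cutoff_cc1 hF).1.
apply: measurable_funM; first apply: measurable_funM.
- apply: (measurableT_comp (measurable_powR (- gamma))).
  by apply: measurableT_comp m2.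
- apply: (measurableT_comp mF); exact: measurable_funM m2 (@measurable_cst _ _ _ _ _ _).
- apply: (measurableT_comp (measurable_powR (- (1 / 2) - gamma / 2))).
  exact: measurableT_comp measurable_bracket m1.
Qed.

(** On this axis the weight takes the conventional value of the power of 0, so statements that
    divide by it hold only off the axis. *)
Lemma axis_negligible : {ae leb2, forall p : PT, p.2 != 0}.
Proof.
exists (setT `*` [set 0]); split.
- exact: measurableX.
- by rewrite leb2X// lebesgue_measure_set1 mule0.
- by move=> p /= h; split=> //=; apply/eqP/negPn/negP.
Qed.

(** The chain [h], [W h], [v], [W v] is an element of the graph of the weighted resolvent at
    [l + i n], so the norm of [W v] is one of the values under the supremum. *)
Lemma weighted_resolvent_bound (r C l n : R) (h f v : E) :
  (weighted_resolvent_sup F eta0 gamma r <= C%:E)%E ->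
  - r <= l <= r -> 0 < n -> dot2 h h = 1 ->
  f.1 = (fun p => W p * h.1 p) :> (PT -> R) -> f.2 = (fun p => W p * h.2 p) :> (PT -> R) ->
  h0_graph v (f + l *: v + n *: rot v) ->
  exists w : E, [/\ w.1 = (fun p => W p * v.1 p) :> (PT -> R),
    w.2 = (fun p => W p * v.2 p) :> (PT -> R) & dot2 w w <= C ^+ 2].
Proof.
move=> hC lr n0 h1 f1 f2 hv.
pose g : R * R -> R[i] := fun p => (W p)%:C * ofE v p.
have gC : (L2norm g <= C%:E)%E.
  apply: le_trans hC.
  apply: (@le_trans _ _ (operator_norm (compose (multiplication W)
      (compose (resolvent H0 (l +i* n)) (multiplication W))))); last first.
    by apply: ereal_sup_ubound; exists (l +i* n) => //; exists l, n; split=> //; left.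
  apply: ereal_sup_ubound; exists (ofE h), g; split=> //.
  - exact: L2_ofE.
  - by rewrite (L2normE (L2_ofE h)) ofEK h1 sqrtr1.
  - exists (ofE v); split=> //.
    exists (fun p => (W p)%:C * ofE h p); split=> //.
    rewrite /resolvent /=.
    have -> : (fun p => (W p)%:C * ofE h p + (l +i* n) * ofE v p) = ofE (f + l *: v + n *: rot v).
      apply/funext => p; rewrite /ofE mul_real_complex /=.
      have e1 : (f + l *: v + n *: rot v).1 p = f.1 p + l * v.1 p + n * - v.2 p by [].
      have e2 : (f + l *: v + n *: rot v).2 p = f.2 p + l * v.2 p + n * v.1 p by [].
      refine (etrans _ (esym (congr2 (fun a b => a +i* b) e1 e2))); rewrite f1 f2.
      by apply/eqP; rewrite eq_complex /=; apply/andP; split; apply/eqP; ring.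
    by apply: H0_graph; [exact: L2_ofE|exact: L2_ofE|rewrite !ofEK].
have gE : g = (fun p => (W p * v.1 p) +i* (W p * v.2 p)).
  by apply/funext => p; rewrite /g mul_real_complex.
have mg (k : L) : measurable_fun setT (fun p : PT => W p * k p).
  exact: measurable_funM measurable_weight (measurable_Lsp k).
have Lg : L2 g.
  apply: L2norm_lty_L2; last exact: le_lt_trans gC (ltry _).
    by rewrite gE; exact: mg.
  by rewrite gE; exact: mg.
exists (toE g); split.
- by rewrite (toE1 Lg) gE.
- by rewrite (toE2 Lg) gE.
- move: gC; rewrite (L2normE Lg) lee_fin => gC.
  have d0 := @dot2_ge0 _ _ _ _ (toE g).
  by rewrite -(sqr_sqrtr d0) lerXn2r ?nnegrE ?sqrtr_ge0// (le_trans _ gC) ?sqrtr_ge0.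
Qed.

End Weight.

(** * The potential against the weight *)

Section Potential.
Context {R : realType}.
Local Notation PT := (measurableTypeR R * measurableTypeR R)%type.
Variables (F : R -> R) (V : R * R -> R) (eta0 s A0 : R).
Hypothesis hF : cutoff F.
Hypothesis heta0 : 0 < eta0.
Hypothesis hs : 1 / 2 < s < 3 / 4.
Hypothesis hA0 : 0 < A0.
Hypothesis hsupp : closure [set p | V p != 0] `<=` [set p | - eta0 <= p.2 <= eta0].
Hypothesis hV : forall x y : R, bracket x `^ (2 * s) * `|V (x, y)| <= A0.
Local Notation gamma := (2 * s - 1).
Local Notation W := (weight F eta0 gamma).

Lemma potential_decay p : `|V p| <= A0 * bracket p.1 `^ (- (2 * s)).
Proof.
have := hV p.1 p.2; rewrite -surjective_pairing mulrC -ler_pdivlMr ?powR_gt0 ?bracket_gt0//.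
by rewrite powRN.
Qed.

Lemma potential_le p : `|V p| <= A0.
Proof.
apply: le_trans (hV p.1 p.2); rewrite -surjective_pairing ler_peMl//.
have s0 : 0 <= 2 * s by move: hs; lra.
by rewrite -[leLHS](powRr0 (bracket p.1)) ler_powR ?bracket_ge1.
Qed.

Lemma potential_strip p : V p != 0 -> `|p.2| <= eta0.
Proof. by move=> Vp; rewrite ler_norml; apply: hsupp; exact: subset_closure. Qed.

(** On the strip the cut-off is 1, and with [gamma = 2 s - 1] the exponent [- 1 / 2 - gamma / 2] is
    [- s]: the square of the weight decays exactly as the potential is assumed to. *)
Lemma weight_strip p : p.2 != 0 -> `|p.2| <= eta0 ->
  0 < W p /\ W p ^+ 2 = `|p.2| `^ (- (2 * gamma)) * bracket p.1 `^ (- (2 * s)).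
Proof.
move=> y0 yeta; have [_ _ F1 _] := hF.
have Fy : F (p.2 / eta0) = 1.
  by apply: F1; rewrite normrM normfV (gtr0_norm heta0) ler_pdivrMr// mul1r.
rewrite /weight Fy mulr1; split.
  by rewrite mulr_gt0// powR_gt0 ?normr_gt0 ?bracket_gt0.
rewrite exprMn -!powR_mulrn ?powR_ge0// -!powRrM; congr (_ `^ _ * _ `^ _); [by ring|by field].
Qed.

(** The brackets cancel, and what is left is [|y|^(2 gamma) <= eta0^(2 gamma)] on the strip, which
    needs [gamma] positive, that is [s > 1 / 2]. *)
Lemma potential_le_weight p : W p != 0 -> `|V p| <= A0 * eta0 `^ (2 * gamma) * W p ^+ 2.
Proof.
move=> Wp; have [->|Vp] := eqVneq (V p) 0.
  rewrite normr0; apply: mulr_ge0 (sqr_ge0 _).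
  exact: mulr_ge0 (ltW hA0) (powR_ge0 _ _).
have g0 : 0 < gamma by move: hs; lra.
(* A power of 0 with nonzero exponent is 0, so the weight vanishes on the axis. *)
have y0 : p.2 != 0.
  apply: contraNN Wp => /eqP y0; rewrite /weight y0 normr0 powR0 ?mul0r//.
  by rewrite oppr_eq0 gt_eqF.
have yeta := potential_strip Vp; have [_ ->] := weight_strip y0 yeta.
apply: le_trans (potential_decay p) _; rewrite -mulrA ler_wpM2l ?(ltW hA0)//.
rewrite mulrA ler_peMl ?powR_ge0// powRN ler_pdivlMr ?powR_gt0 ?normr_gt0// mul1r.
by apply: ge0_ler_powR; rewrite ?nnegrE ?normr_ge0 ?(ltW heta0)// mulr_ge0// (ltW g0).
Qed.

Lemma weight_zero_potential : {ae leb2, forall p : PT, W p = 0 -> V p = 0}.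
Proof.
move: (@axis_negligible R); apply: filterS => p y0 w0.
apply/eqP; apply: contraT => Vp.
by have [h _] := weight_strip y0 (potential_strip Vp); rewrite w0 ltxx in h.
Qed.

End Potential.

Unset Implicit Arguments.
Set Strict Implicit.
Set Printing Implicit Defensive.
Local Open Scope complex_scope.

Theorem theorem1p3 (R : realType)
    (F : R -> R) (hF : cutoff F)
    (C1 C2 : R) (hC1 : 0 < C1) (hC2 : 0 < C2)
    (C : R -> R -> R)
    (V : R * R -> R) (eta0 s A0 A1 : R)
    (hVc : continuous V)
    (hVd : forall p, derivable V p (1, 0))
    (hVdc : continuous (partialx V))
    (heta0 : 0 < eta0) (hs : 1 / 2 < s < 3 / 4)
    (hA0 : 0 < A0) (hA1 : 0 < A1)
    (hsupp : closure [set p | V p != 0] `<=`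
             [set p | - eta0 <= p.2 <= eta0])
    (hV : forall x y : R, bracket x `^ (2 * s) * `|V (x, y)| <= A0)
    (hdV : forall x y : R, bracket x * `|partialx V (x, y)| <= A1) :
  let gamma := 2 * s - 1 in
  let Rmax := Num.max (R1 C1 V) (R2 C2 V) in
  point_spectrum (H V) `&`
    [set lambda%:C | lambda in
      `]-oo, (- R1 C1 V)[ `|` `](R2 C2 V), +oo[] = set0 ->
  0 < C Rmax gamma ->
  (weighted_resolvent_sup F eta0 gamma Rmax <= (C Rmax gamma)%:E)%E ->
  eta0 `^ (2 * gamma) * C Rmax gamma * A0 < 1 ->
  forall lambda : R, ~ point_spectrum (H V) lambda%:C.
Proof.
move=> gamma Rmax hspec hC hsup hq lambda hl.
have lr : - Rmax <= lambda <= Rmax.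
  have notout : ~ (`]-oo, (- R1 C1 V)[ `|` `](R2 C2 V), +oo[) lambda.
    move=> hout; have : set0 lambda%:C by rewrite -hspec; split=> //; exists lambda.
    by [].
  have l1 : - R1 C1 V <= lambda.
    by rewrite leNgt; apply/negP => h; apply: notout; left; rewrite /= in_itv.
  have l2 : lambda <= R2 C2 V.
    by rewrite leNgt; apply/negP => h; apply: notout; right; rewrite /= in_itv /= andbT.
  apply/andP; split; last by rewrite le_max l2 orbT.
  by apply: le_trans l1; rewrite lerN2 le_max lexx.
have [u [hu unz hH]] := hl; apply: unz.
have mV : multiplier (V : measurableTypeR R * measurableTypeR R -> R).
  exact: (multiplier_V hVc (potential_le hs hV)).
apply: (toE_ae0 hu).
have := H_graph mV hH; rewrite (toE_scale lambda hu) => hg.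
have qC : A0 * eta0 `^ (2 * gamma) * C Rmax gamma < 1.
  by move: hq; move: (eta0 `^ _) (C _ _) => x y h; rewrite -mulrA mulrC.
exact (perturbed_no_eigenvalue hVc (potential_le hs hV) (measurable_weight eta0 gamma hF)
  (weight_ge0 eta0 gamma hF) (potential_le_weight hF heta0 hs hA0 hsupp hV)
  (weight_zero_potential s hF heta0 hsupp) hF (ltW hC)
  (fun n h f v n0 h1 f1 f2 hv => weighted_resolvent_bound hF hsup lr n0 h1 f1 f2 hv) qC hg).
Qed.
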